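(* Let $p>1$. There exists a constant $C>0$ such that the following holds for every $0<\epsilon<\frac14$. Let $\rho$ be the solution on $\mathbb{T}^2$, for $t\in[0,1]$, of $$\partial_t\rho+v\cdot\nabla\rho=0,\qquad \nabla\cdot v=0,\qquad \rho|_{t=0}=1_{[0,1/2]}(x_2),$$ and suppose that $\left\|\rho|_{t=1}-\tfrac12\right\|_{H^{-1}}\le\epsilon$. Then the velocity field $v$ satisfies $$\int_0^1\|\nabla v(t)\|_{L^p}\,dt\ \ge\ C\,|\log(\epsilon)|.$$
   Context: $\mathbb{T}^2=\mathbb{R}^2/\mathbb{Z}^2$, with coordinates $(x_1,x_2)\in[0,1)^2$. The time-dependent divergence-free velocity field $v$ is assumed sufficiently regular that the transport equation has a unique solution, which is transported by the measure-preserving flow of $v$. The norm is $\|f\|_{H^{-1}}^2=\sum_{k\in\mathbb{Z}^2}(1+|k|^2)^{-1}|\hat f(k)|^2$, with $\hat f(k)$ the Fourier coefficients of $f$. *)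

(* Defs.v *)
From HB Require Import structures.
From mathcomp Require Import all_boot all_order all_algebra.
From mathcomp Require Import all_classical all_reals all_analysis.
From mathcomp Require Import complex.

Set Implicit Arguments.
Unset Strict Implicit.
Unset Printing Implicit Defensive.

Import Order.TTheory GRing.Theory Num.Theory.
Import numFieldNormedType.Exports.

Local Open Scope classical_set_scope.
Local Open Scope ring_scope.

(* Functions on the torus T^2 = R^2 / Z^2 are the Z^2-periodic functions on
   R * R, and integrals over T^2 are integrals over the unit square Q. *)
Notation leb R := (@lebesgue_measure R).
Notation leb2 R := (leb R \x leb R)%E.

Definition I01 {R : realType} : set R := `[0, 1].

Definition Q {R : realType} : set (R * R) := `[0, 1[ `*` `[0, 1[.

Definition Z2_periodic {R : realType} {A : Type} (f : R * R -> A) : Prop :=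
  forall (x : R * R) (k l : int), f (x.1 + k%:~R, x.2 + l%:~R) = f x.

Definition ae_torus {R : realType} (P : R * R -> Prop) : Prop :=
  {ae leb2 R, forall x, Q x -> P x}.

Definition ae_time {R : realType} (P : R -> Prop) : Prop :=
  {ae leb R, forall t, I01 t -> P t}.

Definition d1 {R : realType} (f : R * R -> R) (x : R * R) : R :=
  'D_((1, 0) : R * R) f x.
Definition d2 {R : realType} (f : R * R -> R) (x : R * R) : R :=
  'D_((0, 1) : R * R) f x.

Fixpoint Cn {R : realType} (n : nat) (f : R * R -> R) : Prop :=
  if n is m.+1 then
    [/\ continuous f,
        (forall x, derivable f x ((1, 0) : R * R)) /\
        (forall x, derivable f x ((0, 1) : R * R)),
        Cn m (d1 f) & Cn m (d2 f)]
  else continuous f.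

Definition test_function {R : realType} (phi : R * R -> R) : Prop :=
  Z2_periodic phi /\ forall n, Cn n phi.

Definition integrable_torus {R : realType} (u : R * R -> R) : Prop :=
  (leb2 R).-integrable Q (EFin \o u).

(* [G x = (d1 u x, d2 u x)] in the sense of distributions *)
Definition weak_gradient {R : realType} (u : R * R -> R)
    (G : R * R -> R * R) : Prop :=
  [/\ integrable_torus u,
      integrable_torus (fun x => (G x).1),
      integrable_torus (fun x => (G x).2)
    & forall phi, test_function phi ->
        \int[leb2 R]_(x in Q) (u x * d1 phi x)
          = - (\int[leb2 R]_(x in Q) ((G x).1 * phi x)) /\
        \int[leb2 R]_(x in Q) (u x * d2 phi x)
          = - (\int[leb2 R]_(x in Q) ((G x).2 * phi x))].

(* A 2 x 2 matrix is given by its pair of rows; this is the Frobenius norm. *)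
Definition matrix_norm {R : realType} (A : (R * R) * (R * R)) : R :=
  Num.sqrt (A.1.1 ^+ 2 + A.1.2 ^+ 2 + A.2.1 ^+ 2 + A.2.2 ^+ 2).

Definition Lp_norm {R : realType} (p : R) (A : R * R -> (R * R) * (R * R))
    : \bar R :=
  'N[leb2 R]_(p%:E)[(fun x => (matrix_norm (A x))%:E) \_ Q]%E.

(* [v] is in L^1([0,1] x T^2), divergence free, with spatial gradient [Dv]:
   the rows of [Dv t x] are the gradients of the two components of [v t]. *)
Definition velocity_field {R : realType} (v : R -> R * R -> R * R)
    (Dv : R -> R * R -> (R * R) * (R * R)) : Prop :=
  [/\ forall t, Z2_periodic (v t) /\ Z2_periodic (Dv t),
      measurable_fun (I01 `*` setT) (fun z : R * (R * R) => v z.1 z.2) /\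
      measurable_fun (I01 `*` setT) (fun z : R * (R * R) => Dv z.1 z.2),
      (leb R \x leb2 R)%E.-integrable (I01 `*` Q)
        (fun z : R * (R * R) => (v z.1 z.2).1%:E) /\
      (leb R \x leb2 R)%E.-integrable (I01 `*` Q)
        (fun z : R * (R * R) => (v z.1 z.2).2%:E),
      ae_time (fun t => weak_gradient (fun x => (v t x).1) (fun x => (Dv t x).1)
                     /\ weak_gradient (fun x => (v t x).2) (fun x => (Dv t x).2))
    & ae_time (fun t => ae_torus (fun x => (Dv t x).1.1 + (Dv t x).2.2 = 0))].

(* Bounded weak solutions on [0,1] of  d_t rho + v . grad rho = 0, that is
   d_t rho + div (v rho) = 0 since div v = 0, with initial datum [rho0].  The
   equation is integrated in time, which selects the representative that is
   weakly continuous in time and so gives a meaning to each [rho t]. *)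
Definition transport_solution {R : realType} (v : R -> R * R -> R * R)
    (rho0 : R * R -> R) (rho : R -> R * R -> R) : Prop :=
  [/\ forall t, Z2_periodic (rho t),
      measurable_fun (I01 `*` setT) (fun z : R * (R * R) => rho z.1 z.2),
      exists M : R, forall t, I01 t ->
        ae_torus (fun x => `|rho t x| <= M),
      ae_torus (fun x => rho 0 x = rho0 x)
    & forall phi t, test_function phi -> I01 t ->
        \int[leb2 R]_(x in Q) (rho t x * phi x)
        = (\int[leb2 R]_(x in Q) (rho 0 x * phi x))
          + \int[leb R]_(s in `[0, t]) (\int[leb2 R]_(x in Q)
              (rho s x * ((v s x).1 * d1 phi x + (v s x).2 * d2 phi x)))].

(* [X t x] is the position at time [t], lifted to R^2, of the trajectory
   starting at [x] in Q.  The last clause says that [X t] modulo Z^2 preserves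
   Lebesgue measure on T^2, Borel sets of T^2 being the periodic ones of R^2. *)
Definition measure_preserving_flow {R : realType} (v : R -> R * R -> R * R)
    (X : R -> R * R -> R * R) : Prop :=
  [/\ measurable_fun (I01 `*` Q) (fun z : R * (R * R) => X z.1 z.2),
      ae_torus (fun x =>
        [/\ (leb R).-integrable I01 (fun s => (v s (X s x)).1%:E),
            (leb R).-integrable I01 (fun s => (v s (X s x)).2%:E)
          & forall t, I01 t ->
              X t x = (x.1 + \int[leb R]_(s in `[0, t]) (v s (X s x)).1,
                       x.2 + \int[leb R]_(s in `[0, t]) (v s (X s x)).2)])
    & forall t, I01 t ->
        forall B : set (R * R), measurable B -> Z2_periodic B ->
          leb2 R (Q `&` X t @^-1` B) = leb2 R (Q `&` B)].

(* The standing regularity assumption on [v]: the solution of the transport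
   equation with datum [rho0] is unique and is transported by the
   measure-preserving flow of [v]. *)
Definition unique_and_transported {R : realType} (v : R -> R * R -> R * R)
    (rho0 : R * R -> R) : Prop :=
  (forall rho rho', transport_solution v rho0 rho ->
     transport_solution v rho0 rho' ->
     forall t, I01 t -> ae_torus (fun x => rho t x = rho' t x)) /\
  (exists2 X, measure_preserving_flow v X &
     forall rho, transport_solution v rho0 rho ->
       forall t, I01 t -> ae_torus (fun x => rho t (X t x) = rho0 x)).

(* The indicator function of {x_2 in [0,1/2]}, for the coordinate x_2 in [0,1);
   it is only ever evaluated on Q. *)
Definition half_strip {R : realType} (x : R * R) : R :=
  \1_(`[0, 2^-1]) x.2.

Definition fourier {R : realType} (f : R * R -> R) (k : int * int) : R[i] :=
  let theta (x : R * R) := 2 * pi * (k.1%:~R * x.1 + k.2%:~R * x.2) in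
  Complex (\int[leb2 R]_(x in Q) (f x * cos (theta x)))
          (- (\int[leb2 R]_(x in Q) (f x * sin (theta x)))).

Definition Hm1_norm {R : realType} (f : R * R -> R) : \bar R :=
  ((\esum_(k in [set: int * int])
     ((1 + (k.1%:~R ^+ 2 + k.2%:~R ^+ 2))^-1 *
      Normc.normc (fourier f k) ^+ 2)%:E) `^ 2^-1)%E.

(* Main.v *)
Require Import Defs.
From HB Require Import structures.
From mathcomp Require Import all_boot all_order all_algebra.
From mathcomp Require Import all_classical all_reals all_analysis.
From mathcomp Require Import measurable_realfun complex.
From mathcomp Require Import ring lra zify.

Set Implicit Arguments.
Unset Strict Implicit.
Unset Printing Implicit Defensive.

Import Order.TTheory GRing.Theory Num.Theory.
Import numFieldNormedType.Exports.

Local Open Scope classical_set_scope.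
Local Open Scope ring_scope.

(** The L^p norm of the gradient controls how fast, on average, two trajectories
    of a measure preserving flow separate or come together on a logarithmic
    scale; mixing a strip down to scale r forces a change of order |log r|.

    The bound on separation.  A function u with weak gradient G in L^p, p > 1,
    satisfies |u x - u y| <= (d + |x - y|) (gam x + gam y) for all x and y, where
    d is any positive scale and the integral of gam is at most C |G|_p, with C
    independent of d ([lusin_lipschitz]).  The function gam is a maximal function
    of |G| over dyadic squares of side at least d, plus |u - (average of u on the
    smallest square)| / d.  The maximal function is bounded by Doob's inequality
    in its L log L form ([doob_L1]), the other term by the Poincare inequality
    ([poincare_avg]).  Dyadic squares only compare points of a common square;
    translating the grid by thirds in each coordinate catches every pair
    ([third_trick]).  The Poincare inequality rests on the fact that u is a
    primitive of G along almost every line ([weak_d1_row]).  The test functions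
    used for this are trigonometric, and they suffice by uniqueness of Fourier
    series ([fourier_uniqueness]).

    Write Z t for the difference of two trajectories, starting from x and y.  Then
    log (d + |Z t|) changes at a rate at most |v (X x) - v (X y)| / (d + |Z t|),
    hence at most gam (X x) + gam (X y).  Since the flow preserves measure,
    integrating over all pairs (x, y) against any weight with marginals at most 1
    bounds the weighted mean of log (d + |Z 0|) - log (d + |Z 1|) by a multiple
    of the time integral of |Dv|_p ([weighted_pathwise_bound]).  Distances are
    measured with the periodic [torus_gauge].

    The choice of weight.  Let f be the solution at time 1 minus 1/2, and K a
    product of two Fejer kernels of order n.  Its Fourier coefficients lie in
    [0, 1] and vanish for frequencies of size n or more, so that the integral of
    f x * f y * K (x - y) is at most 2 n^2 |f|_{H^-1}^2
    ([integral_pair_fejer_le]).  As f takes the values 1/2 and -1/2, this says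
    that the weight K (X_1 x - X_1 y), restricted to the pairs where exactly one
    of x and y starts in the strip, has mass at least 1/4 when n <= 1 / (4 eps)
    ([mix_weight_mass]).  Let n = 1 / d^2.  Under this weight
    log (1 + |Z 1| / d) has mean at most 2, because K concentrates at scale d
    ([mix_log_image_le]).  But Z 0 is at least as long as the distance from x to
    the boundary of the strip, which is rarely small, so log (1 + |Z 0| / d) has
    mean at least c log (1 / d) - c' ([mix_log_ge]).  With d = 2^-L and 4^L about 1 / (4 eps), this
    gives C int |Dv|_p >= |log eps| - C'.

    It remains to see that int |Dv|_p is bounded below when eps is not small.
    The mode e^(2 pi i x_2) of the initial datum has squared amplitude 1 / pi^2,
    while at time 1 it has at most eps^2 <= 1/16; since pi < 4, the mean of
    |cos (2 pi Z_2 1) - cos (2 pi Z_2 0)| is bounded below, and it is bounded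
    above by the same estimate with d = 1 ([universal_lower_bound]). *)

(** * Integration over probability spaces *)

Section bounded_functions.
Context d (T : measurableType d) (R : realType) (mu : probability T R).
Implicit Types f g h : T -> R.

Definition bounded_measurable h :=
  measurable_fun setT h /\ exists M, forall x, `|h x| <= M.

Lemma bounded_measurable_integrable h :
  bounded_measurable h -> mu.-integrable setT (EFin \o h).
Proof.
move=> [mh [M hM]]; apply: measurable_bounded_integrable => //.
- by rewrite /= probability_setT ltry.
- exists M; split; first exact: num_real.
  by move=> y My x _ /=; exact: le_trans (hM x) (ltW My).
Qed.

Lemma integrableM_bounded f h : mu.-integrable setT (EFin \o f) ->
  bounded_measurable h -> mu.-integrable setT (EFin \o (fun x => f x * h x)).
Proof.
move=> fi [mh [M hM]].
have := @integrableMl _ _ _ mu setT measurableT (EFin \o f) h fi mh.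
apply; exists M; split; first exact: num_real.
by move=> y My x _ /=; exact: le_trans (hM x) (ltW My).
Qed.

Lemma integrable_realB f g : mu.-integrable setT (EFin \o f) ->
  mu.-integrable setT (EFin \o g) -> mu.-integrable setT (EFin \o (fun x => f x - g x)).
Proof. by move=> fi gi; exact: (integrableB measurableT fi gi). Qed.

Lemma integrable_realD f g : mu.-integrable setT (EFin \o f) ->
  mu.-integrable setT (EFin \o g) -> mu.-integrable setT (EFin \o (fun x => f x + g x)).
Proof. by move=> fi gi; exact: (integrableD measurableT fi gi). Qed.

Lemma integrable_realZ (c : R) f : mu.-integrable setT (EFin \o f) ->
  mu.-integrable setT (EFin \o (fun x => c * f x)).
Proof. by move=> fi; exact: (integrableZl measurableT c fi). Qed.

Lemma bounded_measurable_cst (c : R) : bounded_measurable (fun=> c).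
Proof. by split; [exact: measurable_cst|exists `|c|]. Qed.

Lemma bounded_measurableD h g : bounded_measurable h -> bounded_measurable g ->
  bounded_measurable (fun x => h x + g x).
Proof.
move=> [mh [M hM]] [mg [N gN]]; split; first exact: measurable_funD.
by exists (M + N) => x; rewrite (le_trans (ler_normD _ _))// lerD.
Qed.

Lemma bounded_measurableM h g : bounded_measurable h -> bounded_measurable g ->
  bounded_measurable (fun x => h x * g x).
Proof.
move=> [mh [M hM]] [mg [N gN]]; split; first exact: measurable_funM.
by exists (M * N) => x; rewrite normrM ler_pM.
Qed.

End bounded_functions.

Section almost_everywhere.
Context d (T : measurableType d) (R : realType) (mu : {measure set T -> \bar R}).

Lemma ae_imp (P P' : T -> Prop) : {ae mu, forall x, P x} ->
  (forall x, P x -> P' x) -> {ae mu, forall x, P' x}.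
Proof. by move=> [N [mN N0 hN]] h; exists N; split=> // x /= n; apply: hN => /= /h. Qed.

Lemma ae_and (P P' : T -> Prop) : {ae mu, forall x, P x} ->
  {ae mu, forall x, P' x} -> {ae mu, forall x, P x /\ P' x}.
Proof.
move=> [N [mN N0 hN]] [M [mM M0 hM]]; exists (N `|` M); split=> [||x /= /not_andP[h|h]].
- exact: measurableU.
- by rewrite null_set_setU.
- by left; exact: hN.
- by right; exact: hM.
Qed.

End almost_everywhere.

Lemma ae_eq_Rintegral d (T : measurableType d) (R : realType) (mu : {measure set T -> \bar R})
    (g h : T -> R) : measurable_fun setT g -> measurable_fun setT h ->
  {ae mu, forall x, g x = h x} -> \int[mu]_x g x = \int[mu]_x h x.
Proof.
move=> mg mh gh; congr fine; apply: ae_eq_integral => //; try exact/measurable_EFinP.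
by apply: (ae_imp gh) => x -> _.
Qed.

Lemma ae_le_Rintegral d (T : measurableType d) (R : realType) (mu : {measure set T -> \bar R})
    (f g : T -> R) : mu.-integrable setT (EFin \o f) -> mu.-integrable setT (EFin \o g) ->
  {ae mu, forall x, f x <= g x} -> \int[mu]_x f x <= \int[mu]_x g x.
Proof.
move=> fi gi fg; rewrite -subr_ge0 -RintegralB//.
have di : mu.-integrable setT (EFin \o (fun x => g x - f x)).
  by have := integrableB measurableT gi fi.
have ni : mu.-integrable setT (EFin \o (fun x => `|g x - f x|)) := integrable_norm di.
rewrite (@ae_eq_Rintegral _ _ _ _ _ (fun x => `|g x - f x|)).
- by apply: Rintegral_ge0.
- by have /measurable_int/measurable_EFinP := di.
- by have /measurable_int/measurable_EFinP := ni.
- by apply: (ae_imp fg) => x h; rewrite ger0_norm// subr_ge0.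
Qed.

Section monotone_integrals.
Context d (T : measurableType d) (R : realType) (mu : {measure set T -> \bar R}).
Local Open Scope ereal_scope.

(** The integral of a nonnegative function is a supremum over the simple functions
    below it, so monotonicity holds even when [g] is not measurable. *)
Lemma ge0_le_integralT (f g : T -> \bar R) : (forall x, 0 <= f x) -> (forall x, f x <= g x) ->
  \int[mu]_x f x <= \int[mu]_x g x.
Proof.
move=> f0 fg; have g0 x : 0 <= g x by exact: le_trans (fg x).
rewrite !ge0_integralTE//; apply: le_ereal_sup => _ /= [h hf <-].
by exists h => // x; exact: le_trans (hf x) (fg x).
Qed.

(** Applied with [g] the function of time [Lp_norm p (Dv t)], whose measurability is
    thus never an issue. *)
Lemma ae_ge0_le_integral_dom (D : set T) (f g : T -> \bar R) : measurable D ->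
  measurable_fun D f -> (forall x, 0 <= f x) -> (forall x, 0 <= g x) ->
  {ae mu, forall x, D x -> f x <= g x} -> \int[mu]_(x in D) f x <= \int[mu]_(x in D) g x.
Proof.
move=> mD mf f0 g0 [N [mN N0 hN]].
rewrite (ge0_negligible_integral mN mD)//.
rewrite [leLHS]integral_mkcond [leRHS]integral_mkcond; apply: ge0_le_integralT.
  by move=> x; rewrite patchE; case: ifP.
move=> x; rewrite !patchE; case: ifPn => [/set_mem[Dx Nx]|]; last by case: ifP.
rewrite mem_set//; have := contra_not (hN x) Nx.
by move=> /contrapT; exact.
Qed.
End monotone_integrals.

Section measure_preserving_maps.
Context d d' (T : measurableType d) (T' : measurableType d') (R : realType).
Variables (mu : {measure set T -> \bar R}) (nu : {measure set T' -> \bar R}).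

Definition preserves (Y : T -> T') :=
  measurable_fun setT Y /\ forall A, measurable A -> mu (Y @^-1` A) = nu A.

Variable Y : T -> T'.
Hypothesis pY : preserves Y.

Let mY : measurable_fun setT Y := pY.1.

Lemma ge0_integral_preserves (f : T' -> \bar R) :
  measurable_fun setT f -> (forall x, 0 <= f x)%E ->
  (\int[mu]_x f (Y x) = \int[nu]_x f x)%E.
Proof.
move=> mf f0; rewrite -[LHS](ge0_integral_pushforward mY mu (D := setT))//.
by apply: eq_measure_integral => A mA _ /=; exact: pY.2.
Qed.

Lemma integrable_preserves (f : T' -> R) :
  nu.-integrable setT (EFin \o f) -> mu.-integrable setT (EFin \o (f \o Y)).
Proof.
move=> /integrableP[mf fi]; apply/integrableP; split.
  exact: (measurableT_comp mf mY).
rewrite (ge0_integral_preserves (f := fun x => `|(f x)%:E|%E))//.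
exact: measurableT_comp.
Qed.

Lemma Rintegral_preserves (f : T' -> R) : nu.-integrable setT (EFin \o f) ->
  \int[mu]_x f (Y x) = \int[nu]_x f x.
Proof.
move=> fi; congr fine.
have mf := measurable_int nu fi.
rewrite -[LHS](integral_pushforward mY mf (D := setT))//; last exact: integrable_preserves.
by apply: eq_measure_integral => A mA _ /=; exact: pY.2.
Qed.

Lemma ae_preserves (P : T' -> Prop) :
  {ae nu, forall x, P x} -> {ae mu, forall x, P (Y x)}.
Proof.
move=> [N [mN N0 hN]]; exists (Y @^-1` N); split.
- by rewrite -[X in measurable X]setTI; exact: mY.
- exact: (etrans (pY.2 _ mN)).
- by move=> x /= h; exact: hN.
Qed.

End measure_preserving_maps.

Lemma preserves_comp d1 d2 d3 (X : measurableType d1) (Y : measurableType d2)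
  (Z : measurableType d3) (R : realType) (mu : {measure set X -> \bar R})
  (nu : {measure set Y -> \bar R}) (xi : {measure set Z -> \bar R}) (f : X -> Y) (g : Y -> Z) :
  preserves mu nu f -> preserves nu xi g -> preserves mu xi (g \o f).
Proof.
move=> [mf pf] [mg pg]; split; first exact: measurableT_comp.
move=> A mA; rewrite comp_preimage pf ?pg//.
by rewrite -[X in measurable X]setTI; exact: mg.
Qed.

Section preserving_products.
Context d1 d2 d3 d4 (X : measurableType d1) (Y : measurableType d2)
  (X' : measurableType d3) (Y' : measurableType d4) (R : realType).
Variables (mu : probability X R) (nu : probability Y R).
Variables (mu' : probability X' R) (nu' : probability Y' R).

Lemma preserves_pair (f : X -> X') (g : Y -> Y') :
  preserves mu mu' f -> preserves nu nu' g ->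
  preserves (mu \x nu)%E (mu' \x nu')%E (fun z : X * Y => (f z.1, g z.2)).
Proof.
move=> [mf pf] [mg pg].
have mY : measurable_fun setT (fun z : X * Y => (f z.1, g z.2)).
  apply: measurable_fun_pair.
  - exact: (measurableT_comp mf measurable_fst).
  - exact: (measurableT_comp mg measurable_snd).
split; [exact: mY|move=> A mA].
pose m : {measure set (X' * Y') -> \bar R} :=
  measure_function_pushforward__canonical__measure_function_Measure (mu \x nu)%E mY.
apply/esym; apply: (@product_measure_unique _ _ _ _ _ mu' nu' m) => // B C mB mC.
rewrite /m/= /pushforward.
have -> : (fun z : X * Y => (f z.1, g z.2)) @^-1` (B `*` C) = (f @^-1` B) `*` (g @^-1` C) by [].
transitivity (mu (f @^-1` B) * nu (g @^-1` C))%E; last by rewrite [X in (X * _)%E]pf// [X in (_ * X)%E]pg.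
apply: product_measure1E; rewrite -[X in measurable X]setTI; [exact: mf|exact: mg].
Qed.

End preserving_products.

Section fubini_real.
Context d1 d2 (X : measurableType d1) (Y : measurableType d2) (R : realType).
Variables (mu : probability X R) (nu : probability Y R).
Variable f : X * Y -> R.
Hypothesis fi : (mu \x nu)%E.-integrable setT (EFin \o f).

Lemma ae_integrable_row_prod : {ae nu, forall y, mu.-integrable setT (EFin \o (fun x => f (x, y)))}.
Proof. exact: (@ae_integrable2 _ _ X Y R mu nu (EFin \o f) fi). Qed.

Lemma ae_integrable_col_prod : {ae mu, forall x, nu.-integrable setT (EFin \o (fun y => f (x, y)))}.
Proof. exact: (@ae_integrable1 _ _ X Y R mu nu (EFin \o f) fi). Qed.

Lemma integrable_row_prod : nu.-integrable setT (EFin \o (fun y => \int[mu]_x f (x, y))).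
Proof.
have mF := @measurable_fubini_G _ _ X Y R mu nu (EFin \o f) fi.
apply/integrableP; split.
  apply/measurable_EFinP; exact: (measurableT_comp (fine_measurable measurableT) mF).
apply: (@le_lt_trans _ _ (\int[nu]_y \int[mu]_x `|(f (x, y))%:E|)%E); last first.
  rewrite -(fubini_tonelli2 (m1 := mu) (m2 := nu) (abse \o (EFin \o f)))//=.
    by have /integrableP[] := fi.
  by apply: measurableT_comp => //; exact: measurable_int fi.
apply: ae_ge0_le_integral => //.
- apply: measurableT_comp => //; apply/measurable_EFinP.
  exact: (measurableT_comp (fine_measurable measurableT) mF).
- by move=> y _; exact: integral_ge0.
- apply: (measurable_fun_fubini_tonelli_G (m1 := mu) (abse \o (EFin \o f))) => //=.
  by apply: measurableT_comp => //; exact: measurable_int fi.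
- apply: (ae_imp ae_integrable_row_prod) => y fy _ /=.
  rewrite EFin_normr_Rintegral//; apply: le_abse_integral => //.
  exact: measurable_int fy.
Qed.

Lemma integrable_col_prod : mu.-integrable setT (EFin \o (fun x => \int[nu]_y f (x, y))).
Proof.
have mF := @measurable_fubini_F _ _ X Y R mu nu (EFin \o f) fi.
apply/integrableP; split.
  apply/measurable_EFinP; exact: (measurableT_comp (fine_measurable measurableT) mF).
apply: (@le_lt_trans _ _ (\int[mu]_x \int[nu]_y `|(f (x, y))%:E|)%E); last first.
  rewrite -(fubini_tonelli1 (m1 := mu) (m2 := nu) (abse \o (EFin \o f)))//=.
    by have /integrableP[] := fi.
  by apply: measurableT_comp => //; exact: measurable_int fi.
apply: ae_ge0_le_integral => //.
- apply: measurableT_comp => //; apply/measurable_EFinP.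
  exact: (measurableT_comp (fine_measurable measurableT) mF).
- by move=> y _; exact: integral_ge0.
- apply: (measurable_fun_fubini_tonelli_F (m2 := nu) (abse \o (EFin \o f))) => //=.
  by apply: measurableT_comp => //; exact: measurable_int fi.
- apply: (ae_imp ae_integrable_col_prod) => y fy _ /=.
  rewrite EFin_normr_Rintegral//; apply: le_abse_integral => //.
  exact: measurable_int fy.
Qed.

Lemma Rintegral_row : \int[(mu \x nu)%E]_z f z = \int[nu]_y \int[mu]_x f (x, y).
Proof.
rewrite /Rintegral -[in LHS](@integral21_prod_meas1 _ _ X Y R mu nu (EFin \o f) fi).
congr fine; apply: ae_eq_integral => //.
- exact: (@measurable_fubini_G _ _ X Y R mu nu (EFin \o f) fi).
- exact: measurable_int integrable_row_prod.
- apply: (ae_imp ae_integrable_row_prod) => y fy _ /=.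
  by rewrite fineK//; exact: integrable_fin_num.
Qed.

Lemma Rintegral_col : \int[(mu \x nu)%E]_z f z = \int[mu]_x \int[nu]_y f (x, y).
Proof.
rewrite /Rintegral -[in LHS](@integral12_prod_meas1 _ _ X Y R mu nu (EFin \o f) fi).
congr fine; apply: ae_eq_integral => //.
- exact: (@measurable_fubini_F _ _ X Y R mu nu (EFin \o f) fi).
- exact: measurable_int integrable_col_prod.
- apply: (ae_imp ae_integrable_col_prod) => y fy _ /=.
  by rewrite fineK//; exact: integrable_fin_num.
Qed.

Lemma Rfubini_prod : \int[mu]_x \int[nu]_y f (x, y) = \int[nu]_y \int[mu]_x f (x, y).
Proof. by rewrite -Rintegral_col Rintegral_row. Qed.

End fubini_real.

Section product_coordinates.
Context d1 d2 (X : measurableType d1) (Y : measurableType d2) (R : realType).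
Variables (mu : probability X R) (nu : probability Y R).

Lemma preserves_fst_prod : preserves (mu \x nu)%E mu (fst : X * Y -> X).
Proof.
split; first exact: measurable_fst.
move=> A mA; have -> : (fst : X * Y -> X) @^-1` A = A `*` setT.
  by apply/seteqP; split => x //= [].
transitivity (mu A * nu [set: Y])%E; first exact: product_measure1E.
by rewrite [X in (_ * X)%E]probability_setT mule1.
Qed.

Lemma preserves_snd_prod : preserves (mu \x nu)%E nu (snd : X * Y -> Y).
Proof.
split; first exact: measurable_snd.
move=> A mA; have -> : (snd : X * Y -> Y) @^-1` A = setT `*` A.
  by apply/seteqP; split => x //= [].
transitivity (mu [set: X] * nu A)%E; first exact: product_measure1E.
by rewrite [X in (X * _)%E]probability_setT mul1e.
Qed.

End product_coordinates.

Section finite_sums.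
Context d (T : measurableType d) (R : realType) (mu : probability T R).
Local Notation intg f := (mu.-integrable setT (EFin \o f)).

Lemma bounded_measurable_sum (I : Type) (s : seq I) (F : I -> T -> R) :
  (forall i, bounded_measurable (F i)) -> bounded_measurable (fun x => \sum_(i <- s) F i x).
Proof.
move=> Fb; elim: s => [|i s IH].
  rewrite (_ : (fun x => _) = fun=> 0); first exact: bounded_measurable_cst.
  by apply/funext => x; rewrite big_nil.
rewrite (_ : (fun x => _) = fun x => F i x + \sum_(j <- s) F j x); last first.
  by apply/funext => x; rewrite big_cons.
exact: bounded_measurableD.
Qed.

Lemma integrable_real_sum (I : Type) (s : seq I) (F : I -> T -> R) :
  (forall i, intg (F i)) -> intg (fun x => \sum_(i <- s) F i x).
Proof.
move=> Fi; elim: s => [|i s IH].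
  rewrite (_ : (fun x => _) = fun=> 0); last by apply/funext => x; rewrite big_nil.
  exact: (bounded_measurable_integrable mu (bounded_measurable_cst _ _)).
rewrite (_ : (fun x => _) = fun x => F i x + \sum_(j <- s) F j x); last first.
  by apply/funext => x; rewrite big_cons.
exact: integrable_realD.
Qed.

Lemma Rintegral_sum (I : Type) (s : seq I) (F : I -> T -> R) :
  (forall i, intg (F i)) -> \int[mu]_x (\sum_(i <- s) F i x) = \sum_(i <- s) \int[mu]_x F i x.
Proof.
move=> Fi; elim: s => [|i s IH].
  under eq_Rintegral do rewrite big_nil.
  by rewrite Rintegral_cst// mul0r big_nil.
under eq_Rintegral do rewrite big_cons.
rewrite big_cons -IH RintegralD//; exact: integrable_real_sum.
Qed.
End finite_sums.

Section product_integrals.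
Context d1 d2 (X : measurableType d1) (Y : measurableType d2) (R : realType).
Variables (mu : probability X R) (nu : probability Y R) (f : X -> R) (g : Y -> R).
Hypotheses (fi : mu.-integrable setT (EFin \o f)) (gi : nu.-integrable setT (EFin \o g)).

Let mf : measurable_fun setT f. Proof. by have /measurable_int/measurable_EFinP := fi. Qed.
Let mg : measurable_fun setT g. Proof. by have /measurable_int/measurable_EFinP := gi. Qed.
Let mfg : measurable_fun setT (fun w : X * Y => f w.1 * g w.2).
Proof.
by apply: measurable_funM; [exact: (measurableT_comp mf measurable_fst)|
  exact: (measurableT_comp mg measurable_snd)].
Qed.

Lemma integrable_prod : (mu \x nu)%E.-integrable setT (EFin \o (fun w => f w.1 * g w.2)).
Proof.
have /integrableP[_ foo] := fi; have /integrableP[_ goo] := gi.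
have mnf : measurable_fun setT (fun x => `|f x|%:E) by apply/measurable_EFinP; exact: measurableT_comp.
have mng : measurable_fun setT (fun x => `|g x|%:E) by apply/measurable_EFinP; exact: measurableT_comp.
have fin : (\int[mu]_x `|f x|%:E)%E \is a fin_num.
  by rewrite ge0_fin_numE//; apply: integral_ge0.
apply/integrableP; split; first exact/measurable_EFinP.
have mn : measurable_fun setT (fun w : X * Y => (`|f w.1 * g w.2|)%:E).
  by apply/measurable_EFinP; exact: measurableT_comp.
have nn (w : X * Y) : (0 <= (`|f w.1 * g w.2|)%:E)%E by rewrite lee_fin.
rewrite (@fubini_tonelli2 _ _ X Y R mu nu _ mn nn)/=.
rewrite (eq_integral (fun y => (\int[mu]_x `|f x|%:E) * `|g y|%:E)%E); last first.
  move=> y _; rewrite -ge0_integralZr//.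
  by apply: eq_integral => x _; rewrite normrM EFinM.
rewrite ge0_integralZl//; last exact: integral_ge0.
by rewrite -(fineK fin) lte_mul_pinfty// lee_fin fine_ge0// integral_ge0.
Qed.

Lemma Rintegral_prod : \int[(mu \x nu)%E]_w (f w.1 * g w.2) = \int[mu]_x f x * \int[nu]_y g y.
Proof.
rewrite (Rintegral_col integrable_prod) -RintegralZr//.
by apply: eq_Rintegral => x _ /=; rewrite -RintegralZl.
Qed.
End product_integrals.

(** * The circle and the torus as probability spaces *)

(** The line and the plane, with the sigma-algebras under which the Lebesgue measure
    and its square are defined. *)
Notation T1 R := (measurableTypeR R).
Notation T2 R := (measurableTypeR R * measurableTypeR R)%type.

Section unit_interval_measure.
Context {R : realType}.

Let mI01 : measurable (`[0, 1[ : set (T1 R)).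
Proof. exact: measurable_itv. Qed.

(** The circle is the line with the measure that charges only [0, 1[.  Integrals are
    then over the whole type, which keeps domains out of all later statements. *)
Definition lam1 : set (T1 R) -> \bar R := mrestr (leb R) mI01.

HB.instance Definition _ := Measure.on lam1.

Let lam1_setT : lam1 setT = 1%E.
Proof.
by rewrite /lam1 /mrestr setTI lebesgue_measure_itv/= lte_fin ltr01 oppr0 adde0.
Qed.

HB.instance Definition _ := Measure_isProbability.Build _ _ R lam1 lam1_setT.

Definition P1 : probability (T1 R) R := lam1.

Definition lam2 : set (T2 R) -> \bar R := (P1 \x P1)%E.

HB.instance Definition _ := Measure.on lam2.

Let lam2_setT : lam2 setT = 1%E.
Proof.
rewrite /lam2 -setXTT; transitivity (P1 setT * P1 setT)%E.
  exact: product_measure1E.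
by rewrite [X in (X * X)%E]probability_setT mule1.
Qed.

HB.instance Definition _ := Measure_isProbability.Build _ _ R lam2 lam2_setT.

Definition P2 : probability (T2 R) R := lam2.

End unit_interval_measure.

Section torus_integrals.
Context {R : realType}.
Local Open Scope ereal_scope.

Lemma measurable_Q : measurable (@Q R : set (T2 R)).
Proof. exact: measurableX. Qed.

Lemma P1E (A : set (T1 R)) : P1 A = leb R (A `&` `[0%R, 1%R[).
Proof. by []. Qed.

Lemma P2E (A : set (T2 R)) : measurable A -> P2 A = leb2 R (A `&` Q).
Proof.
move=> mA; pose m := mrestr (leb2 R) measurable_Q.
apply: (@product_measure_unique _ _ _ _ _ P1 P1 m) => // X Y mX mY.
by rewrite /m /= /mrestr /Q -setXI product_measure1E//; exact: measurableI.
Qed.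

Lemma integral_full d (T : measurableType d) (mu : {measure set T -> \bar R}) (D : set T)
    (f : T -> \bar R) : measurable D -> mu (~` D) = 0 -> measurable_fun setT f ->
  \int[mu]_x f x = \int[mu]_(x in D) f x.
Proof.
move=> mD D0 mf; rewrite [RHS]integral_mkcond; apply: ae_eq_integral => //.
  by apply/(measurable_restrictT f) => //; apply: measurable_funS mf.
exists (~` D); split => //; first exact: measurableC.
by move=> x /= h Qx; apply: h => _; rewrite patchE mem_set.
Qed.

Lemma integral_P2 (f : R * R -> \bar R) : measurable_fun (setT : set (T2 R)) f ->
  \int[P2]_x f x = \int[leb2 R]_(x in Q) f x.
Proof.
move=> mf; rewrite (@integral_full _ _ P2 Q f measurable_Q _ mf); last first.
  by rewrite /= P2E ?setICl ?measure0//; apply: measurableC; exact: measurable_Q.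
by apply: eq_measure_integral => A mA AQ /=; rewrite P2E// setIidl.
Qed.

Lemma integral_P1 (f : R -> \bar R) : measurable_fun (setT : set (T1 R)) f ->
  \int[P1]_x f x = \int[leb R]_(x in `[0%R, 1%R[) f x.
Proof.
move=> mf; rewrite (@integral_full _ _ P1 `[0%R, 1%R[%classic)//; last first.
  by rewrite /= P1E setICl measure0.
by apply: eq_measure_integral => A mA AQ /=; rewrite P1E setIidl.
Qed.

Lemma integral_P1c (f : R -> \bar R) : measurable_fun (setT : set (T1 R)) f ->
  \int[P1]_x f x = \int[leb R]_(x in I01) f x.
Proof.
move=> mf; rewrite integral_P1// /I01.
by apply: integral_itv_bndo_bndc; exact: measurable_funTS.
Qed.

Lemma ae_P2 (P : R * R -> Prop) : ae_torus P -> {ae P2, forall x, P x}.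
Proof.
move=> [N [mN N0 hN]]; exists (N `|` ~` Q); split.
- by apply: measurableU => //; apply: measurableC; exact: measurable_Q.
- rewrite /= P2E//; last by apply: measurableU => //; apply: measurableC; exact: measurable_Q.
  apply/eqP; rewrite -measure_le0 -[leRHS]N0 le_measure ?inE//.
    apply: measurableI; last exact: measurable_Q.
    by apply: measurableU => //; apply: measurableC; exact: measurable_Q.
  by rewrite setIUl setICl setU0; exact: subIsetl.
- move=> x /= hx; have [Qx|nQx] := pselect (Q x); last by right.
  by left; apply: hN => /= /(_ Qx).
Qed.

End torus_integrals.

Section shift_invariance.
Context {R : realType}.

(** The fractional part: the representative in [0, 1[ of a point of the circle. *)
Definition fr1 (x : R) : R := x - (Num.floor x)%:~R.
Definition fr (x : R * R) : R * R := (fr1 x.1, fr1 x.2).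

Lemma fr1_itv x : 0 <= fr1 x < 1.
Proof.
by rewrite /fr1 subr_ge0 ltrBlDl floor_le_tmp/= -intrD1 lt_succ_floor.
Qed.

Lemma fr1_id x : 0 <= x < 1 -> fr1 x = x.
Proof. by move=> x01; rewrite /fr1 (floor_def (m := 0)) ?subr0//. Qed.

Lemma fr1D_int x (k : int) : fr1 (x + k%:~R) = fr1 x.
Proof. by rewrite /fr1 floorDrz ?intr_int// intrD intrKfloor; ring. Qed.

Lemma measurable_fr1 : measurable_fun (setT : set (T1 R)) fr1.
Proof.
apply: measurable_funB => //.
by apply: nondecreasing_measurable => // x y xy; rewrite ler_int; exact: le_floor.
Qed.

Lemma measurable_fr : measurable_fun (setT : set (T2 R)) (fr : T2 R -> T2 R).
Proof.
apply: measurable_fun_pair.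
- exact: (measurableT_comp measurable_fr1 measurable_fst).
- exact: (measurableT_comp measurable_fr1 measurable_snd).
Qed.

Lemma fr_Q x : Q (fr x).
Proof. by split; rewrite /= in_itv/=; exact: fr1_itv. Qed.

Lemma fr_id x : Q x -> fr x = x.
Proof.
by case: x => x y [/=]; rewrite !in_itv/= => x01 y01; rewrite /fr !fr1_id.
Qed.

Lemma periodic_fr (A : Type) (f : R * R -> A) x : Z2_periodic f -> f (fr x) = f x.
Proof.
by move=> pf; rewrite -(pf x (- Num.floor x.1) (- Num.floor x.2)) !intrN.
Qed.

Lemma leb_shift (a : R) (A : set (T1 R)) : measurable A -> leb R [set x | A (x + a)] = leb R A.
Proof.
move=> mA.
have mS : measurable_fun setT (fun x : T1 R => (x : R) + a : T1 R) by exact: measurable_funD.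
pose S : {mfun T1 R >-> T1 R} := HB.pack (fun x : T1 R => (x : R) + a : T1 R) (isMeasurableFun.Build _ _ _ _ _ mS).
transitivity (pushforward (leb R) S A) => //.
apply/esym/lebesgue_measure_unique => //= _ [[b c]] _ <-.
rewrite /pushforward.
rewrite (_ : _ @^-1` _ = `]b - a, c - a]%classic); last first.
  by apply/seteqP; split => x /=; rewrite !in_itv/= ltrBlDr lerBrDr.
rewrite !lebesgue_measure_itv/= !lte_fin ltrD2r; case: ifPn => //.
by rewrite -!EFinD => _; congr EFin; ring.
Qed.

Lemma leb_shiftI (a : R) (A : set (T1 R)) (i : set R) : measurable A -> measurable (i : set (T1 R)) ->
  leb R ([set x | A (x + a)] `&` [set x | i (x + a)]) = leb R (A `&` i).
Proof. by move=> mA mi; exact: (leb_shift a (measurableI _ _ mA mi)). Qed.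

(** The interval [0, 1[ is cut at 1 - a; its two pieces are translated to [a, 1[ and to
    [0, a[. *)
Lemma P1_shift (a : R) (A : set (T1 R)) : 0 <= a < 1 -> measurable A ->
  P1 [set x : R | A (fr1 (x + a))] = P1 A.
Proof.
move=> /andP[a0 a1] mA.
have mS c : measurable [set x : T1 R | A ((x : R) + c)].
  rewrite -[X in measurable X]setTI; apply: (_ : measurable_fun setT (fun x : T1 R => (x : R) + c : T1 R)) => //.
  exact: measurable_funD.
have mfS : measurable [set x : T1 R | A (fr1 ((x : R) + a))].
  rewrite -[X in measurable X]setTI; apply: (_ : measurable_fun setT (fun x : T1 R => fr1 ((x : R) + a) : T1 R)) => //.
  by apply: (measurableT_comp measurable_fr1); exact: measurable_funD.
rewrite !P1E.
have I01E : `[0, 1[%classic = `[0, a[%classic `|` `[a, 1[%classic :> set R.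
  by rewrite -itv_bndbnd_setU// bnd_simp// ltW.
have I01E' : `[0, 1[%classic = `[0, 1 - a[%classic `|` `[1 - a, 1[%classic :> set R.
  by rewrite -itv_bndbnd_setU// bnd_simp; lra.
rewrite [in LHS]I01E' [in RHS]I01E !setIUr.
have D1 : (A `&` `[0, a[) `&` (A `&` `[a, 1[) = set0.
  by apply/seteqP; split => // x /=; rewrite !in_itv/=; lra.
have D2 (B : set R) : (B `&` `[0, 1 - a[) `&` (B `&` `[1 - a, 1[) = set0.
  by apply/seteqP; split => // x /=; rewrite !in_itv/=; lra.
rewrite !measureU//; try exact: measurableI.
have E (y : R) : 1 - a <= y < 1 -> fr1 (y + a) = y + (a - 1).
  move=> ya; rewrite -(fr1D_int (y + a) (-1)) intrN fr1_id; first by ring.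
  by move: ya => /andP[]; lra.
have E' (y : R) : 0 <= y < 1 - a -> fr1 (y + a) = y + a.
  by move=> ya; rewrite fr1_id//; move: ya => /andP[]; lra.
rewrite addeC; congr (_ + _)%E.
  refine (etrans _ (leb_shiftI (a - 1) mA (measurable_itv `[0, a[))).
  congr (leb R _); apply/seteqP; split => x /=; rewrite !in_itv/=.
    by move=> [Ax xa]; rewrite E// in Ax; split => //; move: xa => /andP[]; lra.
  move=> [Ax xa]; have xa' : 1 - a <= x < 1 by move: xa => /andP[]; lra.
  by rewrite E.
refine (etrans _ (leb_shiftI a mA (measurable_itv `[a, 1[))).
congr (leb R _); apply/seteqP; split => x /=; rewrite !in_itv/=.
  by move=> [Ax xa]; rewrite E'// in Ax; split => //; move: xa => /andP[]; lra.
move=> [Ax xa]; have xa' : 0 <= x < 1 - a by move: xa => /andP[]; lra.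
by rewrite E'.
Qed.

End shift_invariance.

Section torus_maps.
Context {R : realType}.

Lemma preserves_shift (a b : R) : 0 <= a < 1 -> 0 <= b < 1 ->
  preserves P2 P2 (fun x : T2 R => fr (x.1 + a, x.2 + b) : T2 R).
Proof.
move=> a01 b01.
have mY : measurable_fun setT (fun x : T2 R => fr (x.1 + a, x.2 + b) : T2 R).
  apply: (measurableT_comp measurable_fr); apply: measurable_fun_pair.
  - by apply: measurable_funD => //; exact: measurable_fst.
  - by apply: measurable_funD => //; exact: measurable_snd.
split; [exact: mY|move=> A mA].
pose m : {measure set (T2 R) -> \bar R} :=
  measure_function_pushforward__canonical__measure_function_Measure P2 mY.
apply/esym; apply: (@product_measure_unique _ _ _ _ _ P1 P1 m) => //= B C mB mC.
rewrite /pushforward/=.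
have -> : (fun x : T2 R => fr (x.1 + a, x.2 + b)) @^-1` (B `*` C) =
  [set x | B (fr1 (x + a))] `*` [set x | C (fr1 (x + b))] by [].
have mS c D : measurable D -> measurable [set x : T1 R | D (fr1 ((x : R) + c))].
  move=> mD; rewrite -[X in measurable X]setTI; apply: (_ : measurable_fun setT (fun x : T1 R => fr1 ((x : R) + c) : T1 R)) => //.
  by apply: (measurableT_comp measurable_fr1); exact: measurable_funD.
transitivity (P1 [set x : R | B (fr1 (x + a))] * P1 [set x : R | C (fr1 (x + b))])%E.
  by apply: product_measure1E; exact: mS.
by rewrite !P1_shift.
Qed.

(** The flow brought back to the unit square, and extended by a constant outside of
    the times and points where it is defined so as to be jointly measurable. *)
Definition torus_flow (X : R -> R * R -> R * R) (z : R * (R * R)) : R * R :=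
  if z \in I01 `*` Q then fr (X z.1 z.2) else (0, 0).

Lemma measurable_torus_flow (v X : R -> R * R -> R * R) :
  measure_preserving_flow v X ->
  measurable_fun (setT : set (T1 R * T2 R)) (torus_flow X : T1 R * T2 R -> T2 R).
Proof.
move=> [mX _ _].
have mI : measurable (I01 `*` Q : set (T1 R * T2 R)).
  by apply: measurableX; [exact: measurable_itv|exact: measurable_Q].
have E (b : bool) : [set: T1 R * T2 R] `&` (fun z => z \in I01 `*` Q) @^-1` [set b] =
    if b then I01 `*` Q else ~` (I01 `*` Q).
  rewrite setTI; apply/seteqP; case: b; split=> z /=.
  - exact: set_mem.
  - exact: mem_set.
  - by move=> h hz; rewrite mem_set in h.
  - by move=> h; apply/negbTE/negP => /set_mem.
apply: measurable_fun_if => //.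
- by apply: (measurable_fun_bool true); have := E true => /= ->.
- rewrite E; apply: measurableT_comp; first exact: measurable_fr.
  exact: mX.
Qed.

(** The measure preservation of a flow is assumed for periodic sets only; it is enough,
    as the preimage of any Borel set under [fr] is periodic. *)
Lemma preserves_flow (v X : R -> R * R -> R * R) t :
  measure_preserving_flow v X -> I01 t ->
  preserves P2 P2 (fun x : T2 R => torus_flow X (t, x) : T2 R).
Proof.
move=> fX t01; have mY := measurable_torus_flow fX.
have mYt : measurable_fun setT (fun x : T2 R => torus_flow X (t, x) : T2 R).
  exact: (measurableT_comp mY).
split; [exact: mYt|move=> A mA].
have mfA : measurable (fr @^-1` A : set (T2 R)).
  by rewrite -[X in measurable X]setTI; exact: measurable_fr.
have mYA : measurable ((fun x : T2 R => torus_flow X (t, x)) @^-1` A).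
  by rewrite -[X in measurable X]setTI; exact: mYt.
rewrite /= (P2E mYA) (P2E mA).
have YE x : Q x -> torus_flow X (t, x) = fr (X t x).
  by move=> Qx; rewrite /torus_flow mem_set.
transitivity (leb2 R (Q `&` X t @^-1` (fr @^-1` A))).
  congr (leb2 R _); apply/seteqP; split => x /=.
    by move=> [+ Qx]; rewrite YE.
  by move=> [Qx ?]; rewrite YE.
have [_ _ pX] := fX.
transitivity (leb2 R (Q `&` fr @^-1` A)).
  apply: pX => //.
  by move=> x k l; rewrite /= /fr/= !fr1D_int.
congr (leb2 R _); apply/seteqP; split => x /=.
  by move=> [Qx]; rewrite fr_id.
by move=> [Ax Qx]; rewrite fr_id.
Qed.

End torus_maps.

Section torus_fubini.
Context {R : realType}.
Local Notation intg1 f := (P1.-integrable (setT : set (T1 R)) (EFin \o f)).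
Local Notation intg2 f := (P2.-integrable (setT : set (T2 R)) (EFin \o f)).

Lemma tonelli1 (f : R * R -> \bar R) : measurable_fun (setT : set (T2 R)) f ->
  (forall x, 0 <= f x)%E -> (\int[P2]_z f z = \int[P1]_x \int[P1]_y f (x, y))%E.
Proof. by move=> mf f0; exact: fubini_tonelli1. Qed.

Lemma tonelli2 (f : R * R -> \bar R) : measurable_fun (setT : set (T2 R)) f ->
  (forall x, 0 <= f x)%E -> (\int[P2]_z f z = \int[P1]_y \int[P1]_x f (x, y))%E.
Proof. by move=> mf f0; exact: fubini_tonelli2. Qed.

Lemma Rintegral_P2_row (f : R * R -> R) : intg2 f ->
  \int[P2]_z f z = \int[P1]_y \int[P1]_x f (x, y).
Proof. exact: (@Rintegral_row _ _ (T1 R) (T1 R) R P1 P1). Qed.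

Lemma Rintegral_P2_col (f : R * R -> R) : intg2 f ->
  \int[P2]_z f z = \int[P1]_x \int[P1]_y f (x, y).
Proof. exact: (@Rintegral_col _ _ (T1 R) (T1 R) R P1 P1). Qed.

Lemma preserves_fst : preserves P2 P1 (fst : T2 R -> T1 R).
Proof. exact: (@preserves_fst_prod _ _ (T1 R) (T1 R) R P1 P1). Qed.

Lemma preserves_snd : preserves P2 P1 (snd : T2 R -> T1 R).
Proof. exact: (@preserves_snd_prod _ _ (T1 R) (T1 R) R P1 P1). Qed.

Lemma ae_integrable_row (f : R * R -> R) : intg2 f ->
  {ae P1, forall y, intg1 (fun x => f (x, y))}.
Proof. exact: (@ae_integrable_row_prod _ _ (T1 R) (T1 R) R P1 P1). Qed.

Lemma integrable_row (f : R * R -> R) : intg2 f ->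
  intg1 (fun y => \int[P1]_x f (x, y)).
Proof. exact: (@integrable_row_prod _ _ (T1 R) (T1 R) R P1 P1). Qed.

Lemma Rfubini (f : R * R -> R) : intg2 f ->
  \int[P1]_x \int[P1]_y f (x, y) = \int[P1]_y \int[P1]_x f (x, y).
Proof. exact: (@Rfubini_prod _ _ (T1 R) (T1 R) R P1 P1). Qed.

Lemma preserves_swap : preserves P2 P2 (fun x : T2 R => (x.2, x.1) : T2 R).
Proof.
have mS : measurable_fun setT (fun x : T2 R => (x.2, x.1) : T2 R).
  by apply: measurable_fun_pair; [exact: measurable_snd|exact: measurable_fst].
split; [exact: mS|move=> A mA].
pose m : {measure set (T2 R) -> \bar R} :=
  measure_function_pushforward__canonical__measure_function_Measure P2 mS.
apply/esym; apply: (@product_measure_unique _ _ _ _ _ P1 P1 m) => //= B C mB mC.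
rewrite /pushforward/=.
have -> : (fun x : T2 R => (x.2, x.1)) @^-1` (B `*` C) = C `*` B.
  by apply/seteqP; split => x /= [].
by rewrite muleC; exact: product_measure1E.
Qed.

End torus_fubini.

(** The law of two independent uniform points of the torus. *)
Definition P22 {R : realType} : probability (T2 R * T2 R)%type R := (P2 \x P2)%E.

(** * Uniqueness of Fourier series on the circle *)

Lemma bernoulli_ge (R : realFieldType) (x : R) m : -1 <= x -> 1 + m%:R * x <= (1 + x) ^+ m.
Proof.
move=> x1; elim: m => [|m ih]; first by rewrite mul0r addr0 expr0.
rewrite exprS -[m.+1]addn1 natrD; apply: (@le_trans _ _ ((1 + x) * (1 + m%:R * x))).
  by have := ler0n R m; have := sqr_ge0 x; nra.
by apply: ler_wpM2l => //; lra.
Qed.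

Lemma natmul_exp_le (R : realFieldType) (r : R) n : 0 <= r < 1 -> n%:R * r ^+ n <= (1 - r)^-1.
Proof.
move=> /andP[r0 r1]; rewrite -div1r ler_pdivlMr ?subr_gt0//.
suff : n%:R * r ^+ n * (1 - r) <= 1 - r ^+ n.
  by move=> /le_trans; apply; rewrite lerBlDr lerDl exprn_ge0.
elim: n => [|n ih]; first by rewrite !mul0r expr0 subrr.
have rn0 : 0 <= r ^+ n by exact: exprn_ge0.
have rn1 : r ^+ n <= 1 by apply: exprn_ile1 => //; exact: ltW.
rewrite -[in n.+1%:R]addn1 natrD exprS.
have : r * (n%:R * r ^+ n * (1 - r)) <= r * (1 - r ^+ n) by exact: ler_wpM2l.
have : 0 <= (1 - r) * (1 - r * r ^+ n).
  by apply: mulr_ge0; [lra|rewrite subr_ge0 mulr_ile1// ltW].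
by nra.
Qed.

(** With m = n 2^n, the power (1 - s^n)^m is at least 1 - n (2 s)^n, which tends to 1
    when s < 1/2, and at most (1 + s^n)^-m <= 1 / (1 + m s^n) <= 1 / (1 + n) otherwise.
    These polynomials in s thus converge to a step function. *)
Lemma threshold_cvg (R : realType) (s : R) : 0 <= s <= 1 ->
  (fun n => (1 - s ^+ n) ^+ (n * 2 ^ n)%N) @ \oo --> (if s < 2^-1 then 1 else 0 : R).
Proof.
move=> /andP[s0 s1].
have sn0 n : 0 <= s ^+ n by exact: exprn_ge0.
have sn1 n : s ^+ n <= 1 by exact: exprn_ile1.
have [s2|s2] := ltP s 2^-1.
  (* so that n (2 s)^n = r^n (n r^n), where n r^n is bounded *)
  pose r := Num.sqrt (2 * s).
  have r0 : 0 <= r by exact: sqrtr_ge0.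
  have r1 : r < 1 by rewrite -[ltRHS]sqrtr1 ltr_sqrt//; lra.
  have r2 : r ^+ 2 = 2 * s by rewrite sqr_sqrtr// mulr_ge0.
  apply: (@squeeze_cvgr _ _ _ _ (fun n => 1 - r ^+ n * (1 - r)^-1) (fun=> 1)).
  - apply: nearW => n; apply/andP; split; last first.
      by apply: exprn_ile1; have := sn0 n; have := sn1 n; lra.
    apply: le_trans (bernoulli_ge _ _); last by have := sn1 n; lra.
    rewrite mulrN lerD2l lerN2 natrM natrX.
    have -> : n%:R * 2 ^+ n * s ^+ n = r ^+ n * (n%:R * r ^+ n).
      by rewrite -mulrA -exprMn -r2 -exprM mulnC exprM; ring.
    by apply: ler_wpM2l; [exact: exprn_ge0|apply: natmul_exp_le; rewrite r0].
  - suff : 1 - r ^+ n * (1 - r)^-1 @[n --> \oo] --> 1 - 0 * (1 - r)^-1.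
      by rewrite mul0r subr0.
    apply: cvgB; first exact: cvg_cst.
    apply: cvgM; last exact: cvg_cst.
    by apply: cvg_expr; rewrite ger0_norm.
  - exact: cvg_cst.
apply: (@squeeze_cvgr _ _ _ _ (fun=> 0) (fun n => n.+1%:R^-1)).
- apply: nearW => n; apply/andP; split.
    by apply: exprn_ge0; have := sn1 n; lra.
  have x0 := sn0 n; have x1 := sn1 n.
  set x := s ^+ n in x0 x1 *; set m := (n * 2 ^ n)%N.
  have mx : n%:R <= m%:R * x.
    rewrite /m /x natrM natrX -mulrA -exprMn ler_peMr ?ler0n//.
    by apply: exprn_ege1; lra.
  rewrite -div1r ler_pdivlMr//.
  apply: (@le_trans _ _ ((1 - x) ^+ m * (1 + x) ^+ m)).
    apply: ler_wpM2l; first by apply: exprn_ge0; lra.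
    apply: le_trans (bernoulli_ge _ _); last by lra.
    by rewrite -[n.+1]addn1 natrD addrC lerD2l.
  by rewrite -exprMn; apply: exprn_ile1; nra.
- exact: cvg_cst.
- exact: cvg_harmonic.
Qed.

Section fourier_uniqueness.
Context {R : realType}.
Local Notation bm := (@bounded_measurable _ (T1 R) R).

Lemma measurable_cos_affine (c a : R) : measurable_fun (setT : set (T1 R)) (fun x : R => cos (c * x + a)).
Proof.
apply: continuous_measurable_fun => x.
apply: (@continuous_comp _ _ _ (fun x : R => c * x + a) cos); last exact: continuous_cos.
by apply: cvgD; [apply: cvgM; [exact: cvg_cst|exact: cvg_id]|exact: cvg_cst].
Qed.

Lemma bounded_cos_affine (c a : R) : bm (fun x : R => cos (c * x + a)).
Proof. by split; [exact: measurable_cos_affine|exists 1 => x; exact: cos_max]. Qed.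

Variable f : R -> R.
Hypothesis fi : P1.-integrable (setT : set (T1 R)) (EFin \o f).
Hypothesis f0 : forall (k : int) (a : R),
  \int[P1]_x (f x * cos (2 * pi * k%:~R * x + a)) = 0.

Definition annihilated (h : R -> R) := bm h /\
  forall (k : int) (a : R), \int[P1]_x (f x * (h x * cos (2 * pi * k%:~R * x + a))) = 0.

(** Trigonometric polynomials are multipliers by the product formula for cosines, and
    multipliers form an algebra; this replaces the explicit expansion of products of
    trigonometric polynomials. *)
Definition multiplier (q : R -> R) := bm q /\
  forall h, annihilated h -> annihilated (fun x => q x * h x).

Let fh_integrable h : bm h -> P1.-integrable (setT : set (T1 R)) (EFin \o (fun x => f x * h x)).
Proof. exact: integrableM_bounded. Qed.

Lemma annihilated1 : annihilated (fun=> 1).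
Proof.
split; first exact: bounded_measurable_cst.
by move=> k a; under eq_Rintegral do rewrite mul1r; exact: f0.
Qed.

Lemma annihilatedD h g : annihilated h -> annihilated g -> annihilated (fun x => h x + g x).
Proof.
move=> [bh h0] [bg g0]; split; first exact: bounded_measurableD.
move=> k a; under eq_Rintegral do rewrite mulrDl mulrDr.
rewrite RintegralD ?h0 ?g0 ?addr0//; apply: fh_integrable; apply: bounded_measurableM => //;
  exact: bounded_cos_affine.
Qed.

Lemma multiplier_cst c : multiplier (fun=> c).
Proof.
split=> [|h [bh h0]]; first exact: bounded_measurable_cst.
split; first by apply: bounded_measurableM => //; exact: bounded_measurable_cst.
move=> k a; under eq_Rintegral do rewrite -mulrA mulrCA.
rewrite RintegralZl ?h0 ?mulr0//; apply: fh_integrable; apply: bounded_measurableM => //.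
exact: bounded_cos_affine.
Qed.

Lemma multiplierD q r : multiplier q -> multiplier r -> multiplier (fun x => q x + r x).
Proof.
move=> [bq hq] [br hr]; split; first exact: bounded_measurableD.
move=> h ah; under eq_fun do rewrite mulrDl.
by apply: annihilatedD; [exact: hq|exact: hr].
Qed.

Lemma multiplierM q r : multiplier q -> multiplier r -> multiplier (fun x => q x * r x).
Proof.
move=> [bq hq] [br hr]; split; first exact: bounded_measurableM.
by move=> h ah; under eq_fun do rewrite -mulrA; apply: hq; exact: hr.
Qed.

Lemma multiplierX q n : multiplier q -> multiplier (fun x => q x ^+ n).
Proof.
move=> mq; elim: n => [|n ih]; first by under eq_fun do rewrite expr0; exact: multiplier_cst.
by under eq_fun do rewrite exprS; exact: multiplierM.
Qed.

Lemma multiplier_cos b : multiplier (fun x => cos (2 * pi * x + b)).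
Proof.
have bc : bm (fun x => cos (2 * pi * x + b)) by exact: bounded_cos_affine.
split=> // h [bh h0]; split; first exact: bounded_measurableM.
move=> k a.
have E x : f x * (cos (2 * pi * x + b) * h x * cos (2 * pi * k%:~R * x + a)) =
   2^-1 * (f x * (h x * cos (2 * pi * (k + 1)%:~R * x + (a + b)))) +
   2^-1 * (f x * (h x * cos (2 * pi * (k - 1)%:~R * x + (a - b)))).
  have -> : 2 * pi * (k + 1)%:~R * x + (a + b) =
            (2 * pi * k%:~R * x + a) + (2 * pi * x + b) by rewrite intrD; ring.
  have -> : 2 * pi * (k - 1)%:~R * x + (a - b) =
            (2 * pi * k%:~R * x + a) - (2 * pi * x + b) by rewrite intrB; ring.
  by move: (_ * x + a) (_ * x + b) => A B; rewrite cosB cosD; field.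
under eq_Rintegral do rewrite E.
have I (j : int) c : P1.-integrable (setT : set (T1 R))
    (EFin \o (fun x => f x * (h x * cos (2 * pi * j%:~R * x + c)))).
  by apply: fh_integrable; apply: bounded_measurableM => //; exact: bounded_cos_affine.
rewrite RintegralD//; [|exact: (integrableZl measurableT 2^-1 (I _ _))|exact: (integrableZl measurableT 2^-1 (I _ _))].
by rewrite !RintegralZl// !h0 !mulr0 addr0.
Qed.

(** A trigonometric polynomial with values in [0, 1], smaller than 1/2 precisely above b;
    combined with [threshold_cvg], it gives the indicator function of ]b, 1[. *)
Let s b x : R := 2^-1 + 4^-1 * (cos (2 * pi * x + - (pi * b)) - cos (pi * b)).

Let sE b x : s b x = 2^-1 + 2^-1 * (sin (pi * x) * sin (pi * (b - x))).
Proof.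
rewrite /s; have -> : 2 * pi * x - pi * b = pi * x - pi * (b - x) by ring.
have -> : pi * b = pi * x + pi * (b - x) by ring.
by rewrite cosB cosD; field.
Qed.

Let s01 b x : 0 <= s b x <= 1.
Proof.
have := sin_max (pi * x); have := sin_max (pi * (b - x)); rewrite sE.
set u := sin _; set w := sin _ => hu hw.
have : `|w * u| <= 1 by rewrite normrM mulr_ile1.
by rewrite ler_norml => /andP[]; lra.
Qed.

Let s_threshold b x : 0 < b < 1 -> 0 < x < 1 -> (s b x < 2^-1) = (b < x).
Proof.
move=> /andP[b0 b1] /andP[x0 x1]; have pi0 := @pi_gt0 R.
have sx : 0 < sin (pi * x) by apply: sin_gt0_pi; rewrite mulr_gt0//= -[ltRHS]mulr1 ltr_pM2l.
rewrite sE gtrDl pmulr_rlt0// pmulr_rlt0//.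
have [bx|bx] := ltP b x.
  rewrite -oppr_gt0 -sinN -mulrN opprB; apply: sin_gt0_pi.
  by rewrite mulr_gt0 ?subr_gt0//= -[ltRHS]mulr1 ltr_pM2l//; lra.
apply/negbTE; rewrite -leNgt; apply: sin_ge0_pi.
by rewrite mulr_ge0 ?subr_ge0 ?(ltW pi0)//= -[leRHS]mulr1 ler_pM2l//; lra.
Qed.

Lemma integral_above b : 0 < b < 1 ->
  \int[P1]_x (f x * (if s b x < 2^-1 then 1 else 0)) = 0.
Proof.
move=> b01.
have mus : multiplier (s b).
  apply: multiplierD; first exact: multiplier_cst.
  apply: multiplierM; first exact: multiplier_cst.
  by apply: multiplierD; [exact: multiplier_cos|exact: multiplier_cst].
pose q n x := (1 - s b x ^+ n) ^+ (n * 2 ^ n)%N.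
have muq n : multiplier (q n).
  apply: multiplierX; have -> : (fun x => 1 - s b x ^+ n) = (fun x => 1 + (-1) * s b x ^+ n).
    by apply/funext => x; rewrite mulN1r.
  apply: multiplierD; first exact: multiplier_cst.
  apply: multiplierM; first exact: multiplier_cst.
  exact: multiplierX.
have q0 n : (\int[P1]_x (f x * q n x)%:E = 0)%E.
  have [bq /(_ _ annihilated1)[_ /(_ 0 0)]] := muq n.
  under eq_Rintegral do rewrite mulr1 mulr0 mul0r addr0 cos0 mulr1.
  rewrite /Rintegral => q0.
  by rewrite -[LHS]fineK ?q0//; apply: integrable_fin_num => //; exact: fh_integrable.
pose chi x : R := if s b x < 2^-1 then 1 else 0.
have qchi x : q ^~ x @ \oo --> chi x by apply: threshold_cvg; exact: s01.
have mf : measurable_fun (setT : set (T1 R)) f.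
  by have := measurable_int _ fi; move/measurable_EFinP.
have mq n : measurable_fun (setT : set (T1 R)) (q n) by have [[]] := muq n.
have mchi : measurable_fun (setT : set (T1 R)) chi.
  by apply: (measurable_fun_cvg (h := q)) => // x _; exact: qchi.
have q1 n x : `|q n x| <= 1.
  have /andP[s0 s1] := s01 b x.
  have h0 : 0 <= s b x ^+ n by exact: exprn_ge0.
  have h1 : s b x ^+ n <= 1 by exact: exprn_ile1.
  have h2 : 0 <= 1 - s b x ^+ n <= 1 by lra.
  by rewrite ger0_norm ?exprn_ge0 ?exprn_ile1//; case/andP: h2.
have [] := @dominated_convergence _ _ _ P1 setT measurableT (fun n x => (f x * q n x)%:E)
   (fun x => (f x * chi x)%:E) (fun x => `|f x|%:E).
- by move=> n; apply/measurable_EFinP; exact: measurable_funM.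
- by apply/measurable_EFinP; exact: measurable_funM.
- apply: aeW => x _; apply: cvg_EFin; first by apply: nearW.
  by apply: cvgM; [exact: cvg_cst|exact: qchi].
- exact: (integrable_norm fi).
- by apply: aeW => x n _ /=; rewrite lee_fin normrM ler_piMr.
move=> _ _; rewrite /sequence; under eq_fun do rewrite q0.
rewrite /Rintegral => h.
by rewrite -(cvg_lim (@ereal_hausdorff R) h) lim_cst.
Qed.

Lemma integral_ray b : (\int[P1]_(x in `]b, +oo[%classic) (f x)%:E = 0)%E.
Proof.
have mf : measurable_fun (setT : set (T1 R)) (EFin \o f) := measurable_int _ fi.
have F0 : (\int[P1]_x (f x)%:E = 0)%E.
  have := f0 0 0; rewrite /Rintegral.
  under eq_integral do rewrite mulr0 mul0r addr0 cos0 mulr1.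
  by move=> h; rewrite -[LHS]fineK ?h//; exact: integrable_fin_num.
have mray c : measurable (`]c, +oo[%classic : set (T1 R)) by exact: measurable_itv.
(* a set that agrees with a ray inside ]0, 1[ has the same integral *)
have E (A : set (T1 R)) : measurable A -> {in `]0, 1[, forall x, A x <-> b < x} ->
    (\int[P1]_(x in `]b, +oo[%classic) (f x)%:E = \int[P1]_(x in A) (f x)%:E)%E.
  move=> mA hA; rewrite [LHS]integral_mkcond [RHS]integral_mkcond.
  apply: ae_eq_integral => //.
  - by apply/(measurable_restrictT (EFin \o f)); [exact: mray|exact: measurable_funTS].
  - by apply/(measurable_restrictT (EFin \o f)); [exact: mA|exact: measurable_funTS].
  exists (~` `]0, 1[%classic); split.
  - by apply: measurableC; exact: measurable_itv.
  - rewrite /= P1E; apply/eqP; rewrite -measure_le0 -[leRHS](lebesgue_measure_set1 (0 : R)).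
    apply: le_measure; rewrite ?inE.
    + by apply: measurableI; [apply: measurableC|]; exact: measurable_itv.
    + exact: measurable_set1.
    + by move=> x /=; rewrite !in_itv/= => -[/negP h /andP[x0 x1]]; move: h; rewrite x1 andbT -leNgt => xle; apply/eqP; rewrite eq_le xle.
  - move=> x /= h x01; apply: h => _; rewrite !patchE.
    have -> // : (x \in A) = (x \in `]b, +oo[%classic).
    have [hA1 hA2] := hA _ x01.
    apply/idP/idP; rewrite !inE/= in_itv/= andbT//.
have [b0|b0] := leP b 0.
  rewrite (E setT)//= => x; rewrite in_itv/= => /andP[x0 _]; split=> // _; exact: le_lt_trans x0.
have [b1|b1] := leP 1 b.
  rewrite (E set0) ?integral_set0//= => x; rewrite in_itv/= => /andP[_ x1]; split=> // bx.
  by have := lt_trans (le_lt_trans b1 bx) x1; rewrite ltxx.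
have b01 : 0 < b < 1 by rewrite b0.
pose A := [set x : R | s b x < 2^-1].
have ms : measurable_fun (setT : set (T1 R)) (s b).
  apply: measurable_funD => //; apply: measurable_funM => //.
  by apply: measurable_funB => //; exact: measurable_cos_affine.
have mA : measurable (A : set (T1 R)).
  rewrite (_ : A = setT `&` s b @^-1` `]-oo, 2^-1[%classic); first exact: ms.
  by apply/seteqP; split=> x; rewrite /A /= in_itv/=; [split|case].
rewrite (E A)//; last by move=> x x01; rewrite /A/= (s_threshold b01 x01).
have := integral_above b01; rewrite /Rintegral.
have -> : (\int[P1]_x (f x * (if s b x < 2^-1 then 1 else 0))%:E = \int[P1]_(x in A) (f x)%:E)%E.
  rewrite [RHS]integral_mkcond; apply: eq_integral => x _; rewrite patchE /A.
  case: ifPn => h; first by rewrite mem_set// mulr1.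
  by rewrite memNset ?mulr0// => /= h'; rewrite h' in h.
move=> h; rewrite -[LHS]fineK ?h//; apply: integrable_fin_num => //.
by apply: integrableS fi.
Qed.

(** The integral of f vanishes on all rays by [integral_ray], so the positive and
    negative parts of f have the same integral on every Borel set. *)
Theorem fourier_uniqueness : {ae P1, forall x, f x = 0}.
Proof.
have mf : measurable_fun (setT : set (T1 R)) (EFin \o f) := measurable_int _ fi.
have ip := integrable_funepos measurableT fi.
have iN := integrable_funeneg measurableT fi.
have sub0 (X Y : \bar R) : X \is a fin_num -> Y \is a fin_num -> (X - Y = 0)%E -> X = Y.
  by move: X Y => [x| |] [y| |] //= _ _ [] /eqP; rewrite subr_eq0 => /eqP ->.
have fpn (A : set (T1 R)) : measurable A ->
    ((\int[P1]_(x in A) ((EFin \o f)^\+ x) \is a fin_num) &&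
     (\int[P1]_(x in A) ((EFin \o f)^\- x) \is a fin_num))%E.
  move=> mA; apply/andP; split; apply: integrable_fin_num => //.
    exact: (integrableS measurableT mA _ ip).
  exact: (integrableS measurableT mA _ iN).
have p0 A : (0 <= induced_charge ip A)%E by exact: integral_ge0.
have n0 A : (0 <= induced_charge iN A)%E by exact: integral_ge0.
pose mp : {measure set (T1 R) -> \bar R} := measure_of_charge _ p0.
pose mn : {measure set (T1 R) -> \bar R} := measure_of_charge _ n0.
have mpn A : measurable A -> mp A = mn A.
  apply: (@measure_unique _ R (T1 R) (@RGenOInfty.G R) (fun n => `](- n%:R)%R, +oo[%classic) _ _ _ _ mp mn).
  - exact: RGenOInfty.measurableE.
  - move=> _ _ [x ->] [y ->]; exists (Num.max x y).
    by apply/seteqP; split => z /=; rewrite !in_itv/= !andbT gt_max => /andP.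
  - by move=> n; exists (- n%:R)%R.
  - rewrite -subTset => x _; exists (Num.truncn `|x|).+1 => //=; rewrite in_itv/= andbT ltrNl.
    by apply: (@le_lt_trans _ _ `|x|); [rewrite -normrN ler_norm|exact: truncnS_gt].
  - move=> _ [b ->]; rewrite /mp /mn /= /measure_of_charge /induced_charge.
    have mb : measurable (`]b, +oo[%classic : set (T1 R)) by exact: measurable_itv.
    have h := integral_ray b; rewrite integralE in h.
    have /andP[fp fn] := fpn _ mb.
    exact: sub0 fp fn h.
  - move=> k; rewrite /mp /= /measure_of_charge /induced_charge.
    have mb : measurable (`](- k%:R)%R, +oo[%classic : set (T1 R)) by exact: measurable_itv.
    by have /andP[/fin_numPlt/andP[]] := fpn _ mb.
have : ae_eq P1 setT (EFin \o f) (cst 0%E).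
  apply: integral_ae_eq => // A _ mA; rewrite integral0 integralE.
  have := mpn A mA; rewrite /mp /mn /= /measure_of_charge /induced_charge => ->.
  by rewrite subee//; have /andP[] := fpn _ mA.
by apply: filterS => x /(_ I) /= [].
Qed.

End fourier_uniqueness.

(** * Weak derivatives along lines *)

Section trigonometric_integrals.
Context {R : realType}.
Implicit Types (c a x s : R).

Lemma is_derive_sin_affine c a x : is_derive x 1 (fun y : R => sin (c * y + a)) (c * cos (c * x + a)).
Proof.
have h1 : is_derive x 1 (fun y : R => c * y + a) c.
  by apply: trigger_derive; rewrite /GRing.scale/=; ring.
have := @is_derive1_comp R sin (fun y : R => c * y + a) x _ _ (is_derive_sin (c * x + a)) h1.
by rewrite mulrC.
Qed.

Lemma integral_cos_from s c a : 0 <= s < 1 -> c != 0 ->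
  \int[P1]_x ((if s <= x then 1 else 0) * cos (c * x + a)) =
  c^-1 * sin (c + a) - c^-1 * sin (c * s + a).
Proof.
move=> /andP[s0 s1] c0.
have mc := @measurable_cos_affine R c a.
have mi : measurable_fun (setT : set (T1 R)) (fun x : R => if s <= x then 1 else 0 : R).
  by apply: measurable_fun_ifT => //; exact: measurable_fun_ler.
rewrite /Rintegral integral_P1; last by apply/measurable_EFinP; exact: measurable_funM.
have -> : (\int[leb R]_(x in `[0%R, 1%R[) ((if (s <= x)%R then 1 else 0) * cos (c * x + a))%:E =
   \int[leb R]_(x in `[s, 1%R[) (cos (c * x + a))%:E)%E.
  rewrite [LHS]integral_mkcond [RHS]integral_mkcond; apply: eq_integral => x _.
  rewrite !patchE !mem_setE !in_itv/=.
  case: (leP s x) => sx; last by case: ifP => //; rewrite mul0r.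
  by rewrite (le_trans s0 sx)/= mul1r.
rewrite integral_itv_bndo_bndc; last by apply: measurable_funTS; apply/measurable_EFinP.
have cF (F : R -> R) : continuous F -> {within `[s, 1], continuous F}.
  by move=> cF; exact: continuous_subspaceT.
have c1 : continuous (fun x : R => cos (c * x + a)).
  move=> x; apply: (@continuous_comp _ _ _ (fun x : R => c * x + a) cos); last exact: continuous_cos.
  by apply: cvgD; [apply: cvgM; [exact: cvg_cst|exact: cvg_id]|exact: cvg_cst].
have dF x : is_derive x 1 (fun y : R => c^-1 * sin (c * y + a)) (cos (c * x + a)).
  have h := is_derive_sin_affine c a x.
  by apply: trigger_derive; rewrite /GRing.scale/=; field.
have cFF : continuous (fun y : R => c^-1 * sin (c * y + a)).
  by move=> x; apply: differentiable_continuous; apply/derivable1_diffP; have [] := dF x.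
rewrite (@continuous_FTC2 _ _ (fun y => c^-1 * sin (c * y + a)))//.
- by rewrite mulr1 -EFinB.
- exact: cF.
- split.
  + by move=> x _; have [] := dF x.
  + by apply: cvg_at_right_filter; exact: cFF.
  + by apply: cvg_at_left_filter; exact: cFF.
- by move=> x _; rewrite derive1E; have [] := dF x.
Qed.

Lemma integral_cos_P1 c a : c != 0 ->
  \int[P1]_x cos (c * x + a) = c^-1 * sin (c + a) - c^-1 * sin a.
Proof.
move=> c0; have s0 : 0 <= (0 : R) < 1 by rewrite lexx ltr01.
have := integral_cos_from a s0 c0; rewrite mulr0 add0r => <-.
rewrite /Rintegral; congr fine; apply: ae_eq_integral => //.
- by apply/measurable_EFinP; exact: measurable_cos_affine.
- apply/measurable_EFinP; apply: measurable_funM; last exact: measurable_cos_affine.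
  by apply: measurable_fun_ifT => //; exact: measurable_fun_ler.
- exists (~` `[0, 1[%classic); split.
  + by apply: measurableC; exact: measurable_itv.
  + by rewrite /= P1E setICl measure0.
  + move=> x /= h; apply: contra_not h; rewrite in_itv/= => /andP[x0 _] _.
    by rewrite x0 mul1r.
Qed.

Lemma sin_period (k : int) a : sin (2 * pi * k%:~R + a) = sin a.
Proof.
have P n (b : R) : sin (b + 2 * pi * n%:R) = sin b.
  have := periodicn (@sinD2pi R) n b.
  by rewrite -(mulr_natr (pi *+ 2) n) -(mulr_natl pi 2).
case: k => n; first by rewrite addrC -[n%:~R]/(n%:R) P.
rewrite NegzE intrN -[n.+1%:~R]/(n.+1%:R) -[LHS](P n.+1); congr sin; ring.
Qed.

Lemma cos_period (k : int) a : cos (2 * pi * k%:~R + a) = cos a.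
Proof. by rewrite -!sinDpihalf -addrA sin_period. Qed.

Lemma integral_cos_mode (k : int) a : k != 0 ->
  \int[P1]_x cos (2 * pi * k%:~R * x + a) = 0.
Proof.
move=> k0; rewrite integral_cos_P1 ?sin_period ?subrr//.
by rewrite !mulf_neq0 ?intr_eq0 ?pnatr_eq0// gt_eqF ?pi_gt0.
Qed.

End trigonometric_integrals.

Section weak_derivative_on_circle.
Context {R : realType}.
Local Notation intg1 f := (P1.-integrable (setT : set (T1 R)) (EFin \o f)).
Local Notation intg2 f := (P2.-integrable (setT : set (T2 R)) (EFin \o f)).
Variables f h : R -> R.
Hypotheses (fi : intg1 f) (hi : intg1 h).

Definition primitive (x : R) := \int[P1]_s (h s * (if s <= x then 1 else 0)).

Lemma bounded_step2 : bounded_measurable (fun z : T2 R => if (z.2 : R) <= z.1 then 1 else 0 : R).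
Proof.
split; last by exists 1 => z; case: ifP => _; rewrite ?normr1 ?normr0.
apply: measurable_fun_ifT => //.
by apply: measurable_fun_ler; [exact: measurable_snd|exact: measurable_fst].
Qed.

Lemma integrable_step2 : intg2 (fun z : R * R => h z.2 * (if z.2 <= z.1 then 1 else 0)).
Proof.
apply: (@integrableM_bounded _ (T2 R) R P2 (fun z => h z.2)); last exact: bounded_step2.
exact: (integrable_preserves preserves_snd hi).
Qed.

Lemma integrable_primitive : intg1 primitive.
Proof.
have := integrable_row (integrable_preserves preserves_swap integrable_step2).
by apply: eq_integrable.
Qed.

Hypothesis weak : forall (k : int) a,
  \int[P1]_x (f x * (2 * pi * k%:~R * sin (2 * pi * k%:~R * x + a))) =
  \int[P1]_x (h x * cos (2 * pi * k%:~R * x + a)).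

Let h0 : \int[P1]_x h x = 0.
Proof.
have := weak 0 0; rewrite mulr0.
under eq_Rintegral do rewrite mul0r mulr0.
under [in RHS]eq_Rintegral do rewrite mul0r addr0 cos0 mulr1.
by move=> <-; rewrite Rintegral_cst// mul0r.
Qed.

Let primitive_mode (k : int) a : k != 0 ->
  \int[P1]_x (primitive x * (2 * pi * k%:~R * cos (2 * pi * k%:~R * x + a))) =
  - \int[P1]_x (h x * sin (2 * pi * k%:~R * x + a)).
Proof.
move=> k0; set c := 2 * pi * k%:~R.
have c0 : c != 0 by rewrite !mulf_neq0 ?intr_eq0 ?pnatr_eq0// gt_eqF ?pi_gt0.
pose F (z : R * R) := h z.2 * (if z.2 <= z.1 then 1 else 0) * (c * cos (c * z.1 + a)).
have Fi : intg2 F.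
  apply: integrableM_bounded; first exact: integrable_step2.
  apply: bounded_measurableM; first exact: bounded_measurable_cst.
  split; last by exists 1 => z; exact: cos_max.
  exact: (measurableT_comp (measurable_cos_affine c a) measurable_fst).
transitivity (\int[P1]_x \int[P1]_s F (x, s)).
  apply: eq_Rintegral => x _; rewrite /primitive -RintegralZr//.
  apply: (@integrableM_bounded _ (T1 R) R P1 h) => //.
  split; last by exists 1 => z; case: ifP => _; rewrite ?normr1 ?normr0.
  by apply: measurable_fun_ifT => //; exact: measurable_fun_ler.
rewrite (Rfubini Fi).
have hs : intg1 (fun s => h s * sin (c * s + a)).
  apply: integrableM_bounded => //; split; last by exists 1 => z; exact: sin_max.
  have := measurable_cos_affine c (a - pi / 2).
  by congr measurable_fun; apply/funext => x; rewrite addrA cosBpihalf.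
have hc : intg1 (fun s => h s * sin (c + a)).
  by apply: integrableM_bounded => //; exact: bounded_measurable_cst.
transitivity (\int[P1]_s (h s * sin (c + a) - h s * sin (c * s + a))); last first.
  rewrite RintegralB//.
  by rewrite RintegralZr// h0 mul0r sub0r.
rewrite /Rintegral; congr fine; apply: ae_eq_integral => //.
- exact: measurable_int (integrable_row Fi).
- exact: (measurable_int P1 (integrableB measurableT hc hs)).
- exists (~` `[0, 1[%classic); split.
  + by apply: measurableC; exact: measurable_itv.
  + by rewrite /= P1E setICl measure0.
  + move=> s /= H; apply: contra_not H; rewrite in_itv/= => s01 _; congr EFin.
    rewrite -[fine _]/(\int[P1]_x F (x, s)).
    transitivity (\int[P1]_x (h s * c * ((if s <= x then 1 else 0) * cos (c * x + a)))).
      apply: eq_Rintegral => x _; rewrite /F/=.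
      by move: (h s) (if _ then _ else _) (cos _) => p q r; ring.
    have bc : bounded_measurable (fun x : T1 R => (if s <= x then 1 else 0) * cos (c * x + a)).
      apply: bounded_measurableM; last exact: bounded_cos_affine.
      split; last by exists 1 => z; case: ifP => _; rewrite ?normr1 ?normr0.
      by apply: measurable_fun_ifT => //; exact: measurable_fun_ler.
    rewrite RintegralZl//; last exact: bounded_measurable_integrable.
    by rewrite integral_cos_from//; field.
Qed.

(** f minus the primitive of h is orthogonal to all nonconstant trigonometric functions,
    hence is constant by uniqueness of Fourier series.  The constant is written as the
    mean value of f minus the primitive, so as to be measurable in a parameter. *)
Theorem weak_derivative_primitive :
  {ae P1, forall x, f x = \int[P1]_t (f t - primitive t) + primitive x}.
Proof.
pose g x := f x - primitive x.
have gi : intg1 g by exact: (integrableB measurableT fi integrable_primitive).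
pose m := \int[P1]_x g x; rewrite -/m.
have mi : intg1 (fun=> m).
  by apply: bounded_measurable_integrable; exact: bounded_measurable_cst.
suff : {ae P1, forall x, g x - m = 0}.
  by move/ae_imp; apply => x /eqP; rewrite subr_eq0 /g subr_eq => /eqP.
apply: fourier_uniqueness; first exact: (integrableB measurableT gi mi).
move=> k a.
have [->|k0] := eqVneq k 0.
  under eq_Rintegral do rewrite mulr0 mul0r add0r.
  rewrite RintegralZr//; last exact: (integrableB measurableT gi mi).
  rewrite RintegralB// Rintegral_cst//= [X in fine X](_ : _ = 1%E) ?probability_setT//.
  by rewrite mulr1 subrr mul0r.
have bc := bounded_cos_affine (2 * pi * k%:~R) a.
have c0 : 2 * pi * k%:~R != 0 :> R by rewrite !mulf_neq0 ?intr_eq0 ?pnatr_eq0// gt_eqF ?pi_gt0.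
under eq_Rintegral do rewrite mulrBl.
rewrite RintegralB//; [|exact: integrableM_bounded|exact: integrableM_bounded].
rewrite RintegralZl//; last exact: bounded_measurable_integrable.
rewrite integral_cos_mode// mulr0 subr0 /g.
under eq_Rintegral do rewrite mulrBl.
have pri := integrable_primitive.
rewrite RintegralB//; [|exact: integrableM_bounded|exact: integrableM_bounded].
apply/eqP; rewrite subr_eq0; apply/eqP/(mulfI c0).
rewrite -!RintegralZl//; [|exact: integrableM_bounded|exact: integrableM_bounded].
transitivity (\int[P1]_x (f x * (2 * pi * k%:~R * sin (2 * pi * k%:~R * x + (a + pi / 2))))).
  by apply: eq_Rintegral => x _; rewrite addrA sinDpihalf; ring.
rewrite weak; transitivity (- \int[P1]_x (h x * sin (2 * pi * k%:~R * x + a))).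
  transitivity (\int[P1]_x (-1 * (h x * sin (2 * pi * k%:~R * x + a)))).
    by apply: eq_Rintegral => x _; rewrite addrA cosDpihalf; ring.
  rewrite RintegralZl ?mulN1r//; apply: integrableM_bounded => //.
  split; last by exists 1 => z; exact: sin_max.
  have := measurable_cos_affine (2 * pi * k%:~R) (a - pi / 2).
  by congr measurable_fun; apply/funext => x; rewrite addrA cosBpihalf.
rewrite -primitive_mode//.
by apply: eq_Rintegral => x _; ring.
Qed.

End weak_derivative_on_circle.

Section weak_gradient_slices.
Context {R : realType}.
Local Notation intg1 f := (P1.-integrable (setT : set (T1 R)) (EFin \o f)).
Local Notation intg2 f := (P2.-integrable (setT : set (T2 R)) (EFin \o f)).

(** The weak equation d_1 u = G, tested against products of one trigonometric function
    of each variable only; these separate the two variables. *)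
Definition weak_d1 (u G : R * R -> R) := forall (k l : int) a b,
  \int[P2]_z (u z * ((2 * pi * k%:~R * sin (2 * pi * k%:~R * z.1 + a)) * cos (2 * pi * l%:~R * z.2 + b))) =
  \int[P2]_z (G z * (cos (2 * pi * k%:~R * z.1 + a) * cos (2 * pi * l%:~R * z.2 + b))).

Definition swap (z : R * R) : R * R := (z.2, z.1).

Lemma bounded_cos_fst c a : bounded_measurable (fun z : T2 R => cos (c * (z.1 : R) + a)).
Proof.
split; last by exists 1 => z; exact: cos_max.
exact: (measurableT_comp (measurable_cos_affine c a) measurable_fst).
Qed.

Lemma bounded_cos_snd c a : bounded_measurable (fun z : T2 R => cos (c * (z.2 : R) + a)).
Proof.
split; last by exists 1 => z; exact: cos_max.
exact: (measurableT_comp (measurable_cos_affine c a) measurable_snd).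
Qed.

Lemma bounded_sin_fst c a : bounded_measurable (fun z : T2 R => sin (c * (z.1 : R) + a)).
Proof.
have := bounded_cos_fst c (a - pi / 2); congr bounded_measurable.
by apply/funext => z; rewrite addrA cosBpihalf.
Qed.

Definition row_primitive (G : R * R -> R) (z : R * R) := primitive (fun s => G (s, z.2)) z.1.

Definition primitive_on_row (u G : R * R -> R) (y : R) := {ae P1, forall x,
  u (x, y) = \int[P1]_t (u (t, y) - row_primitive G (t, y)) + row_primitive G (x, y)}.

Variables u G : R * R -> R.
Hypotheses (ui : intg2 u) (Gi : intg2 G) (wd : weak_d1 u G).

Let defect (k : int) a (z : R * R) :=
  u z * (2 * pi * k%:~R * sin (2 * pi * k%:~R * z.1 + a)) - G z * cos (2 * pi * k%:~R * z.1 + a).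

Let defect_integrable k a : intg2 (defect k a).
Proof.
apply: integrable_realB.
- apply: integrableM_bounded => //; apply: bounded_measurableM; last exact: bounded_sin_fst.
  exact: bounded_measurable_cst.
- by apply: integrableM_bounded => //; exact: bounded_cos_fst.
Qed.

Let defect0 k a : {ae P1, forall y, \int[P1]_x defect k a (x, y) = 0}.
Proof.
apply: fourier_uniqueness; first exact: integrable_row.
move=> l b; pose W z := defect k a z * cos (2 * pi * l%:~R * z.2 + b).
have Wi : intg2 W by apply: integrableM_bounded => //; exact: bounded_cos_snd.
transitivity (\int[P1]_y \int[P1]_x W (x, y)).
  rewrite /Rintegral; congr fine; apply: ae_eq_integral => //.
  - apply: measurable_int; apply: (integrableM_bounded (integrable_row (defect_integrable k a))).
    exact: bounded_cos_affine.
  - exact: measurable_int (integrable_row Wi).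
  - apply: (ae_imp (ae_integrable_row (defect_integrable k a))) => y dy _; congr EFin.
    by rewrite -RintegralZr.
rewrite -Rintegral_P2_row//.
have h1 : intg2 (fun z => u z * ((2 * pi * k%:~R * sin (2 * pi * k%:~R * z.1 + a)) * cos (2 * pi * l%:~R * z.2 + b))).
  apply: integrableM_bounded => //; apply: bounded_measurableM; last exact: bounded_cos_snd.
  by apply: bounded_measurableM; [exact: bounded_measurable_cst|exact: bounded_sin_fst].
have h2 : intg2 (fun z => G z * (cos (2 * pi * k%:~R * z.1 + a) * cos (2 * pi * l%:~R * z.2 + b))).
  apply: integrableM_bounded => //; apply: bounded_measurableM; last exact: bounded_cos_snd.
  exact: bounded_cos_fst.
transitivity (\int[P2]_z (u z * ((2 * pi * k%:~R * sin (2 * pi * k%:~R * z.1 + a)) * cos (2 * pi * l%:~R * z.2 + b)) -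
   G z * (cos (2 * pi * k%:~R * z.1 + a) * cos (2 * pi * l%:~R * z.2 + b)))).
  by apply: eq_Rintegral => z _; rewrite /W /defect mulrBl -!mulrA.
by rewrite RintegralB// wd subrr.
Qed.

Lemma ae_forall_int (P : int -> R -> Prop) :
  (forall k, {ae P1, forall y, P k y}) -> {ae P1, forall y, forall k, P k y}.
Proof.
move=> h; have := @ae_foralln _ (T1 R) R P1 (fun n y => P (Posz n) y /\ P (Negz n) y).
by move=> /(_ (fun n => ae_and (h _) (h _))) /ae_imp; apply => y hy [n|n]; have [] := hy n.
Qed.

(** For each frequency k in the first variable, the defect of the one dimensional weak
    equation on the row y is a function of y orthogonal to all trigonometric functions,
    hence null for almost every y; and there are countably many k. *)
Theorem weak_d1_row : {ae P1, forall y, [/\ intg1 (fun x => u (x, y)),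
  intg1 (fun x => G (x, y)) & primitive_on_row u G y]}.
Proof.
have H := ae_forall_int (fun k => ae_and (defect0 k 0) (defect0 k (pi / 2))).
apply: (ae_imp (ae_and (ae_and (ae_integrable_row ui) (ae_integrable_row Gi)) H)).
move=> y [[uy Gy] {}H]; split=> //.
apply: (weak_derivative_primitive uy Gy) => k a.
set c := 2 * pi * k%:~R.
have bs b : bounded_measurable (fun x : T1 R => sin (c * x + b)).
  have := bounded_cos_affine c (b - pi / 2); congr bounded_measurable.
  by apply/funext => z; rewrite addrA cosBpihalf.
have D b : intg1 (fun x => u (x, y) * (c * sin (c * x + b))).
  apply: (@integrableM_bounded _ (T1 R) R P1 (fun x => u (x, y))) => //.
  by apply: bounded_measurableM; [exact: bounded_measurable_cst|exact: bs].
have E b : intg1 (fun x => G (x, y) * cos (c * x + b)).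
  by apply: (@integrableM_bounded _ (T1 R) R P1 (fun x => G (x, y))) => //; exact: bounded_cos_affine.
have [] := H k; rewrite /defect -/c/= !RintegralB// => /eqP; rewrite subr_eq0 => /eqP H0 /eqP.
rewrite subr_eq0 => /eqP H1.
transitivity (\int[P1]_x (cos a * (u (x, y) * (c * sin (c * x + 0))) + sin a * (u (x, y) * (c * sin (c * x + pi / 2))))).
  by apply: eq_Rintegral => x _; rewrite addr0 sinDpihalf sinD; ring.
rewrite RintegralD//; [|exact: (integrableZl measurableT (cos a) (D 0))|exact: (integrableZl measurableT (sin a) (D (pi / 2)))].
rewrite !RintegralZl// H0 H1 -!RintegralZl// -RintegralD//;
  [|exact: (integrableZl measurableT (cos a) (E 0))|exact: (integrableZl measurableT (sin a) (E (pi / 2)))].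
by apply: eq_Rintegral => x _; rewrite addr0 cosDpihalf cosD; ring.
Qed.

End weak_gradient_slices.

Section primitives_on_rows.
Context {R : realType}.
Local Notation intg1 f := (P1.-integrable (setT : set (T1 R)) (EFin \o f)).
Local Notation intg2 f := (P2.-integrable (setT : set (T2 R)) (EFin \o f)).

Lemma preserves_cross : preserves (P2 \x P2)%E P2 (fun w : T2 R * T2 R => (w.2.1, w.1.2) : T2 R).
Proof.
have := preserves_comp (preserves_pair preserves_snd preserves_fst) preserves_swap.
exact.
Qed.

Lemma ae_P2_rows (a b : R * R -> R) : measurable_fun (setT : set (T2 R)) a ->
  measurable_fun (setT : set (T2 R)) b ->
  {ae P1, forall y, {ae P1, forall x, a (x, y) = b (x, y)}} ->
  {ae P2, forall z, a z = b z}.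
Proof.
move=> ma mb ab.
have mab : measurable_fun (setT : set (T2 R)) (fun z => (`|a z - b z|)%:E).
  by apply/measurable_EFinP; apply: measurableT_comp => //; exact: measurable_funB.
have H : (\int[P2]_z (`|a z - b z|)%:E = 0)%E.
  rewrite tonelli2//.
  have -> : (0 = \int[P1]_(y in (setT : set (T1 R))) 0 :> \bar R)%E by rewrite integral0.
  apply: ae_eq_integral => //.
    by apply: (measurable_fun_fubini_tonelli_G (m1 := P1) (fun z : T2 R => (`|a z - b z|)%:E)).
  apply: (ae_imp ab) => y aby _.
  have -> : (0 = \int[P1]_(x in (setT : set (T1 R))) 0 :> \bar R)%E by rewrite integral0.
  apply: ae_eq_integral => //.
    exact: (measurableT_comp mab (measurable_pair2 y)).
  by apply: (ae_imp aby) => x -> _; rewrite subrr normr0.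
have mc : measurable_fun (setT : set (T2 R)) (fun z => (a z - b z)%:E).
  by apply/measurable_EFinP; exact: measurable_funB.
have [h _] := ae_eq_integral_abs P2 measurableT mc.
have {h} := h _; rewrite /= => /(_ H) h.
by apply: (ae_imp h) => z /(_ I) [] /eqP; rewrite subr_eq0 => /eqP.
Qed.

Variables u G : R * R -> R.
Hypotheses (ui : intg2 u) (Gi : intg2 G) (wd : weak_d1 u G).

Lemma integrable_row_primitive : intg2 (row_primitive G).
Proof.
pose F (w : T2 R * T1 R) := G (w.2, w.1.2) * (if (w.2 : R) <= w.1.1 then 1 else 0).
have pr : preserves (P2 \x P1)%E P2 (fun w : T2 R * T1 R => (w.2, w.1.2) : T2 R).
  have pid : preserves P1 P1 (fun x : T1 R => x) by split; first exact: measurable_id.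
  exact: (preserves_comp (preserves_pair preserves_snd pid) preserves_swap).
have Fi : (P2 \x P1)%E.-integrable setT (EFin \o F).
  apply: integrableM_bounded; first exact: (integrable_preserves pr Gi).
  split; last by exists 1 => z; case: ifP => _; rewrite ?normr1 ?normr0.
  apply: measurable_fun_ifT => //; apply: measurable_fun_ler; first exact: measurable_snd.
  exact: (measurableT_comp measurable_fst measurable_fst).
exact: (integrable_col_prod Fi).
Qed.

Lemma ae_primitive : {ae P2, forall z : R * R,
  u z = \int[P1]_t (u (t, z.2) - row_primitive G (t, z.2)) + row_primitive G z}.
Proof.
have pi2 := integrable_row_primitive.
apply: ae_P2_rows.
- by have /measurable_int/measurable_EFinP := ui.
- apply: measurable_funD; last by have /measurable_int/measurable_EFinP := pi2.
  have := integrable_row (integrable_realB ui pi2).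
  move=> /measurable_int/measurable_EFinP h.
  exact: (measurableT_comp h measurable_snd).
- by apply: (ae_imp (weak_d1_row ui Gi wd)) => y [].
Qed.

End primitives_on_rows.

Section trigonometric_test_functions.
Context {R : realType}.

Lemma is_derive_line (f : R * R -> R) (x v : R * R) (df : R) :
  is_derive (0 : R) 1 (fun h : R => f (h * v.1 + x.1, h * v.2 + x.2)) df -> is_derive x v f df.
Proof.
pose g (h : R) := f (h *: v + x).
rewrite (_ : (fun h => _) = g); last by [].
suff e : (fun h : R => h^-1 *: ((f \o shift x) (h *: v) - f x)) =
    (fun h : R => h^-1 *: ((g \o shift (0 : R)) (h *: (1 : R)) - g 0)).
  by move=> [dg vg]; split; [rewrite /derivable e|rewrite /derive e].
by rewrite funeqE /g => h /=; rewrite addr0 scale0r add0r [_%:A]mulr1.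
Qed.

(** The scalar c makes this family stable under both partial derivatives, so that all its
    members are smooth by induction. *)
Definition trig (c : R) (k l : int) (a b : R) (x : R * R) : R :=
  c * (cos (2 * pi * k%:~R * x.1 + a) * cos (2 * pi * l%:~R * x.2 + b)).

Lemma is_derive_cos_line (c w a y s : R) :
  is_derive (0 : R) 1 (fun h : R => c * cos (w * (h * s + y) + a))
    (c * (w * s * cos (w * y + (a + pi / 2)))).
Proof.
have h1 : is_derive (0 : R) 1 (fun h : R => w * (h * s + y) + a) (w * s).
  by apply: trigger_derive; rewrite /GRing.scale/=; ring.
have h2 := @is_derive1_comp R cos (fun h : R => w * (h * s + y) + a) 0 _ _ (is_derive_cos _) h1.
rewrite mul0r add0r in h2.
have := @is_deriveZ R R R (cos \o (fun h : R => w * (h * s + y) + a)) c 0 1 _ h2.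
by rewrite addrA cosDpihalf /GRing.scale/= [_ * (w * s)]mulrC.
Qed.

Lemma is_derive_trig1 c k l a b x :
  is_derive x ((1, 0) : R * R) (trig c k l a b) (trig (c * (2 * pi * k%:~R)) k l (a + pi / 2) b x).
Proof.
apply: is_derive_line => /=.
have := is_derive_cos_line (c * cos (2 * pi * l%:~R * x.2 + b)) (2 * pi * k%:~R) a x.1 1.
rewrite (_ : (fun h : R => _ * cos _) = (fun h => trig c k l a b (h * 1 + x.1, h * 0 + x.2))); last first.
  by apply/funext => h; rewrite /trig/= mulr0 add0r mulrCA mulrA mulrC mulrA; ring.
move=> h; apply: (is_derive_eq h); rewrite /trig; ring.
Qed.

Lemma is_derive_trig2 c k l a b x :
  is_derive x ((0, 1) : R * R) (trig c k l a b) (trig (c * (2 * pi * l%:~R)) k l a (b + pi / 2) x).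
Proof.
apply: is_derive_line => /=.
have := is_derive_cos_line (c * cos (2 * pi * k%:~R * x.1 + a)) (2 * pi * l%:~R) b x.2 1.
rewrite (_ : (fun h : R => _ * cos _) = (fun h => trig c k l a b (h * 0 + x.1, h * 1 + x.2))); last first.
  by apply/funext => h; rewrite /trig/= mulr0 add0r; ring.
move=> h; apply: (is_derive_eq h); rewrite /trig; ring.
Qed.

Lemma continuous_trig c k l a b : continuous (trig c k l a b).
Proof.
have h (w s : R) (p : R * R -> R) : continuous p -> continuous (fun x => cos (w * p x + s)).
  move=> cp x; apply: (@continuous_comp _ _ _ (fun x => w * p x + s) cos); last exact: continuous_cos.
  apply: cvgD; last exact: cvg_cst.
  by apply: cvgM; [exact: cvg_cst|exact: cp].
move=> x; apply: cvgM; first exact: cvg_cst.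
apply: cvgM.
- by apply: h => y; exact: cvg_fst.
- by apply: h => y; exact: cvg_snd.
Qed.

Lemma d1_trig c k l a b :
  d1 (trig c k l a b) = trig (c * (2 * pi * k%:~R)) k l (a + pi / 2) b.
Proof. by apply/funext => x; have [_] := is_derive_trig1 c k l a b x. Qed.

Lemma d2_trig c k l a b :
  d2 (trig c k l a b) = trig (c * (2 * pi * l%:~R)) k l a (b + pi / 2).
Proof. by apply/funext => x; have [_] := is_derive_trig2 c k l a b x. Qed.

Lemma test_trig c k l a b : test_function (trig c k l a b).
Proof.
split; last first.
  move=> n; elim: n c a b => [|n IH] c a b /=; first exact: continuous_trig.
  split; [exact: continuous_trig| |by rewrite d1_trig|by rewrite d2_trig].
  by split=> x; [have [] := is_derive_trig1 c k l a b x|have [] := is_derive_trig2 c k l a b x].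
have per (m i : int) (y s : R) : cos (2 * pi * m%:~R * (y + i%:~R) + s) = cos (2 * pi * m%:~R * y + s).
  rewrite mulrDr (_ : 2 * pi * m%:~R * i%:~R = 2 * pi * (m * i)%:~R); last by rewrite intrM mulrA.
  by rewrite addrAC addrC cos_period.
by move=> x i j; rewrite /trig/= !per.
Qed.

End trigonometric_test_functions.

Section weak_gradient_modes.
Context {R : realType}.
Local Notation intg2 f := (P2.-integrable (setT : set (T2 R)) (EFin \o f)).

Lemma integrable_P2 (f : R * R -> R) : measurable_fun (setT : set (T2 R)) f ->
  integrable_torus f -> intg2 f.
Proof.
move=> mf /integrableP[_ fi]; apply/integrableP; split; first exact/measurable_EFinP.
rewrite integral_P2//; apply/measurable_EFinP.
exact: measurableT_comp.
Qed.

Lemma Rintegral_P2 (f : R * R -> R) : measurable_fun (setT : set (T2 R)) f ->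
  \int[P2]_x f x = \int[leb2 R]_(x in Q) f x.
Proof. by move=> mf; rewrite /Rintegral integral_P2//; exact/measurable_EFinP. Qed.

Lemma measurable_trig (c : R) k l a b : measurable_fun (setT : set (T2 R)) (trig c k l a b).
Proof.
apply: measurable_funM; first exact: measurable_cst.
by apply: measurable_funM; [have [] := @bounded_cos_fst R (2 * pi * k%:~R) a|have [] := @bounded_cos_snd R (2 * pi * l%:~R) b].
Qed.

Variables (u : R * R -> R) (G : R * R -> R * R).
Hypotheses (mu_ : measurable_fun (setT : set (T2 R)) u).
Hypotheses (mG1 : measurable_fun (setT : set (T2 R)) (fun x => (G x).1)).
Hypotheses (mG2 : measurable_fun (setT : set (T2 R)) (fun x => (G x).2)).
Hypothesis wg : weak_gradient u G.

Lemma weak_gradient_integrable : [/\ intg2 u, intg2 (fun x => (G x).1) & intg2 (fun x => (G x).2)].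
Proof. by have [ui g1 g2 _] := wg; split; apply: integrable_P2. Qed.

Lemma weak_gradient_d1 : weak_d1 u (fun x => (G x).1).
Proof.
have [_ _ _ h] := wg; move=> k l a b.
have [+ _] := h _ (test_trig 1 k l a b); rewrite d1_trig.
rewrite -!Rintegral_P2; [|exact: measurable_funM mG1 (measurable_trig _ _ _ _ _)|
  exact: measurable_funM mu_ (measurable_trig _ _ _ _ _)].
have [ui _ _] := weak_gradient_integrable.
under [in X in _ = X -> _]eq_Rintegral do rewrite /trig mul1r.
move=> e; apply: oppr_inj; rewrite -{}e -mulN1r.
rewrite -(@RintegralZl _ (T2 R) R P2 setT _ (-1) measurableT); last first.
  apply: integrableM_bounded => //; apply: bounded_measurableM; last exact: bounded_cos_snd.
  by apply: bounded_measurableM; [exact: bounded_measurable_cst|exact: bounded_sin_fst].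
by apply: eq_Rintegral => x _; rewrite /trig addrA cosDpihalf; ring.
Qed.

Lemma weak_gradient_d2 : weak_d1 (u \o swap) ((fun x => (G x).2) \o swap).
Proof.
have [_ _ _ h] := wg; move=> k l a b.
have [_ +] := h _ (test_trig 1 l k b a); rewrite d2_trig.
rewrite -!Rintegral_P2; [|exact: measurable_funM mG2 (measurable_trig _ _ _ _ _)|
  exact: measurable_funM mu_ (measurable_trig _ _ _ _ _)].
have [ui _ g2] := weak_gradient_integrable.
have bt (c : R) k' l' a' b' : bounded_measurable (trig c k' l' a' b' : T2 R -> R).
  apply: bounded_measurableM; first exact: bounded_measurable_cst.
  by apply: bounded_measurableM; [exact: bounded_cos_fst|exact: bounded_cos_snd].
rewrite -(Rintegral_preserves preserves_swap (integrableM_bounded ui (bt _ _ _ _ _))).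
rewrite -(Rintegral_preserves preserves_swap (integrableM_bounded g2 (bt _ _ _ _ _))).
move=> e; apply: oppr_inj; rewrite [in RHS](_ : Rintegral _ _ _ = \int[P2]_x
  ((G (x.2, x.1)).2 * trig 1 l k b a (x.2, x.1))); last first.
  by apply: eq_Rintegral => x _; rewrite /trig/=; ring.
rewrite -{}e -mulN1r.
rewrite -(@RintegralZl _ (T2 R) R P2 setT _ (-1) measurableT); last first.
  have := integrable_preserves preserves_swap ui => ui'.
  apply: integrableM_bounded => //; apply: bounded_measurableM; last exact: bounded_cos_snd.
  by apply: bounded_measurableM; [exact: bounded_measurable_cst|exact: bounded_sin_fst].
by apply: eq_Rintegral => x _; rewrite /trig/= addrA cosDpihalf; ring.
Qed.

End weak_gradient_modes.

(** * Dyadic averages and the maximal inequality *)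

Section dyadic_intervals.
Context {R : realType}.
Implicit Types (x y : R) (n : nat).

(** The index of the dyadic interval of length 2^-n containing x. *)
Definition didx n x : int := Num.floor (2 ^+ n * x).
Definition same1 n x y := didx n x == didx n y.

Lemma same1_refl n x : same1 n x x. Proof. exact: eqxx. Qed.
Lemma same1_sym n x y : same1 n x y = same1 n y x. Proof. exact: eq_sym. Qed.
Lemma same1_trans n y x z : same1 n x y -> same1 n y z -> same1 n x z.
Proof. by rewrite /same1 => /eqP ->. Qed.

Lemma didx_eq n x (i : int) : (didx n x == i) = (i%:~R / 2 ^+ n <= x < (i%:~R + 1) / 2 ^+ n).
Proof.
have p : 0 < 2 ^+ n :> R by rewrite exprn_gt0.
by rewrite /didx floor_eq ler_pdivrMr// ltr_pdivlMr// mulrC intrD.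
Qed.

Lemma same1S n x y : same1 n.+1 x y -> same1 n x y.
Proof.
rewrite /same1 /didx exprS => /eqP h.
have E (z w : R) : Num.floor (2 * 2 ^+ n * z) = Num.floor (2 * 2 ^+ n * w) ->
    Num.floor (2 ^+ n * z) <= Num.floor (2 ^+ n * w).
  move=> {}h; rewrite floor_ge_int.
  have : 2 * Num.floor (2 ^+ n * z) <= Num.floor (2 * 2 ^+ n * w).
    by rewrite -h floor_ge_int intrM -mulrA ler_pM2l// floor_le_tmp.
  by rewrite floor_ge_int intrM -mulrA ler_pM2l.
by rewrite eq_le !E.
Qed.

Lemma same1_le m n x y : (m <= n)%N -> same1 n x y -> same1 m x y.
Proof.
move=> /subnK <-; elim: (n - m)%N => // k ih; rewrite addSn => /same1S; exact: ih.
Qed.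

Lemma same1_0 x y : 0 <= x < 1 -> 0 <= y < 1 -> same1 0 x y.
Proof.
by move=> x01 y01; rewrite /same1 /didx expr0 !mul1r !(floor_def (m := 0)).
Qed.

Lemma measurable_didx n : measurable_fun (setT : set (T1 R)) (fun x : R => (didx n x)%:~R : R).
Proof.
apply: nondecreasing_measurable => // x y xy; rewrite ler_int; apply: le_floor.
by rewrite ler_pM2l// exprn_gt0.
Qed.

(** The density of the uniform law on the dyadic interval of x. *)
Definition kap n x y : R := 2 ^+ n * (if same1 n x y then 1 else 0).

Lemma kap_ge0 n x y : 0 <= kap n x y.
Proof. by rewrite mulr_ge0 ?exprn_ge0//; case: ifP. Qed.

Lemma kap_le n x y : kap n x y <= 2 ^+ n.
Proof. by rewrite ler_piMr ?exprn_ge0//; case: ifP. Qed.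

Lemma measurable_kap n : measurable_fun (setT : set (T2 R)) (fun z : R * R => kap n z.1 z.2).
Proof.
apply: measurable_funM => //; apply: measurable_fun_ifT => //.
have -> : (fun z : R * R => same1 n z.1 z.2) = (fun z : R * R => ((didx n z.1)%:~R : R) == (didx n z.2)%:~R).
  by apply/funext => z; rewrite eqr_int.
apply: measurable_fun_eqr.
- exact: (measurableT_comp (measurable_didx n) measurable_fst).
- exact: (measurableT_comp (measurable_didx n) measurable_snd).
Qed.

Lemma cellE n x : [set y | same1 n x y] =
  `[(didx n x)%:~R / 2 ^+ n, ((didx n x)%:~R + 1) / 2 ^+ n[%classic.
Proof.
by apply/seteqP; split=> y /=; rewrite in_itv/= -didx_eq /same1 eq_sym.
Qed.

Lemma cell_sub01 n x : 0 <= x < 1 -> [set y | same1 n x y] `<=` `[0, 1[.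
Proof.
move=> x01 y /= xy; have [y0 y1] : 0 <= y /\ y < 1; last by rewrite in_itv/= y0.
have h := same1_le (leq0n n) xy; move: h; rewrite /same1 /didx expr0 !mul1r.
rewrite (floor_def (m := 0) (x := x))// eq_sym floor_eq => /andP[y0 y1].
by split.
Qed.

Lemma measurable_cell n x : measurable ([set y | same1 n x y] : set (T1 R)).
Proof. by rewrite cellE; exact: measurable_itv. Qed.

Lemma P1_cell n x : 0 <= x < 1 -> P1 [set y | same1 n x y] = (2 ^- n)%:E.
Proof.
move=> x01; rewrite P1E setIidl; last exact: cell_sub01.
have p : 0 < 2 ^+ n :> R by rewrite exprn_gt0.
rewrite cellE lebesgue_measure_itv/= lte_fin ltr_pM2r ?invr_gt0//.
rewrite ltrDl ltr01 -EFinB; congr EFin; by field; rewrite gt_eqF.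
Qed.

Lemma integral_kap n x : 0 <= x < 1 -> (\int[P1]_y (kap n x y)%:E = 1)%E.
Proof.
move=> x01; have mc := measurable_cell n x.
have p : 0 < 2 ^+ n :> R by rewrite exprn_gt0.
transitivity (\int[P1]_(y in [set y | same1 n x y]) (2 ^+ n)%:E)%E.
  rewrite [RHS]integral_mkcond; apply: eq_integral => y _; rewrite patchE /kap.
  case: ifP => h; first by rewrite mem_set// mulr1.
  by rewrite memNset ?mulr0//= h.
by rewrite integral_cst//= P1_cell// -EFinM mulfV// gt_eqF.
Qed.

End dyadic_intervals.

Section dyadic_squares.
Context {R : realType}.
Implicit Types (x y : R * R) (n : nat).

Definition same n x y := same1 n x.1 y.1 && same1 n x.2 y.2.
Definition ker n x y : R := kap n x.1 y.1 * kap n x.2 y.2.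

Lemma kerE n x y : ker n x y = 4 ^+ n * (if same n x y then 1 else 0).
Proof.
rewrite /ker /kap /same; have -> : 4 = 2 * 2 :> R by ring.
by rewrite exprMn; case: same1; case: same1; rewrite /= ?mulr0 ?mul0r ?mulr1.
Qed.

Lemma same_sym n x y : same n x y = same n y x.
Proof. by rewrite /same 2!(same1_sym n x.1, same1_sym n x.2). Qed.
Lemma same_trans n y x z : same n x y -> same n y z -> same n x z.
Proof.
by move=> /andP[a b] /andP[c d]; rewrite /same (same1_trans a c) (same1_trans b d).
Qed.

Lemma same_le m n x y : (m <= n)%N -> same n x y -> same m x y.
Proof. by move=> mn /andP[a b]; rewrite /same !(same1_le mn). Qed.

Lemma ker_ge0 n x y : 0 <= ker n x y.
Proof. by rewrite mulr_ge0 ?kap_ge0. Qed.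

Lemma ker_le n x y : ker n x y <= 4 ^+ n.
Proof. by rewrite kerE ler_piMr ?exprn_ge0//; case: ifP. Qed.

Lemma ker_sym n x y : ker n x y = ker n y x.
Proof. by rewrite !kerE same_sym. Qed.

Lemma ker_same n x y z : same n x y -> ker n x z = ker n y z.
Proof.
move=> xy; rewrite !kerE; suff -> : same n x z = same n y z by [].
apply/idP/idP => h; last exact: same_trans h.
by apply: same_trans h; rewrite same_sym.
Qed.

Lemma measurable_ker n : measurable_fun (setT : set (T2 R * T2 R))
  (fun z : (R * R) * (R * R) => ker n z.1 z.2).
Proof.
have m1 : measurable_fun setT (fun z : T2 R * T2 R => (z.1.1, z.2.1) : T2 R).
  apply: measurable_fun_pair.
  - exact: (measurableT_comp measurable_fst measurable_fst).
  - exact: (measurableT_comp measurable_fst measurable_snd).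
have m2 : measurable_fun setT (fun z : T2 R * T2 R => (z.1.2, z.2.2) : T2 R).
  apply: measurable_fun_pair.
  - exact: (measurableT_comp measurable_snd measurable_fst).
  - exact: (measurableT_comp measurable_snd measurable_snd).
apply: measurable_funM.
- exact: (measurableT_comp (measurable_kap n) m1).
- exact: (measurableT_comp (measurable_kap n) m2).
Qed.

Lemma bounded_ker n : bounded_measurable (fun z : T2 R * T2 R => ker n z.1 z.2).
Proof.
split; first exact: measurable_ker.
by exists (4 ^+ n) => z; rewrite ger0_norm ?ker_ge0// ker_le.
Qed.

Lemma bounded_ker_r n x : bounded_measurable (fun y : T2 R => ker n x y).
Proof.
split; last by exists (4 ^+ n) => z; rewrite ger0_norm ?ker_ge0// ker_le.
exact: (measurableT_comp (measurable_ker n) (measurable_pair1 x)).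
Qed.

Lemma integral_ker n x : Q x -> \int[P2]_y ker n x y = 1.
Proof.
move=> [x1 x2]; rewrite /Rintegral tonelli1.
- rewrite (_ : (\int[P1]_x0 _ = 1)%E)//.
  rewrite -[RHS](integral_kap n (x := x.1))//; apply: eq_integral => s _.
  rewrite -[RHS]mule1 -(integral_kap n (x := x.2))// -ge0_integralZl//.
  + apply/measurable_EFinP.
    exact: (measurableT_comp (measurable_kap n) (measurable_pair1 (x.2 : T1 R))).
  + by move=> t _; rewrite lee_fin kap_ge0.
  + by rewrite lee_fin kap_ge0.
- by apply/measurable_EFinP; have [] := bounded_ker_r n x.
- by move=> y; rewrite lee_fin ker_ge0.
Qed.

End dyadic_squares.

Section dyadic_averages.
Context {R : realType}.
Local Notation intg2 f := (P2.-integrable (setT : set (T2 R)) (EFin \o f)).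
Local Notation bm2 := (@bounded_measurable _ (T2 R) R).
Implicit Types (f phi : R * R -> R) (n : nat).

Lemma ae_Q : {ae P2, forall x : R * R, Q x}.
Proof. by apply: ae_P2; exact: aeW. Qed.

(** The conditional expectation of f given the dyadic squares of side 2^-n. *)
Definition avg n f (x : R * R) := \int[P2]_y (f y * ker n x y).

Definition level_constant n phi := forall x y, same n x y -> phi x = phi y.

Lemma avg_level_constant n f : level_constant n (avg n f).
Proof. by move=> x y xy; apply: eq_Rintegral => z _; rewrite (ker_same z xy). Qed.

Lemma level_constant_le m n phi : (m <= n)%N -> level_constant m phi -> level_constant n phi.
Proof. by move=> mn h x y /(same_le mn); exact: h. Qed.

Variable f : R * R -> R.
Hypothesis fi : intg2 f.

Lemma integrable_ker n x : intg2 (fun y => f y * ker n x y).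
Proof. by apply: integrableM_bounded => //; exact: bounded_ker_r. Qed.

Lemma integrable_ker_joint n : (P2 \x P2)%E.-integrable setT
  (EFin \o (fun z : T2 R * T2 R => f z.2 * ker n z.1 z.2)).
Proof.
apply: (@integrableM_bounded _ _ R _ (fun z : T2 R * T2 R => f z.2)); last exact: bounded_ker.
exact: (integrable_preserves (preserves_snd_prod P2 P2) fi).
Qed.

Lemma avg_bounded n : bm2 (avg n f).
Proof.
split.
  have := integrable_col_prod (integrable_ker_joint n).
  by move/measurable_int/measurable_EFinP.
exists (4 ^+ n * \int[P2]_y `|f y|) => x.
apply: (le_trans (le_normr_Rintegral measurableT (integrable_ker n x))).
have fi' := integrable_norm fi.
rewrite -RintegralZl//; apply: le_Rintegral => //.
- exact: (integrable_norm (integrable_ker n x)).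
- exact: integrable_realZ.
- by move=> y _; rewrite normrM mulrC ler_wpM2r// ger0_norm ?ker_ge0// ker_le.
Qed.

Lemma avg_ge0 n x : (forall y, 0 <= f y) -> 0 <= avg n f x.
Proof. by move=> f0; apply: Rintegral_ge0 => y _; rewrite mulr_ge0 ?ker_ge0. Qed.

(** The conditional expectation is an orthogonal projection. *)
Lemma avg_self_adjoint n phi : bm2 phi -> level_constant n phi ->
  \int[P2]_x (avg n f x * phi x) = \int[P2]_x (f x * phi x).
Proof.
move=> bphi cphi.
pose F (z : T2 R * T2 R) := f z.2 * ker n z.1 z.2 * phi z.1.
have Fi : (P2 \x P2)%E.-integrable setT (EFin \o F).
  apply: (integrableM_bounded (integrable_ker_joint n)).
  have [mphi [M phiM]] := bphi; split; last by exists M => z; exact: phiM.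
  exact: (measurableT_comp mphi measurable_fst).
have ai : intg2 (avg n f) by apply: bounded_measurable_integrable; exact: avg_bounded.
transitivity (\int[P2]_x \int[P2]_y F (x, y)).
  by apply: eq_Rintegral => x _; rewrite /avg -RintegralZr//; exact: integrable_ker.
rewrite (Rfubini_prod Fi).
apply: ae_eq_Rintegral.
- by have /integrable_row_prod/measurable_int/measurable_EFinP := Fi.
- by have /measurable_int/measurable_EFinP := integrableM_bounded fi bphi.
apply: (ae_imp ae_Q) => y Qy.
transitivity (\int[P2]_x (f y * phi y * ker n y x)).
  apply: eq_Rintegral => x _; rewrite /F/= (ker_sym n y) kerE.
  by case: ifPn => [/cphi ->|_]; rewrite ?mulr0 ?mul0r//; ring.
rewrite RintegralZl//; last by apply: bounded_measurable_integrable; exact: bounded_ker_r.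
by rewrite integral_ker// mulr1.
Qed.

End dyadic_averages.

Section doob.
Context {R : realType}.
Local Notation intg2 f := (P2.-integrable (setT : set (T2 R)) (EFin \o f)).
Local Notation bm2 := (@bounded_measurable _ (T2 R) R).
Variables (g : R * R -> R) (m0 : R).
Hypotheses (gi : intg2 g) (g0 : forall x, 0 <= g x) (m0_gt0 : 0 < m0).

(** The maximal function of the martingale of dyadic averages, started from the level m0
    so that its logarithm is bounded.  Only the averages at levels k < n enter. *)
Fixpoint dyadic_max n (x : R * R) : R :=
  if n is k.+1 then Num.max (dyadic_max k x) (avg k g x) else m0.

Lemma dyadic_max_gt0 n x : 0 < dyadic_max n x.
Proof. by elim: n => //= n ih; rewrite lt_max ih. Qed.

Lemma dyadic_max_ge n x : m0 <= dyadic_max n x.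
Proof. by elim: n => //= n ih; rewrite le_max ih. Qed.

Lemma avg_le_dyadic_max k n x : (k < n)%N -> avg k g x <= dyadic_max n x.
Proof.
elim: n => // n ih; rewrite ltnS leq_eqVlt => /predU1P[->|/ih] /=; rewrite le_max.
  by rewrite lexx orbT.
by move=> ->.
Qed.

Lemma dyadic_max_level n : level_constant n (dyadic_max n).
Proof.
elim: n => //= n ih x y xy; rewrite (level_constant_le (leqnSn n) ih xy).
by rewrite (level_constant_le (leqnSn n) (@avg_level_constant R n g) xy).
Qed.

Lemma dyadic_max_levelS n : level_constant n (dyadic_max n.+1).
Proof. by move=> x y xy /=; rewrite (dyadic_max_level xy) (@avg_level_constant R n g _ _ xy). Qed.

Lemma dyadic_max_bounded n : bm2 (dyadic_max n).
Proof.
elim: n => [|n [mM [M hM]]] /=; first exact: bounded_measurable_cst.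
have [ma [A hA]] := avg_bounded gi n; split; first exact: measurable_maxr.
exists (Num.max M A) => x; rewrite le_max.
by case: (leP (dyadic_max n x) (avg n g x)) => _; rewrite ?hM ?hA ?orbT.
Qed.

Lemma ln_dyadic_max_bounded n : bm2 (fun x => ln (dyadic_max n x)).
Proof.
have [mM [M hM]] := dyadic_max_bounded n; split.
  exact: (measurableT_comp (@measurable_ln R) mM).
exists (Num.max `|ln m0| `|ln M|) => x; rewrite le_max.
have x0 := dyadic_max_gt0 n x.
have xM : dyadic_max n x <= M by rewrite (le_trans (ler_norm _)).
have l1 : ln m0 <= ln (dyadic_max n x) by rewrite ler_ln ?posrE// dyadic_max_ge.
have l2 : ln (dyadic_max n x) <= ln M by rewrite ler_ln ?posrE// (lt_le_trans x0).
have [h|h] := leP 0 (ln (dyadic_max n x)).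
  by rewrite (ger0_norm h) (le_trans l2 (ler_norm _)) orbT.
by rewrite (ltr0_norm h) -normrN (le_trans _ (ler_norm _))// lerN2.
Qed.

(** For fixed s, the map M -> M - s ln M has its minimum at M = s. *)
Lemma max_sub_ln_le (M s : R) : 0 < M -> 0 <= s ->
  Num.max M s - s * ln (Num.max M s) <= M - s * ln M.
Proof.
move=> M0 s0; case: (leP M s) => // Ms.
have sgt0 : 0 < s by exact: lt_le_trans Ms.
have h : ln (M / s) <= M / s - 1.
  have := @le_ln1Dx R (M / s - 1); rewrite addrCA subrr addr0; apply.
  by rewrite ltrBrDl subrr; exact: divr_gt0.
rewrite ln_div ?posrE// in h.
have : s * (ln M - ln s) <= s * (M / s - 1) by rewrite ler_wpM2l// ltW.
rewrite mulrBr mulrBr mulrC mulr1 mulrCA mulfV ?gt_eqF// mulr1; lra.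
Qed.

(** Only the average of g at level n matters against functions that are constant on the
    squares of level n; the inequality is then the pointwise one above. *)
Lemma doob_decreasing n :
  \int[P2]_x (dyadic_max n.+1 x - g x * ln (dyadic_max n.+1 x)) <=
  \int[P2]_x (dyadic_max n x - g x * ln (dyadic_max n x)).
Proof.
have Mi k : intg2 (dyadic_max k) by apply: bounded_measurable_integrable; exact: dyadic_max_bounded.
have gl k : intg2 (fun x => g x * ln (dyadic_max k x)).
  by apply: integrableM_bounded => //; exact: ln_dyadic_max_bounded.
have ai : intg2 (avg n g) by apply: bounded_measurable_integrable; exact: avg_bounded.
have al k : intg2 (fun x => avg n g x * ln (dyadic_max k x)).
  by apply: integrableM_bounded => //; exact: ln_dyadic_max_bounded.
rewrite !RintegralB// -!(avg_self_adjoint gi (n := n)); first last.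
- by move=> x y xy; rewrite (dyadic_max_levelS xy).
- exact: ln_dyadic_max_bounded.
- by move=> x y xy; rewrite (dyadic_max_level xy).
- exact: ln_dyadic_max_bounded.
rewrite -!RintegralB//; apply: le_Rintegral => //.
- exact: integrable_realB.
- exact: integrable_realB.
- by move=> x _; apply: max_sub_ln_le; [exact: dyadic_max_gt0|exact: avg_ge0].
Qed.

Lemma ln_le_powR (q y : R) : 0 < q -> 0 < y -> ln y <= y `^ q / q.
Proof.
move=> q0 y0; rewrite ler_pdivlMr// mulrC -ln_powR.
have yq : 0 < y `^ q by exact: powR_gt0.
have := @le_ln1Dx R (y `^ q - 1); rewrite addrCA subrr addr0 => h.
by apply: (le_trans (h _)); rewrite ?gerBl ?ler01//; lra.
Qed.

Definition doob_cst (p : R) := 2 `^ (p - 1) / (p - 1).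

(** From ln (a / (2 b)) <= a / (2 b) - 1, which produces a / 2, and a bound of ln (2 b) by
    a power of b. *)
Lemma mul_ln_le (p a b : R) : 1 < p -> 0 < a -> 0 <= b ->
  b * ln a <= 2^-1 * a + doob_cst p * b `^ p.
Proof.
move=> p1 a0; rewrite le_eqVlt => /predU1P[<-|b0].
  by rewrite mul0r powR0 ?mulr0 ?addr0; [lra|rewrite gt_eqF//; lra].
have h : ln (a / (2 * b)) <= a / (2 * b) - 1.
  have := @le_ln1Dx R (a / (2 * b) - 1); rewrite addrCA subrr addr0; apply.
  by rewrite ltrBrDl subrr divr_gt0// mulr_gt0.
rewrite ln_div ?posrE ?mulr_gt0// in h.
have h2 : ln (2 * b) <= (2 * b) `^ (p - 1) / (p - 1).
  by apply: ln_le_powR; [lra|exact: mulr_gt0].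
have E : b * ((2 * b) `^ (p - 1) / (p - 1)) = doob_cst p * b `^ p.
  have p0 : 0 < p by lra.
  by rewrite powRM ?(ltW b0)// /doob_cst -(mulr_powRB1 (ltW b0) p0); ring.
have {h} : b * (ln a - ln (2 * b)) <= b * (a / (2 * b) - 1) by rewrite ler_pM2l.
have -> : b * (a / (2 * b) - 1) = 2^-1 * a - b by field; rewrite gt_eqF.
have := ler_wpM2l (ltW b0) h2; rewrite E; lra.
Qed.

(** By [doob_decreasing], the mean of M - m0 is at most the mean of g (ln M - ln m0), and
    [mul_ln_le] absorbs half of the mean of M in the left-hand side. *)
Lemma doob_L1 (p : R) n : 1 < p -> (\int[P2]_x ((g x / m0) `^ p)%:E <= 1)%E ->
  \int[P2]_x dyadic_max n x <= 2 * (1 + doob_cst p) * m0.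
Proof.
move=> p1 gp.
have Mi k : intg2 (dyadic_max k) by apply: bounded_measurable_integrable; exact: dyadic_max_bounded.
have gl k : intg2 (fun x => g x * ln (dyadic_max k x)).
  by apply: integrableM_bounded => //; exact: ln_dyadic_max_bounded.
have mg : measurable_fun (setT : set (T2 R)) g by have /measurable_int/measurable_EFinP := gi.
have mgp : measurable_fun (setT : set (T2 R)) (fun x => (g x / m0) `^ p).
  have mq : measurable_fun (setT : set (T2 R)) (fun x => g x / m0) by exact: measurable_funM.
  exact: (measurableT_comp (measurable_powR p) mq).
have gpi : intg2 (fun x => (g x / m0) `^ p).
  apply/integrableP; split; first exact/measurable_EFinP.
  apply: (@le_lt_trans _ _ 1%E); last by rewrite ltry.
  apply: le_trans gp; rewrite le_eqVlt; apply/orP; left; apply/eqP.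
  by apply: eq_integral => x _; rewrite gee0_abs// lee_fin powR_ge0.
have gp1 : \int[P2]_x (g x / m0) `^ p <= 1.
  rewrite -lee_fin /Rintegral fineK//; exact: integrable_fin_num.
have dec : \int[P2]_x (dyadic_max n x - g x * ln (dyadic_max n x)) <=
    \int[P2]_x (m0 - g x * ln m0).
  by elim: n => // n; apply: le_trans; exact: doob_decreasing.
have m0i : intg2 (fun=> m0).
  by apply: bounded_measurable_integrable; exact: bounded_measurable_cst.
have gl0 : intg2 (fun x => g x * ln m0) := gl 0%N.
rewrite !RintegralB// Rintegral_cst//= [X in fine X](_ : _ = 1%E) ?probability_setT// mulr1 in dec.
have : \int[P2]_x (g x * ln (dyadic_max n x) - g x * ln m0) <=
    \int[P2]_x (2^-1 * dyadic_max n x + (m0 * doob_cst p) * (g x / m0) `^ p).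
  apply: le_Rintegral => //.
  - exact: integrable_realB.
  - by apply: integrable_realD; exact: integrable_realZ.
  - move=> x _; have M0 := dyadic_max_gt0 n x.
    have := @mul_ln_le p (dyadic_max n x / m0) (g x / m0) p1 (divr_gt0 M0 m0_gt0) (divr_ge0 (g0 x) (ltW m0_gt0)).
    rewrite ln_div ?posrE// => /(ler_wpM2l (ltW m0_gt0)).
    set B := _ `^ p; set c := doob_cst p; set l := ln _; set l0 := ln m0.
    have -> : m0 * (g x / m0 * (l - l0)) = g x * l - g x * l0.
      by field; rewrite gt_eqF.
    have -> // : m0 * (2^-1 * (dyadic_max n x / m0) + c * B) =
        2^-1 * dyadic_max n x + m0 * c * B.
    by field; rewrite gt_eqF.
rewrite RintegralB// RintegralD//; [|exact: integrable_realZ|exact: integrable_realZ].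
rewrite !RintegralZl//.
have c0 : 0 <= doob_cst p.
  by apply: divr_ge0; [exact: powR_ge0|rewrite subr_ge0 ltW].
have : m0 * doob_cst p * \int[P2]_x (g x / m0) `^ p <= m0 * doob_cst p.
  by rewrite -[leRHS]mulr1 ler_wpM2l// mulr_ge0// ltW.
move: dec; set A := Rintegral _ _ _; set B := Rintegral _ _ _; set D := Rintegral _ _ _.
set E := Rintegral _ _ _; move: A B D E (doob_cst p) => A B D E c.
clear -m0; lra.
Qed.

End doob.

(** * Poincare inequality on dyadic squares *)

Section poincare.
Context {R : realType}.
Local Notation intg1 f := (P1.-integrable (setT : set (T1 R)) (EFin \o f)).
Local Notation intg2 f := (P2.-integrable (setT : set (T2 R)) (EFin \o f)).
Local Open Scope ereal_scope.

Lemma bounded_same1 n y : bounded_measurable (fun s : T1 R => if same1 n y s then 1%R else 0%R : R).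
Proof.
split; last by exists 1%R => z; case: ifP => _; rewrite ?normr1 ?normr0.
apply: measurable_fun_ifT => //; apply: (measurable_fun_bool true).
by rewrite setTI; exact: measurable_cell.
Qed.

Lemma primitive_sub_le n (h : R -> R) (y z : R) : intg1 h -> same1 n y z ->
  (`|primitive h y - primitive h z|)%:E <=
  \int[P1]_s (`|h s| * (if same1 n y s then 1 else 0))%:E.
Proof.
move=> hi yz.
have bs (t : R) : bounded_measurable (fun s : T1 R => if s <= t then 1 else 0 : R)%R.
  split; last by exists 1%R => w; case: ifP => _; rewrite ?normr1 ?normr0.
  by apply: measurable_fun_ifT => //; exact: measurable_fun_ler.
have hs t : intg1 (fun s => h s * (if s <= t then 1 else 0))%R by exact: integrableM_bounded.
rewrite /primitive -RintegralB//.
have i1 := integrable_realB (hs y) (hs z).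
have i2 : intg1 (fun s => `|h s| * (if same1 n y s then 1 else 0))%R.
  by apply: integrableM_bounded (bounded_same1 n y); exact: (integrable_norm hi).
rewrite -[leRHS]fineK; last exact: integrable_fin_num.
rewrite lee_fin; apply: (le_trans (le_normr_Rintegral measurableT i1)).
apply: le_Rintegral => //; first exact: integrable_norm i1.
move=> s _; rewrite -mulrBr normrM; apply: ler_wpM2l => //.
have mono (a b : R) : (a <= b)%R -> (didx n a <= didx n b)%R.
  by move=> ab; apply: le_floor; rewrite ler_pM2l// exprn_gt0.
move: yz; rewrite /same1 => /eqP yz.
case: (leP s y) => sy; case: (leP s z) => sz; rewrite ?subrr ?normr0 ?subr0 ?sub0r ?normrN ?normr1.
- by case: ifP.
- by rewrite ifT// eq_le {1}yz !mono// ltW.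
- by rewrite ifT// eq_le mono ?(ltW sy)//= yz mono.
- by case: ifP.
Qed.

(** The integral of |G| on the part of the row of z lying in the dyadic square of z; it
    bounds the oscillation, on this segment, of a function with derivative G. *)
Definition osc n (G : R * R -> R) (z : R * R) :=
  \int[P1]_s (`|G (s, z.2)| * (if same1 n z.1 s then 1 else 0))%:E.

Variables u G1 G2 : R * R -> R.
Hypotheses (ui : intg2 u) (G1i : intg2 G1) (G2i : intg2 G2).
Hypotheses (wd1 : weak_d1 u G1) (wd2 : weak_d1 (u \o swap) (G2 \o swap)).

Let ui' : intg2 (u \o swap) := integrable_preserves preserves_swap ui.
Let G2i' : intg2 (G2 \o swap) := integrable_preserves preserves_swap G2i.

Let row_ae v G : intg2 v -> intg2 G -> weak_d1 v G ->
  {ae P2, forall z : R * R, intg1 (fun s => G (s, z.2)) /\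
  v z = (\int[P1]_t (v (t, z.2) - row_primitive G (t, z.2)) + row_primitive G z)%R}.
Proof.
move=> vi Gi w; apply: ae_and (ae_primitive vi Gi w).
exact: (ae_preserves preserves_snd (ae_integrable_row Gi)).
Qed.

(** From y, go along the row to the point with the first coordinate of z, then along the
    column.  All three points are in the same square. *)
Lemma ae_sub_le_osc n : {ae (P2 \x P2), forall w : (R * R) * (R * R),
  same n w.1 w.2 -> (`|u w.1 - u w.2|)%:E <= osc n G1 w.1 + osc n (G2 \o swap) (swap w.2)}.
Proof.
have h1 := row_ae ui G1i wd1.
have h2 := ae_preserves preserves_swap (row_ae ui' G2i' wd2).
have a1 := ae_preserves (preserves_fst_prod P2 P2) h1.
have a2 := ae_preserves (preserves_snd_prod P2 P2) h2.
have a3 := ae_preserves preserves_cross (ae_and h1 h2).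
apply: (ae_imp (ae_and (ae_and a1 a2) a3)) => -[[y1 y2] [z1 z2]] /=.
move=> [[[i1 e1] [i2 e2]] [[_ e3] [_ e4]]] /andP[/= s1 s2].
apply: (@le_trans _ _ ((`|u (y1, y2) - u (z1, y2)|)%:E + (`|u (z1, y2) - u (z1, z2)|)%:E)).
  by rewrite -EFinD lee_fin; exact: ler_distD.
rewrite leeD//.
- rewrite e1 e3 opprD addrACA subrr add0r; exact: primitive_sub_le.
- rewrite /swap/= in e2 e4; rewrite e2 e4 opprD addrACA subrr add0r distrC.
  by apply: primitive_sub_le => //; rewrite same1_sym.
Qed.

End poincare.

Section poincare_average.
Context {R : realType}.
Local Notation intg1 f := (P1.-integrable (setT : set (T1 R)) (EFin \o f)).
Local Notation intg2 f := (P2.-integrable (setT : set (T2 R)) (EFin \o f)).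
Local Open Scope ereal_scope.

Lemma measurable_osc n (G : R * R -> R) : measurable_fun (setT : set (T2 R)) G ->
  measurable_fun (setT : set (T2 R)) (osc n G).
Proof.
move=> mG; pose F (w : T2 R * T1 R) := (`|G (w.2, w.1.2)| * (if same1 n w.1.1 w.2 then 1 else 0))%:E.
have mF : measurable_fun (setT : set (T2 R * T1 R)) F.
  apply/measurable_EFinP; apply: measurable_funM.
    apply: measurableT_comp => //.
    have h : measurable_fun setT (fun w : T2 R * T1 R => (w.2, w.1.2) : T2 R).
      apply: measurable_fun_pair; first exact: measurable_snd.
      exact: (measurableT_comp measurable_snd measurable_fst).
    exact: (measurableT_comp mG h).
  apply: measurable_fun_ifT => //.
  have -> : (fun w : T2 R * T1 R => same1 n w.1.1 w.2) =
     (fun w => ((didx n w.1.1)%:~R : R) == (didx n w.2)%:~R).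
    by apply/funext => w; rewrite eqr_int.
  apply: measurable_fun_eqr.
  - apply: (measurableT_comp (measurable_didx n)).
    exact: (measurableT_comp measurable_fst measurable_fst).
  - exact: (measurableT_comp (measurable_didx n) measurable_snd).
apply: (measurable_fun_fubini_tonelli_F (m2 := P1) F mF).
by move=> w; rewrite lee_fin mulr_ge0//; case: ifP.
Qed.

Lemma osc_ge0 n (G : R * R -> R) z : 0 <= osc n G z.
Proof. by apply: integral_ge0 => s _; rewrite lee_fin mulr_ge0//; case: ifP. Qed.

Lemma measurable_kap_r n x : measurable_fun (setT : set (T1 R)) (fun y : R => kap n x y).
Proof. exact: (measurableT_comp (measurable_kap n) (measurable_pair1 (x : T1 R))). Qed.

(** Averaging over the square the integral along rows gives the integral over the square,
    times the length 2^-n of the rows. *)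
Lemma integral_osc n (G : R * R -> R) x : measurable_fun (setT : set (T2 R)) G -> Q x ->
  \int[P2]_y (osc n G y * (ker n x y)%:E) =
  (2 ^- n)%:E * \int[P2]_y (`|G y| * ker n x y)%:E.
Proof.
move=> mG [x1 x2]; have mo := measurable_osc n mG.
have mk := measurable_kap_r.
have mG' y2 : measurable_fun (setT : set (T1 R)) (fun s : R => G (s, y2)).
  exact: (measurableT_comp mG (measurable_pair2 (y2 : T1 R))).
have mker : measurable_fun (setT : set (T2 R)) (fun y => (ker n x y)%:E).
  by apply/measurable_EFinP; have [] := bounded_ker_r n x.
have mGk : measurable_fun (setT : set (T2 R)) (fun y => (`|G y| * ker n x y)%:E).
  apply/measurable_EFinP; apply: measurable_funM; first exact: measurableT_comp.
  exact/measurable_EFinP.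
have p : (0 < 2 ^+ n :> R)%R by rewrite exprn_gt0.
rewrite -ge0_integralZl//; last by move=> y _; rewrite lee_fin mulr_ge0 ?ker_ge0.
rewrite tonelli2; [|exact: emeasurable_funM|by move=> y; rewrite mule_ge0 ?osc_ge0// lee_fin ker_ge0].
rewrite [RHS]tonelli2; first last.
- by move=> y; apply: mule_ge0; rewrite lee_fin; [rewrite invr_ge0 ltW|rewrite mulr_ge0 ?ker_ge0].
- exact: measurable_funeM.
apply: eq_integral => y2 _.
transitivity (osc n G (x.1, y2) * (kap n x.2 y2)%:E).
  transitivity (\int[P1]_y1 ((osc n G (x.1, y2) * (kap n x.2 y2)%:E) * (kap n x.1 y1)%:E)).
    apply: eq_integral => y1 _; rewrite /ker EFinM/=.
    have [h|h] := boolP (same1 n x.1 y1); last first.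
      by rewrite [kap n x.1 y1]/kap (negbTE h) mulr0 mul0e !mule0.
    have -> : osc n G (y1, y2) = osc n G (x.1, y2).
      apply: eq_integral => s _; congr (_ * _)%:E => /=.
      have -> // : same1 n y1 s = same1 n x.1 s.
      by apply/idP/idP => h'; [exact: same1_trans h'|apply: same1_trans h'; rewrite same1_sym].
    by rewrite [X in _ * X]muleC muleA.
  rewrite ge0_integralZl//.
  - by rewrite integral_kap// mule1.
  - by apply/measurable_EFinP; exact: mk.
  - by move=> y1 _; rewrite lee_fin kap_ge0.
  - by rewrite mule_ge0 ?osc_ge0// lee_fin kap_ge0.
rewrite muleC -ge0_integralZl//; first last.
- by rewrite lee_fin kap_ge0.
- by move=> s _; rewrite lee_fin mulr_ge0//; case: ifP.
- apply/measurable_EFinP; apply: measurable_funM; first exact: measurableT_comp.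
  by have [] := bounded_same1 n x.1.
apply: eq_integral => s _ /=; rewrite -!EFinM; congr EFin; rewrite /ker/= /kap.
move: (if same1 n x.1 s then _ else _) (if same1 n x.2 y2 then _ else _) => a b.
by field; rewrite gt_eqF.
Qed.

Lemma ker_swap n (x y : R * R) : ker n (swap x) (swap y) = ker n x y.
Proof. by rewrite /ker/= mulrC. Qed.

Lemma ker_mul n (x y z : R * R) : (ker n y z * ker n x y = ker n x z * ker n x y)%R.
Proof.
rewrite [ker n x y]kerE; case: ifPn => h; last by rewrite !mulr0.
by rewrite (ker_same z h).
Qed.

Lemma Rintegral_EFin (f : R * R -> R) : intg2 f ->
  (\int[P2]_x f x)%R%:E = \int[P2]_x (f x)%:E.
Proof.
by move=> fi; rewrite /Rintegral fineK//; exact: (integrable_fin_num measurableT fi).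
Qed.

Lemma integral_kerE n (x : R * R) : Q x -> \int[P2]_y (ker n x y)%:E = 1.
Proof.
move=> Qx; have i := @bounded_measurable_integrable _ (T2 R) R P2 _ (bounded_ker_r n x).
by rewrite -Rintegral_EFin// integral_ker.
Qed.

Variables u G1 G2 : R * R -> R.
Hypotheses (ui : intg2 u) (G1i : intg2 G1) (G2i : intg2 G2).
Hypotheses (wd1 : weak_d1 u G1) (wd2 : weak_d1 (u \o swap) (G2 \o swap)).

Lemma norm_sub_avg_le n y : Q y ->
  (`|u y - avg n u y|)%:E <= \int[P2]_z (`|u y - u z| * ker n y z)%:E.
Proof.
move=> Qy.
have ci : intg2 (fun=> u y) by apply: bounded_measurable_integrable; exact: bounded_measurable_cst.
have di : intg2 (fun z => (u y - u z) * ker n y z)%R.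
  by apply: integrableM_bounded (bounded_ker_r n y); exact: integrable_realB.
have ni : intg2 (fun z => `|u y - u z| * ker n y z)%R.
  apply: integrableM_bounded (bounded_ker_r n y).
  exact: (integrable_norm (integrable_realB ci ui)).
rewrite -Rintegral_EFin// lee_fin.
have -> : (u y - avg n u y = \int[P2]_z ((u y - u z) * ker n y z))%R.
  under eq_Rintegral do rewrite mulrBl.
  have ki : intg2 (ker n y) by exact: (bounded_measurable_integrable P2 (bounded_ker_r n y)).
  rewrite RintegralB//; [|exact: integrable_realZ|exact: integrable_ker].
  by rewrite RintegralZl// integral_ker// mulr1.
apply: (le_trans (le_normr_Rintegral measurableT di)).
apply: le_Rintegral => //; first exact: (integrable_norm di).
by move=> z _; rewrite normrM (ger0_norm (ker_ge0 n y z)).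
Qed.

Let mu_ : measurable_fun (setT : set (T2 R)) u.
Proof. by have /measurable_int/measurable_EFinP := ui. Qed.
Let mG1 : measurable_fun (setT : set (T2 R)) G1.
Proof. by have /measurable_int/measurable_EFinP := G1i. Qed.
Let mG2' : measurable_fun (setT : set (T2 R)) (G2 \o swap).
Proof. by have /measurable_int/measurable_EFinP := integrable_preserves preserves_swap G2i. Qed.

Let W n x (w : (R * R) * (R * R)) : R := ker n w.1 w.2 * ker n x w.1.
Let W0 n x w : (0 <= W n x w)%R. Proof. by rewrite mulr_ge0 ?ker_ge0. Qed.
Let mW n x : measurable_fun (setT : set (T2 R * T2 R)) (W n x).
Proof.
apply: measurable_funM; first exact: measurable_ker.
have [mk _] := bounded_ker_r n x.
exact: (measurableT_comp mk measurable_fst).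
Qed.

(** The weight [W] is the density of two independent uniform points of the square of x. *)
Lemma poincare_osc n x : Q x ->
  \int[P2]_y \int[P2]_z (`|u y - u z| * W n x (y, z))%:E <=
  (2 ^- n)%:E * \int[P2]_z ((`|G1 z| + `|G2 z|) * ker n x z)%:E.
Proof.
move=> Qx.
have Qsx : Q (swap x) by case: Qx.
have mo1 := measurable_osc n mG1.
have mo2 := measurable_osc n mG2'.
have mo2s : measurable_fun (setT : set (T2 R)) (fun z => osc n (G2 \o swap) (swap z)).
  exact: (measurableT_comp mo2 (preserves_swap).1).
have mker y : measurable_fun (setT : set (T2 R)) (fun z => (ker n y z)%:E).
  by apply/measurable_EFinP; have [] := bounded_ker_r n y.
have mWE : measurable_fun (setT : set (T2 R * T2 R)) (fun w => (W n x w)%:E).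
  by apply/measurable_EFinP; exact: mW.
have mo1w : measurable_fun (setT : set (T2 R * T2 R)) (fun w => osc n G1 w.1).
  exact: (measurableT_comp mo1 measurable_fst).
have mo2w : measurable_fun (setT : set (T2 R * T2 R)) (fun w => osc n (G2 \o swap) (swap w.2)).
  exact: (measurableT_comp mo2s measurable_snd).
pose D (w : T2 R * T2 R) := (`|u w.1 - u w.2| * W n x w)%:E.
have mD : measurable_fun (setT : set (T2 R * T2 R)) D.
  apply/measurable_EFinP; apply: measurable_funM; last exact: mW.
  apply: measurableT_comp => //; apply: measurable_funB.
  - exact: (measurableT_comp mu_ measurable_fst).
  - exact: (measurableT_comp mu_ measurable_snd).
have D0 w : 0 <= D w by rewrite lee_fin mulr_ge0.
rewrite -(@fubini_tonelli1 _ _ (T2 R) (T2 R) R P2 P2 D mD D0).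
pose o1 (w : T2 R * T2 R) := osc n G1 w.1 * (W n x w)%:E.
pose o2 (w : T2 R * T2 R) := osc n (G2 \o swap) (swap w.2) * (W n x w)%:E.
have o10 w : 0 <= o1 w by rewrite mule_ge0 ?osc_ge0// lee_fin.
have o20 w : 0 <= o2 w by rewrite mule_ge0 ?osc_ge0// lee_fin.
have mo1W : measurable_fun setT o1 by exact: emeasurable_funM.
have mo2W : measurable_fun setT o2 by exact: emeasurable_funM.
apply: (@le_trans _ _ (\int[P2 \x P2]_w (o1 w + o2 w))).
  apply: ae_ge0_le_integral => //.
  - by move=> w _; rewrite adde_ge0.
  - exact: emeasurable_funD.
  - apply: (ae_imp (ae_sub_le_osc ui G1i G2i wd1 wd2 n)) => w hw _.
    rewrite /D /o1 /o2 -muleDl// ?ge0_adde_def ?inE ?osc_ge0//.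
    have [h|h] := boolP (same n w.1 w.2).
      by rewrite EFinM; apply: lee_wpmul2r; [rewrite lee_fin|exact: hw].
    by rewrite /W [ker n w.1 w.2]kerE (negbTE h) mulr0 mul0r mulr0 mule0.
rewrite ge0_integralD// [X in X + _]fubini_tonelli1// [X in _ + X]fubini_tonelli2//.
have E1 : \int[P2]_y \int[P2]_z o1 (y, z) = \int[P2]_y (osc n G1 y * (ker n x y)%:E).
  apply: ae_eq_integral => //.
  - exact: (measurable_fun_fubini_tonelli_F (m2 := P2) o1 mo1W o10).
  - exact: emeasurable_funM.
  - apply: (ae_imp ae_Q) => y Qy _.
    transitivity (\int[P2]_z ((osc n G1 y * (ker n x y)%:E) * (ker n y z)%:E)).
      by apply: eq_integral => z _; rewrite /o1 /W/= mulrC EFinM muleA.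
    rewrite ge0_integralZl//; first by rewrite integral_kerE// mule1.
    + by move=> z _; rewrite lee_fin ker_ge0.
    + by rewrite mule_ge0 ?osc_ge0// lee_fin ker_ge0.
have E2 : \int[P2]_z \int[P2]_y o2 (y, z) = \int[P2]_z (osc n (G2 \o swap) (swap z) * (ker n x z)%:E).
  apply: eq_integral => z _.
  transitivity (\int[P2]_y ((osc n (G2 \o swap) (swap z) * (ker n x z)%:E) * (ker n x y)%:E)).
    by apply: eq_integral => y _; rewrite /o2 /W/= ker_mul EFinM muleA.
  rewrite ge0_integralZl//; first by rewrite integral_kerE// mule1.
  + by move=> y _; rewrite lee_fin ker_ge0.
  + by rewrite mule_ge0 ?osc_ge0// lee_fin ker_ge0.
have E3 : \int[P2]_z (osc n (G2 \o swap) (swap z) * (ker n x z)%:E) =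
    (2 ^- n)%:E * \int[P2]_z (`|G2 z| * ker n x z)%:E.
  have h := ge0_integral_preserves preserves_swap (f := fun z => osc n (G2 \o swap) z * (ker n (swap x) z)%:E).
  transitivity (\int[P2]_z (osc n (G2 \o swap) z * (ker n (swap x) z)%:E)).
    rewrite -h.
    - by apply: eq_integral => z _; rewrite -[in LHS](ker_swap n x z).
    - exact: emeasurable_funM.
    - by move=> z; rewrite mule_ge0 ?osc_ge0// lee_fin ker_ge0.
  rewrite (integral_osc n mG2' Qsx); congr (_ * _).
  rewrite -[RHS](ge0_integral_preserves preserves_swap (f := fun z => (`|G2 z| * ker n x z)%:E)).
  - by apply: eq_integral => z _ /=; rewrite -(ker_swap n x (swap z)).
  - apply/measurable_EFinP; apply: measurable_funM; last by have [] := bounded_ker_r n x.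
    by apply: measurableT_comp => //; have /measurable_int/measurable_EFinP := G2i.
  - by move=> z; rewrite lee_fin mulr_ge0 ?ker_ge0.
rewrite E1 E2 E3 (integral_osc n mG1 Qx) -muleDr//; last first.
  rewrite ge0_adde_def ?inE//; apply: integral_ge0 => z _; rewrite lee_fin mulr_ge0 ?ker_ge0//.
rewrite -ge0_integralD//.
- by under eq_integral do rewrite -EFinD -mulrDl.
- by move=> z _; rewrite lee_fin mulr_ge0 ?ker_ge0.
- apply/measurable_EFinP; apply: measurable_funM; last by have [] := bounded_ker_r n x.
  exact: measurableT_comp.
- by move=> z _; rewrite lee_fin mulr_ge0 ?ker_ge0.
- apply/measurable_EFinP; apply: measurable_funM; last by have [] := bounded_ker_r n x.
  by apply: measurableT_comp => //; have /measurable_int/measurable_EFinP := G2i.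
Qed.

Lemma poincare_avg n x : Q x ->
  (avg n (fun y => `|u y - avg n u y|) x <= 2 ^- n * avg n (fun z => `|G1 z| + `|G2 z|) x)%R.
Proof.
move=> Qx.
have ai : intg2 (avg n u) by apply: bounded_measurable_integrable; exact: avg_bounded.
have ri : intg2 (fun y => `|u y - avg n u y|)%R.
  exact: (integrable_norm (integrable_realB ui ai)).
have gi : intg2 (fun z => `|G1 z| + `|G2 z|)%R.
  by apply: integrable_realD; exact: (integrable_norm _).
have rki := integrable_ker ri n x.
have gki := integrable_ker gi n x.
rewrite -lee_fin EFinM /avg !Rintegral_EFin//; apply: le_trans (poincare_osc n Qx).
have mF : measurable_fun (setT : set (T2 R * T2 R)) (fun w => (`|u w.1 - u w.2| * W n x w)%:E).
  apply/measurable_EFinP; apply: measurable_funM; last exact: mW.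
  apply: measurableT_comp => //; apply: measurable_funB.
  - exact: (measurableT_comp mu_ measurable_fst).
  - exact: (measurableT_comp mu_ measurable_snd).
apply: ae_ge0_le_integral => //.
- by move=> y _; rewrite lee_fin mulr_ge0 ?ker_ge0.
- exact: measurable_int rki.
- by move=> y _; apply: integral_ge0 => z _; rewrite lee_fin mulr_ge0.
- apply: (measurable_fun_fubini_tonelli_F (m2 := P2) _ mF) => w.
  by rewrite lee_fin mulr_ge0.
- apply: (ae_imp ae_Q) => y Qy _; rewrite EFinM.
  apply: (@le_trans _ _ ((\int[P2]_z (`|u y - u z| * ker n y z)%:E) * (ker n x y)%:E)).
    by apply: lee_wpmul2r; [rewrite lee_fin ker_ge0|exact: norm_sub_avg_le].
  rewrite -ge0_integralZr//.
  + rewrite le_eqVlt; apply/orP; left; apply/eqP; apply: eq_integral => z _; rewrite /W/= -EFinM; congr EFin; ring.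
  + apply/measurable_EFinP; apply: measurable_funM; last by have [] := bounded_ker_r n y.
    by apply: measurableT_comp => //; apply: measurable_funB.
  + by move=> z _; rewrite lee_fin mulr_ge0 ?ker_ge0.
  + by rewrite lee_fin ker_ge0.
Qed.

End poincare_average.

Section dyadic_lipschitz.
Context {R : realType}.
Local Notation intg2 f := (P2.-integrable (setT : set (T2 R)) (EFin \o f)).
Local Notation bm2 := (@bounded_measurable _ (T2 R) R).

Lemma avg_norm_le n (f : R * R -> R) x : intg2 f -> `|avg n f x| <= avg n (fun y => `|f y|) x.
Proof.
move=> fi; apply: (le_trans (le_normr_Rintegral measurableT (integrable_ker fi n x))).
apply: le_Rintegral => //.
- exact: (integrable_norm (integrable_ker fi n x)).
- by apply: integrable_ker; exact: (integrable_norm fi).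
- by move=> y _; rewrite normrM (ger0_norm (ker_ge0 n x y)).
Qed.

Lemma avgS_le n (f : R * R -> R) x : intg2 f -> (forall y, 0 <= f y) ->
  avg n.+1 f x <= 4 * avg n f x.
Proof.
move=> fi f0; rewrite -RintegralZl//; last exact: integrable_ker.
apply: le_Rintegral => //.
- exact: integrable_ker.
- by apply: integrable_realZ; exact: integrable_ker.
- move=> y _; rewrite [leRHS]mulrCA ler_wpM2l// !kerE exprS -mulrA.
  rewrite ler_wpM2l// ler_wpM2l ?exprn_ge0//.
  have [h|_] := boolP (same n.+1 x y); last by case: ifP.
  by rewrite (same_le (leqnSn n) h).
Qed.

Lemma avg_level n m (f : R * R -> R) x : Q x -> (n <= m)%N -> avg m (avg n f) x = avg n f x.
Proof.
move=> Qx nm; have lc := level_constant_le nm (@avg_level_constant _ n f).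
have ki := @bounded_measurable_integrable _ (T2 R) R P2 _ (bounded_ker_r m x).
transitivity (\int[P2]_y (avg n f x * ker m x y)); last first.
  by rewrite (@RintegralZl _ (T2 R) R P2 setT (ker m x) (avg n f x) measurableT ki) integral_ker// mulr1.
apply: eq_Rintegral => y _; rewrite [ker m x y]kerE.
case: ifPn => h; last by rewrite !mulr0.
by rewrite (lc _ _ h).
Qed.

Variables u G1 G2 : R * R -> R.
Hypotheses (ui : intg2 u) (G1i : intg2 G1) (G2i : intg2 G2).
Hypotheses (wd1 : weak_d1 u G1) (wd2 : weak_d1 (u \o swap) (G2 \o swap)).
Let g x := `|G1 x| + `|G2 x|.
Let gi : intg2 g.
Proof. by apply: integrable_realD; exact: (integrable_norm _). Qed.
Let g0 x : 0 <= g x. Proof. by rewrite addr_ge0. Qed.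

Let r n x := `|u x - avg n u x|.
Let ri n : intg2 (r n).
Proof.
apply: (integrable_norm (integrable_realB ui _)).
by apply: bounded_measurable_integrable; exact: avg_bounded.
Qed.

(** The increment is the average over a subsquare of u minus its average; a subsquare has
    a quarter of the area, and [poincare_avg] bounds the average on the large square. *)
Lemma avg_step n x : Q x -> `|avg n u x - avg n.+1 u x| <= 4 * (2 ^- n * avg n g x).
Proof.
move=> Qx.
have ai : intg2 (avg n u) by apply: bounded_measurable_integrable; exact: avg_bounded.
have -> : avg n u x - avg n.+1 u x = - avg n.+1 (fun y => u y - avg n u y) x.
  rewrite -{1}(avg_level u Qx (leqnSn n)) /avg -opprB; congr -%R.
  rewrite -RintegralB//; [|exact: integrable_ker|exact: integrable_ker].
  by apply: eq_Rintegral => y _; rewrite mulrBl.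
rewrite normrN; apply: (le_trans (avg_norm_le _ _ (integrable_realB ui ai))).
apply: (le_trans (avgS_le _ _ (ri n) _)); first by move=> y; exact: normr_ge0.
by rewrite ler_pM2l//; exact: (poincare_avg ui G1i G2i wd1 wd2 n Qx).
Qed.

Variable m0 : R.
Hypothesis m0_gt0 : 0 < m0.
Let M := dyadic_max g m0.

(** The steps at levels m, ..., L - 1 have sizes 4 * 2^-n, a geometric series. *)
Lemma avg_telescope m L x : Q x -> (m <= L)%N ->
  `|avg m u x - avg L u x| <= 8 * (2 ^- m - 2 ^- L) * M L x.
Proof.
move=> Qx /subnKC <-; elim: (L - m)%N => [|k IH]; first by rewrite addn0 !subrr normr0 mulr0 mul0r.
rewrite addnS; set n := (m + k)%N in IH *.
apply: (le_trans (ler_distD (avg n u x) _ _)).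
have hM : avg n g x <= M n.+1 x by apply: avg_le_dyadic_max.
have hM' : M n x <= M n.+1 x by rewrite /M/= le_max lexx.
have p2 : 0 < 2 ^- n :> R by rewrite invr_gt0 exprn_gt0.
have hs := avg_step n Qx.
have e : 2 ^- n.+1 = 2^-1 * 2 ^- n :> R by rewrite exprS invfM.
have mn : 2 ^- n <= 2 ^- m :> R by rewrite lef_pV2 ?posrE ?exprn_gt0// ler_weXn2l ?ler1n// leq_addr.
rewrite e; set a := 2 ^- n in p2 hs mn IH *; set b := 2 ^- m in mn IH *.
have h1 : a * avg n g x <= a * M n.+1 x by rewrite ler_pM2l.
have h2 : 8 * (b - a) * M n x <= 8 * (b - a) * M n.+1 x by rewrite ler_wpM2l// mulr_ge0// subr_ge0.
by clear - IH hs h1 h2; lra.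
Qed.

Definition dyadic_lip L x := 8 * M L x + 2 ^+ L * r L x.

Lemma dyadic_lip_ge0 L x : 0 <= dyadic_lip L x.
Proof.
apply: addr_ge0; apply: mulr_ge0 => //; first exact/ltW/(dyadic_max_gt0 g m0_gt0).
exact: normr_ge0.
Qed.

Lemma integrable_dyadic_lip L : intg2 (dyadic_lip L).
Proof.
apply: integrable_realD; apply: integrable_realZ => //.
by apply: bounded_measurable_integrable; exact: dyadic_max_bounded.
Qed.

(** The averages at level m agree at x and y.  From level m to level L the change is at
    most 8 * 2^-m M L by [avg_telescope], and from level L to u it is 2^-L times the
    second term. *)
Lemma dyadic_lip_le L m x y : Q x -> Q y -> (m <= L)%N -> same m x y ->
  `|u x - u y| <= 2 ^- m * (dyadic_lip L x + dyadic_lip L y).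
Proof.
move=> Qx Qy mL xy.
have hx := avg_telescope Qx mL; have hy := avg_telescope Qy mL.
have e : avg m u x = avg m u y by exact: avg_level_constant.
have Mx : 0 < M L x by exact: dyadic_max_gt0.
have My : 0 < M L y by exact: dyadic_max_gt0.
have -> : u x - u y = (u x - avg L u x) - (avg m u x - avg L u x) +
  (avg m u y - avg L u y) - (u y - avg L u y) by rewrite e; ring.
apply: (le_trans (ler_normB _ _)).
apply: (@le_trans _ _ (`|u x - avg L u x| + `|avg m u x - avg L u x| + `|avg m u y - avg L u y| + `|u y - avg L u y|)).
  by rewrite lerD2r (le_trans (ler_normD _ _))// lerD2r ler_normB.
rewrite /dyadic_lip /r.
have pL : 0 < 2 ^+ L :> R by rewrite exprn_gt0.
have mn : 1 <= 2 ^- m * 2 ^+ L :> R.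
  by rewrite mulrC ler_pdivlMr ?exprn_gt0// mul1r ler_weXn2l ?ler1n.
have mn' : 0 < 2 ^- L :> R by rewrite invr_gt0.
have pm : 0 < 2 ^- m :> R by rewrite invr_gt0 exprn_gt0.
move: (2 ^- L) mn' hx hy => c c0 hx hy.
have [rx ry] : 0 <= `|u x - avg L u x| /\ 0 <= `|u y - avg L u y| by split.
have cx : 0 < c * M L x by rewrite mulr_gt0.
have cy : 0 < c * M L y by rewrite mulr_gt0.
have rx1 := ler_peMl rx mn; have ry1 := ler_peMl ry mn.
move: rx1 ry1 hx hy cx cy; clear.
move: (`|u x - avg L u x|) (`|u y - avg L u y|) (`|avg m u x - _|) (`|avg m u y - _|).
move: (M L x) (M L y) (2 ^- m) (2 ^+ L) => X Y a b r1 r2 s1 s2.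
lra.
Qed.

(** By [poincare_avg] integrated over the torus. *)
Lemma integral_remainder n : \int[P2]_x (2 ^+ n * r n x) <= \int[P2]_x g x.
Proof.
have p : 0 < 2 ^+ n :> R by rewrite exprn_gt0.
rewrite RintegralZl// -ler_pdivlMl//.
have one : bm2 (fun=> 1) by exact: bounded_measurable_cst.
have l1 : level_constant n (fun=> 1 : R) by [].
have sa f (fi : intg2 f) : \int[P2]_x avg n f x = \int[P2]_x f x.
  have := avg_self_adjoint fi one l1.
  by under eq_Rintegral do rewrite mulr1; under [X in _ = X -> _]eq_Rintegral do rewrite mulr1.
have ai f (fi : intg2 f) : intg2 (avg n f).
  by apply: bounded_measurable_integrable; exact: avg_bounded.
rewrite -(sa _ (ri n)) -(sa _ gi) -RintegralZl//; last exact: ai.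
apply: ae_le_Rintegral => //; first exact: ai.
  by apply: integrable_realZ; exact: ai.
exact: (ae_imp ae_Q) (fun x Qx => poincare_avg ui G1i G2i wd1 wd2 n Qx).
Qed.

Variable p : R.
Hypotheses (p1 : 1 < p) (gp : (\int[P2]_x ((g x / m0) `^ p)%:E <= 1)%E).

Lemma integral_g_le : \int[P2]_x g x <= 2 * m0.
Proof.
have m0i : intg2 (fun=> m0).
  by apply: bounded_measurable_integrable; exact: bounded_measurable_cst.
have mg : measurable_fun (setT : set (T2 R)) g by have /measurable_int/measurable_EFinP := gi.
have mgp : measurable_fun (setT : set (T2 R)) (fun x => (g x / m0) `^ p).
  have mq : measurable_fun (setT : set (T2 R)) (fun x => g x / m0) by exact: measurable_funM.
  exact: (measurableT_comp (measurable_powR p) mq).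
have gpi : intg2 (fun x => (g x / m0) `^ p).
  apply/integrableP; split; first exact/measurable_EFinP.
  apply: (@le_lt_trans _ _ 1%E); last by rewrite ltry.
  apply: le_trans gp; rewrite le_eqVlt; apply/orP; left; apply/eqP.
  by apply: eq_integral => x _; rewrite gee0_abs// lee_fin powR_ge0.
apply: (@le_trans _ _ (\int[P2]_x (m0 + m0 * (g x / m0) `^ p))).
  apply: le_Rintegral => //.
    by apply: integrable_realD => //; exact: integrable_realZ.
  move=> x _; have q0 : 0 <= g x / m0 by rewrite divr_ge0// ltW.
  have -> : g x = m0 * (g x / m0) by field; rewrite gt_eqF.
  rewrite -[X in _ <= X + _]mulr1 -mulrDr ler_pM2l// mulrAC divff ?gt_eqF// mul1r.
  have [q1|q1] := leP (g x / m0) 1.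
    by rewrite (le_trans q1)// lerDl powR_ge0.
  apply: (@le_trans _ _ ((g x / m0) `^ p)); last by rewrite lerDr.
  by rewrite -[leLHS]powRr1// ler_powR// ltW.
rewrite RintegralD//; last exact: integrable_realZ.
rewrite RintegralZl// Rintegral_cst//= [X in fine X](_ : _ = 1%E) ?probability_setT// mulr1.
rewrite (_ : 2 * m0 = m0 + m0 * 1); last by ring.
by rewrite lerD2l ler_pM2l// -lee_fin Rintegral_EFin.
Qed.

Lemma integral_dyadic_lip L :
  \int[P2]_x dyadic_lip L x <= (18 + 16 * doob_cst p) * m0.
Proof.
have Mi : intg2 (M L) by apply: bounded_measurable_integrable; exact: dyadic_max_bounded.
rewrite /dyadic_lip RintegralD//; [|exact: integrable_realZ|exact: integrable_realZ].
rewrite RintegralZl//.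
have h1 := doob_L1 gi g0 m0_gt0 L p1 gp.
have h2 := le_trans (integral_remainder L) integral_g_le.
move: h1 h2; rewrite -/M; set A := Rintegral _ _ _; set B := Rintegral _ _ _; move: A B (doob_cst p) => A B c.
clear => h1 h2; rewrite (_ : _ * m0 = 8 * (2 * (1 + c) * m0) + 2 * m0); last by ring.
by apply: lerD => //; rewrite ler_pM2l.
Qed.
End dyadic_lipschitz.

(** * Lipschitz bound for Sobolev functions off dyadic scales *)

Section sine_bounds.
Context {R : realType}.
Implicit Types x y t : R.

Lemma sin_mvt x y : exists c, sin y - sin x = cos c * (y - x) /\ (x <= y -> x <= c <= y).
Proof.
have key a b : a <= b -> exists2 c : R, c \in `[a, b] & sin b - sin a = cos c * (b - a).
  move=> ab; apply: (@MVT_segment R sin cos a b ab).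
    by apply: continuous_subspaceT => z; exact: continuous_sin.
have [xy|yx] := leP x y.
  by have [c cc e] := key _ _ xy; exists c; split.
have [c cc e] := key _ _ (ltW yx); exists c; split => //.
by rewrite -opprB e -mulrN opprB.
Qed.

Lemma sin_lipschitz x y : `|sin x - sin y| <= `|x - y|.
Proof.
have [c [-> _]] := sin_mvt y x.
by rewrite normrM ler_piMl ?cos_max.
Qed.

Lemma abs_sin_lipschitz x y : `| `|sin x| - `|sin y| | <= `|x - y|.
Proof. exact: le_trans (ler_dist_dist _ _) (sin_lipschitz x y). Qed.

Lemma cos_ge x : 1 - x ^+ 2 / 2 <= cos x.
Proof.
have -> : cos x = 1 - sin (x / 2) ^+ 2 *+ 2.
  rewrite [in LHS](_ : x = (x / 2) *+ 2); last by rewrite -mulr_natr; field.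
  by rewrite cos_mulr2n cos2sin2 -[LHS]/(_ *+ 2 - 1) mulrnBl; ring.
have h : sin (x / 2) ^+ 2 <= (x / 2) ^+ 2.
  rewrite -(real_normK (num_real (sin _))) -[leRHS](real_normK (num_real _)).
  rewrite ler_pXn2r ?nnegrE//.
  by have := sin_lipschitz (x / 2) 0; rewrite sin0 !subr0.
by move: h; move: (sin _ ^+ 2) => s; rewrite expr_div_n; lra.
Qed.

(** A weak form of the concavity of the sine: sin y >= y / 2 for y <= 1, and the sine
    is increasing up to pi / 2. *)
Lemma sin_pi_ge t : 0 <= t <= 2^-1 -> t <= sin (pi * t).
Proof.
move=> /andP[t0 t1]; have p2 := @pi_ge2 R; have p0 : 0 < pi :> R by exact: pi_gt0.
have half y : 0 <= y <= 1 -> y / 2 <= sin y.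
  move=> /andP[y0 y1]; have [c [e /(_ y0)/andP[c0 cy]]] := sin_mvt 0 y.
  move: e; rewrite sin0 !subr0 => ->; rewrite mulrC ler_wpM2r//.
  apply: le_trans (cos_ge c).
  have : c ^+ 2 <= 1 by rewrite expr_le1// (le_trans cy).
  by lra.
have pt : 2 * t <= pi * t by rewrite ler_wpM2r.
have [h|h] := leP (pi * t) 1.
  apply: le_trans (half (pi * t) _); last by rewrite h mulr_ge0// ltW.
  by lra.
apply: (le_trans t1); apply: (@le_trans _ _ (sin 1)); first by have := half 1; rewrite ler01 lexx mul1r; exact.
have ph := @pihalf_ge1 R.
have ptp : pi * t <= pi / 2 by rewrite ler_wpM2l// ltW.
rewrite ltW// ltr_sin// in_itv/=; apply/andP; split; lra.
Qed.

Lemma sin_pi_int t (k : int) : `|sin (pi * (t + k%:~R))| = `|sin (pi * t)|.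
Proof.
have nat1 s (n : nat) : `|sin (pi * (s + n%:R))| = `|sin (pi * s)|.
  elim: n => [|n IH]; first by rewrite addr0.
  by rewrite -natr1 addrA mulrDr mulr1 sinDpi normrN.
case: k => n; first by exact: nat1.
rewrite NegzE mulrNz; apply: esym.
rewrite -[in LHS](subrK (n.+1%:~R : R) t); exact: nat1.
Qed.

(** |sin (pi t)| is comparable to the distance from t to the integers. *)
Lemma near_int t : exists k : int, `|t + k%:~R| <= `|sin (pi * t)| /\ `|t + k%:~R| <= 2^-1.
Proof.
pose k : int := - Num.floor (t + 2^-1).
have [h1 h2] : - 2^-1 <= t + k%:~R /\ t + k%:~R <= 2^-1.
  have := Num.Theory.floor_itv (t + 2^-1); rewrite /k intrD mulrNz.
  move=> /andP[a b]; split; lra.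
exists k; rewrite -(sin_pi_int t k); move: h1 h2; move: (t + _) => s h1 h2.
split; last by rewrite ler_norml h1.
have -> : `|sin (pi * s)| = `|sin (pi * `|s|)|.
  by have [_|_] := ger0P s; rewrite // mulrN sinN normrN.
apply: le_trans (ler_norm _); apply: sin_pi_ge.
by rewrite normr_ge0 ler_norml h1.
Qed.

End sine_bounds.

Section shifted_gradients.
Context {R : realType}.
Local Notation intg2 f := (P2.-integrable (setT : set (T2 R)) (EFin \o f)).

Definition torus_shift (a b : R) (x : R * R) : R * R := fr (x.1 + a, x.2 + b).

Lemma cos_fr1 (k : int) (y a c : R) :
  cos (2 * pi * k%:~R * fr1 (y + a) + (c - 2 * pi * k%:~R * a)) = cos (2 * pi * k%:~R * y + c).
Proof.
rewrite /fr1; set n := Num.floor _; rewrite -[RHS](cos_period (- (k * n))) mulrNz intrM.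
by congr cos; ring.
Qed.

Lemma sin_fr1 (k : int) (y a c : R) :
  sin (2 * pi * k%:~R * fr1 (y + a) + (c - 2 * pi * k%:~R * a)) = sin (2 * pi * k%:~R * y + c).
Proof.
rewrite /fr1; set n := Num.floor _; rewrite -[RHS](sin_period (- (k * n))) mulrNz intrM.
by congr sin; ring.
Qed.

(** A translation of the torus only changes the phases of the test functions. *)
Lemma weak_d1_shift (a b : R) (u G : R * R -> R) : 0 <= a < 1 -> 0 <= b < 1 ->
  intg2 u -> intg2 G -> weak_d1 u G -> weak_d1 (u \o torus_shift a b) (G \o torus_shift a b).
Proof.
move=> ha hb ui Gi wd k l c d.
have ps := preserves_shift ha hb.
have := wd k l (c - 2 * pi * k%:~R * a) (d - 2 * pi * l%:~R * b).
have bc : bounded_measurable (fun z : T2 R => 2 * pi * k%:~R * sin (2 * pi * k%:~R * z.1 + (c - 2 * pi * k%:~R * a)) *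
    cos (2 * pi * l%:~R * z.2 + (d - 2 * pi * l%:~R * b))).
  apply: bounded_measurableM; last exact: bounded_cos_snd.
  by apply: bounded_measurableM; [exact: bounded_measurable_cst|exact: bounded_sin_fst].
have bc' : bounded_measurable (fun z : T2 R => cos (2 * pi * k%:~R * z.1 + (c - 2 * pi * k%:~R * a)) *
    cos (2 * pi * l%:~R * z.2 + (d - 2 * pi * l%:~R * b))).
  by apply: bounded_measurableM; [exact: bounded_cos_fst|exact: bounded_cos_snd].
rewrite -(Rintegral_preserves ps (integrableM_bounded ui bc)).
rewrite -(Rintegral_preserves ps (integrableM_bounded Gi bc')).
under eq_Rintegral do rewrite /= sin_fr1 cos_fr1.
by under [in X in _ = X -> _]eq_Rintegral do rewrite /= !cos_fr1.
Qed.

End shifted_gradients.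

Section one_third_trick.
Context {R : realType}.
Implicit Types (x y : R) (m L : nat).

Lemma same1_fr1 m x y : same1 m x y -> same1 m (fr1 x) (fr1 y).
Proof.
move=> h; have := same1_le (leq0n m) h; rewrite /same1 /didx expr0 !mul1r => /eqP e.
move: h; rewrite /same1 /didx /fr1 e; set n := Num.floor y.
have ez (z : R) : 2 ^+ m * (z - n%:~R) = 2 ^+ m * z + (- (2 ^+ m * n))%:~R :> R.
  by rewrite rmorphN rmorphM rmorphXn/= mulrBr.
move=> /eqP h; apply/eqP.
by rewrite !ez !Num.Theory.floorDrz ?intr_int// h.
Qed.

Definition third (b : bool) : R := if b then 3^-1 else 0.

(** If both grids separated x and y, there would be an endpoint i / 2^m of one grid and an
    endpoint j / 2^m + 1/3 of the other between x and y.  The integer 3 (i - j) would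
    differ from 2^m by less than 1, hence be equal to it, but 3 does not divide 2^m. *)
Lemma third_trick m x y : `|x - y| < (3 * 2 ^+ m)^-1 ->
  exists b, same1 m (x - third b) (y - third b).
Proof.
wlog xy : x y / x <= y.
  move=> h; have [/h//|/ltW/h h'] := leP x y.
  by rewrite distrC => /h'[b]; rewrite same1_sym; exists b.
rewrite distrC ger0_norm ?subr_ge0// => d.
have [s0|s0] := boolP (same1 m x y); first by exists false; rewrite !subr0.
have [s1|s1] := boolP (same1 m (x - 3^-1) (y - 3^-1)); first by exists true.
have p : 0 < 2 ^+ m :> R by rewrite exprn_gt0.
(* two points of different intervals are separated by an endpoint *)
have cut (s t : R) : s <= t -> ~~ same1 m s t -> exists i : int, 2 ^+ m * s < i%:~R <= 2 ^+ m * t.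
  move=> st; rewrite /same1 /didx => h; exists (Num.floor (2 ^+ m * t)).
  rewrite Num.Theory.ge_floor andbT ltNge -Num.Theory.floor_ge_int; apply: contra h => h.
  by rewrite eq_le h andbT; apply: Num.Theory.le_floor; rewrite ler_pM2l.
(* the endpoints of the two grids that lie between x and y *)
have [i /andP[i1 i2]] := cut _ _ xy s0.
have [j /andP[j1 j2]] : exists j : int, 2 ^+ m * (x - 3^-1) < j%:~R <= 2 ^+ m * (y - 3^-1).
  by apply: cut => //; rewrite lerD2r.
have d' : 2 ^+ m * y - 2 ^+ m * x < 3^-1.
  by move: d; rewrite invfM ltr_pdivlMr// mulrC mulrBr.
have [k1 k2] : ((3 * (i - j))%:~R < ((2 ^ m)%N%:Z + 1)%:~R :> R) /\
    (((2 ^ m)%N%:Z - 1)%:~R < (3 * (i - j))%:~R :> R).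
  rewrite !(intrM, intrD, mulrNz) -!pmulrn natrX; move: i1 i2 j1 j2 d'.
  move: (2 ^+ m) => q; rewrite !mulrBr => *; split; lra.
move: k1 k2; rewrite !ltr_int => k1 k2.
have e : 3 * (i - j) = (2 ^ m)%N%:Z by clear -k1 k2; lia.
have : (3 %| 2 ^ m)%N.
  apply/dvdnP; exists `|i - j|%N.
  by have := congr1 absz e; rewrite abszM/= mulnC => ->.
by rewrite Euclid_dvdX.
Qed.

Lemma third_trick_circle m x y : m = 0%N \/ `|sin (pi * (x - y))| < (3 * 2 ^+ m)^-1 ->
  exists b, same1 m (fr1 (x - third b)) (fr1 (y - third b)).
Proof.
case=> [->|h]; first by exists false; apply: same1_0; exact: fr1_itv.
have [k [hk _]] := near_int (x - y).
have [|b sb] := @third_trick m (x + k%:~R) y; first by rewrite addrAC (le_lt_trans hk).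
exists b; move/same1_fr1: sb.
by rewrite addrAC fr1D_int.
Qed.

(** Take the finest level, up to L, that is still coarser than 3 D.  Level 0 is always
    allowed as the whole torus is a square. *)
Lemma dyadic_scale L (D : R) : 0 <= D -> exists m, [/\ (m <= L)%N,
  m = 0%N \/ D < (3 * 2 ^+ m)^-1 & 2 ^- m <= 6 * (2 ^- L + D)].
Proof.
move=> D0.
suff [m [h1 h2 h3]] : exists m, [/\ (m <= L)%N, m = 0%N \/ D < (3 * 2 ^+ m)^-1 &
    2 ^- m <= Num.max (2 ^- L) (6 * D)].
  exists m; split=> //; apply: (le_trans h3).
  have : 0 < 2 ^- L :> R by rewrite invr_gt0 exprn_gt0.
  by rewrite ge_max => ?; apply/andP; split; lra.
elim: L => [|L [m [h1 h2 h3]]].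
  by exists 0%N; split=> //; [left|rewrite le_max lexx].
have [h|h] := ltP D (3 * 2 ^+ L.+1)^-1.
  by exists L.+1; split=> //; [right|rewrite le_max lexx].
exists m; split=> //; first exact: leqW.
apply: (le_trans h3); rewrite ge_max le_max le_max lexx orbT andbT.
apply/orP; right; move: h; rewrite exprS !invfM.
by move: (2 ^- L) => c; lra.
Qed.

End one_third_trick.

Lemma le_sum_bool2 (R : realDomainType) (F : bool -> bool -> R) a b : (forall a b, 0 <= F a b) ->
  F a b <= F false false + F false true + (F true false + F true true).
Proof.
move=> F0; have := F0 false false; have := F0 false true.
have := F0 true false; have := F0 true true.
by case: a; case: b; lra.
Qed.

Section lusin_lipschitz.
Context {R : realType}.
Local Notation intg2 f := (P2.-integrable (setT : set (T2 R)) (EFin \o f)).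

(** Comparable to the distance from z to the lattice Z^2, and Lipschitz. *)
Definition torus_gauge (z : R * R) : R := `|sin (pi * z.1)| + `|sin (pi * z.2)|.

Lemma third01 b : 0 <= (third b : R) < 1.
Proof. by case: b; rewrite /third; apply/andP; split=> //; lra. Qed.

Lemma preserves_shiftN (a b : bool) :
  preserves P2 P2 (torus_shift (- third a) (- third b) : T2 R -> T2 R).
Proof.
(* -1/3 and 2/3 are the same point of the circle *)
pose c (d : bool) : R := if d then 1 - third d else 0.
have hc d : 0 <= c d < 1 by case: d; rewrite /c /third; apply/andP; split=> //; lra.
rewrite (_ : torus_shift _ _ = torus_shift (c a) (c b)); first exact: preserves_shift.
have e d (y : R) : fr1 (y - third d) = fr1 (y + c d).
  by case: d; rewrite /c /third ?oppr0// addrCA addrC (fr1D_int _ 1).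
by apply/funext => x; rewrite /torus_shift /fr/= !e.
Qed.

Definition lip_cst (p : R) : R := 24 * (18 + 16 * doob_cst p).

Variables (p : R) (u : R * R -> R) (G : R * R -> R * R) (m0 : R) (L : nat).
Hypotheses (p1 : 1 < p) (pu : Z2_periodic u).
Hypotheses (mu_ : measurable_fun (setT : set (T2 R)) u).
Hypotheses (mG1 : measurable_fun (setT : set (T2 R)) (fun x => (G x).1)).
Hypotheses (mG2 : measurable_fun (setT : set (T2 R)) (fun x => (G x).2)).
Hypotheses (wg : weak_gradient u G) (m0_gt0 : 0 < m0).
Let g x := `|(G x).1| + `|(G x).2|.
Hypothesis gp : (\int[P2]_x ((g x / m0) `^ p)%:E <= 1)%E.

Let lip (a b : bool) (x : R * R) :=
  let s := torus_shift (third a) (third b) in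
  dyadic_lip (u \o s) (fun x => (G (s x)).1) (fun x => (G (s x)).2) m0 L
    (torus_shift (- third a) (- third b) x).

Lemma torus_shiftK a b x : u (torus_shift (third a) (third b)
  (torus_shift (- third a) (- third b) x)) = u x.
Proof.
rewrite -[RHS](periodic_fr x pu); congr u; rewrite /torus_shift /fr/=.
have e (y : R) c : fr1 (fr1 (y - c) + c) = fr1 y.
  by rewrite {2}/fr1 addrAC subrK -mulrNz fr1D_int.
by rewrite !e.
Qed.

Let lip_props a b : [/\ (forall x, 0 <= lip a b x), intg2 (lip a b),
  (forall m x y, (m <= L)%N -> same m (torus_shift (- third a) (- third b) x)
     (torus_shift (- third a) (- third b) y) ->
     `|u x - u y| <= 2 ^- m * (lip a b x + lip a b y)) &
  \int[P2]_x lip a b x <= (18 + 16 * doob_cst p) * m0].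
Proof.
have [ui g1i g2i] := weak_gradient_integrable mu_ mG1 mG2 wg.
have wd1 := weak_gradient_d1 mu_ mG1 mG2 wg.
have wd2 := weak_gradient_d2 mu_ mG1 mG2 wg.
have ps := preserves_shift (third01 a) (third01 b).
have psN := preserves_shiftN a b.
pose s : R * R -> R * R := torus_shift (third a) (third b).
have us : intg2 (u \o s) := integrable_preserves ps ui.
have g1s : intg2 (fun x => (G (s x)).1) := integrable_preserves ps g1i.
have g2s : intg2 (fun x => (G (s x)).2) := integrable_preserves ps g2i.
have wd1s : weak_d1 (u \o s) (fun x => (G (s x)).1) :=
  weak_d1_shift (third01 a) (third01 b) ui g1i wd1.
have wd2s : weak_d1 ((u \o s) \o swap) ((fun x => (G (s x)).2) \o swap).
  exact: (weak_d1_shift (third01 b) (third01 a)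
    (integrable_preserves preserves_swap ui) (integrable_preserves preserves_swap g2i) wd2).
have gps : (\int[P2]_x (((`|(G (s x)).1| + `|(G (s x)).2|) / m0) `^ p)%:E <= 1)%E.
  rewrite (ge0_integral_preserves ps (f := fun x => ((g x / m0) `^ p)%:E))//; last first.
    by move=> x; rewrite lee_fin powR_ge0.
  apply/measurable_EFinP.
  have mq : measurable_fun (setT : set (T2 R)) (fun x => g x / m0).
    by apply: measurable_funM => //; apply: measurable_funD; exact: measurableT_comp.
  exact: (measurableT_comp (measurable_powR p) mq).
split.
- by move=> x; exact: dyadic_lip_ge0.
- exact: (integrable_preserves psN (integrable_dyadic_lip us g1s g2s m0 L)).
- move=> m x y mL xy; have := dyadic_lip_le us g1s g2s wd1s wd2s m0_gt0 _ _ mL xy.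
  by rewrite /= !torus_shiftK; apply; exact: fr_Q.
- rewrite (Rintegral_preserves psN (integrable_dyadic_lip us g1s g2s m0 L)).
  exact: integral_dyadic_lip.
Qed.

(** The function gam is the sum, over the four grids, of the functions [dyadic_lip] of the
    translated data.  By [third_trick_circle] in each coordinate, some grid has x and y in
    a common square of side comparable to 2^-L + |x - y|. *)
Theorem lusin_lipschitz : exists gam : R * R -> R, [/\ (forall x, 0 <= gam x), intg2 gam,
  (forall x y, `|u x - u y| <= (2 ^- L + torus_gauge (x.1 - y.1, x.2 - y.2)) * (gam x + gam y)) &
  \int[P2]_x gam x <= lip_cst p * m0].
Proof.
have [l lP] : exists l : bool -> bool -> R * R -> R, forall a b, [/\ (forall x, 0 <= l a b x),
  intg2 (l a b),
  (forall m x y, (m <= L)%N -> same m (torus_shift (- third a) (- third b) x)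
     (torus_shift (- third a) (- third b) y) ->
     `|u x - u y| <= 2 ^- m * (l a b x + l a b y)) &
  \int[P2]_x l a b x <= (18 + 16 * doob_cst p) * m0] by exists lip.
pose gam x := 6 * (l false false x + l false true x + (l true false x + l true true x)).
have L0 a b x : 0 <= l a b x by have [] := lP a b.
have Li a b : intg2 (l a b) by have [] := lP a b.
have LI a b : \int[P2]_x l a b x <= (18 + 16 * doob_cst p) * m0 by have [] := lP a b.
have i1 : intg2 (fun x => l false false x + l false true x) by exact: integrable_realD.
have i2 : intg2 (fun x => l true false x + l true true x) by exact: integrable_realD.
exists gam; split.
- by move=> x; rewrite mulr_ge0// !addr_ge0.
- by apply: integrable_realZ; exact: integrable_realD.
- move=> x y; set D := torus_gauge _.
  have D0 : 0 <= D by rewrite addr_ge0.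
  have [m [mL hm m6]] := dyadic_scale L D0.
  have [a ha] : exists a, same1 m (fr1 (x.1 - third a)) (fr1 (y.1 - third a)).
    apply: third_trick_circle; case: hm => [|h]; [by left|right].
    by apply: le_lt_trans h; rewrite lerDl.
  have [b hb] : exists b, same1 m (fr1 (x.2 - third b)) (fr1 (y.2 - third b)).
    apply: third_trick_circle; case: hm => [|h]; [by left|right].
    by apply: le_lt_trans h; rewrite lerDr.
  have [_ _ h _] := lP a b.
  have sm : same m (torus_shift (- third a) (- third b) x)
     (torus_shift (- third a) (- third b) y) by rewrite /same/= ha hb.
  apply: (le_trans (h m x y mL sm)).
  have le1 z : l a b z <= l false false z + l false true z + (l true false z + l true true z).
    exact: (@le_sum_bool2 _ (fun a b => l a b z)).
  have l0 : 0 <= l a b x + l a b y by rewrite addr_ge0.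
  apply: (le_trans (ler_wpM2r l0 m6)).
  rewrite /gam -mulrDr mulrCA -mulrA ler_pM2l// ler_wpM2l ?lerD//.
  by rewrite addr_ge0// invr_ge0 exprn_ge0.
- rewrite /gam RintegralZl//; last exact: integrable_realD.
  rewrite RintegralD// RintegralD// RintegralD//.
  have := LI false false; have := LI false true; have := LI true false; have := LI true true.
  rewrite /lip_cst -mulrA; move: (_ * m0) => c.
  move: (Rintegral _ _ _) (Rintegral _ _ _) (Rintegral _ _ _) (Rintegral _ _ _).
  by move=> A B C D; lra.
Qed.

End lusin_lipschitz.

(** * Separation of trajectories *)

Section logarithmic_decay.
Context {R : realType}.
Local Notation mu := (leb R).
Local Notation intg f := (mu.-integrable (setT : set (T1 R)) (EFin \o f)).
Variables (a b c : R -> R) (d : R).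
Hypotheses (d0 : 0 < d) (da : forall t, 0 <= t <= 1 -> d <= a t).
Hypotheses (b0 : forall r, 0 <= b r) (c0 : forall r, 0 <= c r).
Hypotheses (bi : intg b) (ci : intg c).
Hypothesis ab : forall s t, 0 <= s -> s <= t -> t <= 1 ->
  `|a t - a s| <= \int[mu]_(r in `]s, t]) b r.
Hypothesis bc : forall r, 0 <= r <= 1 -> b r <= a r * c r.

Let sub f (A : set R) : intg f -> measurable (A : set (T1 R)) -> mu.-integrable A (EFin \o f).
Proof. by move=> fi mA; apply: integrableS fi. Qed.

Let split f r s t : intg f -> r <= s -> s <= t ->
  \int[mu]_(x in `]r, t]) f x = \int[mu]_(x in `]r, s]) f x + \int[mu]_(x in `]s, t]) f x.
Proof.
move=> fi rs st.
rewrite (@itv_bndbnd_setU _ _ (BRight r) (BRight s) (BRight t)) ?bnd_simp//.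
apply: Rintegral_setU; [exact: measurable_itv|exact: measurable_itv| |].
- by apply: sub => //; apply: measurableU; exact: measurable_itv.
- apply/disj_setPS => x [/=]; rewrite !in_itv/= => /andP[_ xs] /andP[sx _].
  by move: (lt_le_trans sx xs); rewrite ltxx.
Qed.

Let ge0 f (A : set R) : (forall r, 0 <= f r) -> 0 <= \int[mu]_(x in A) f x.
Proof. by move=> f0; apply: Rintegral_ge0. Qed.

(** On this interval a varies by at most d <= a t, hence a <= 2 a t there, and
    ln (a s) - ln (a t) <= (a s - a t) / a t. *)
Lemma ln_decay_step s t : 0 <= s -> s <= t -> t <= 1 -> \int[mu]_(r in `]s, t]) b r <= d ->
  ln (a s) - ln (a t) <= 2 * \int[mu]_(r in `]s, t]) c r.
Proof.
move=> s0 st t1 bd.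
have pos r : 0 <= r <= 1 -> 0 < a r by move/da; exact: lt_le_trans.
have at0 : 0 < a t by rewrite pos// t1 andbT (le_trans s0).
have as0 : 0 < a s by rewrite pos// s0 (le_trans st).
have dat : d <= a t by rewrite da// t1 andbT (le_trans s0).
rewrite -ln_div ?posrE//.
have -> : a s / a t = 1 + (a s - a t) / a t by field; rewrite gt_eqF.
apply: (le_trans (@le_ln1Dx _ _ _)).
  by rewrite -(@ltr_pM2r _ (a t))// mulfVK ?gt_eqF//; lra.
rewrite ler_pdivrMr//.
apply: (@le_trans _ _ (\int[mu]_(r in `]s, t]) b r)).
  by apply: le_trans (ab s0 st t1); rewrite distrC ler_norm.
have -> : 2 * \int[mu]_(r in `]s, t]) c r * a t = \int[mu]_(r in `]s, t]) (2 * a t * c r).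
  rewrite RintegralZl//; first by ring.
  by apply: sub => //; exact: measurable_itv.
apply: le_Rintegral; first exact: measurable_itv.
- by apply: sub => //; exact: measurable_itv.
- have m : measurable (`]s, t] : set (T1 R)) by exact: measurable_itv.
  have := @integrableZl _ (T1 R) R mu _ m (2 * a t)%R _ (sub ci m).
  by apply: eq_integrable => // x _; rewrite /= EFinM.
move=> r /=; rewrite in_itv/= => /andP[sr rt].
have r01 : 0 <= r <= 1 by rewrite (le_trans rt t1) (le_trans s0 (ltW sr)).
apply: (le_trans (bc r01)); apply: ler_wpM2r => //.
have := ab (le_trans s0 (ltW sr)) rt t1.
have := split bi (ltW sr) rt; have := ge0 `]s, r] b0.
by rewrite ler_norml => + + /andP[+ _]; lra.
Qed.

(** A logarithmic derivative bound for a function that is absolutely continuous in the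
    weak sense of [ab].  The interval is divided so finely that [ln_decay_step] applies to
    each piece; this is possible since the integral of b over short intervals is small. *)
Lemma ln_decay : ln (a 0) - ln (a 1) <= 2 * \int[mu]_(r in `]0, 1]) c r.
Proof.
have [e [e0 he]] := integral_normr_continuous bi d0.
(* pieces of length 1 / n < e *)
pose n := `|Num.ceil (e^-1)|%N.+1.
have n0 : 0 < n%:R :> R by rewrite ltr0n.
have ne : n%:R^-1 < e.
  rewrite -[e]invrK ltf_pV2 ?posrE ?invr_gt0//.
  rewrite /n -natr1 (le_lt_trans (Num.Theory.ceil_ge _))//.
  by rewrite ltr_pwDr// natr_absz ler_int ler_norm.
pose t k : R := k%:R / n%:R.
suff h k : (k <= n)%N -> ln (a 0) - ln (a (t k)) <= 2 * \int[mu]_(r in `]0, (t k)]) c r.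
  by have := h n (leqnn n); rewrite /t divff ?gt_eqF.
elim: k => [|k IH] kn.
  by rewrite /t mul0r subrr mulr_ge0// ge0.
have t0 : 0 <= t k by rewrite divr_ge0.
have tt : t k <= t k.+1 by rewrite ler_pM2r ?invr_gt0// ler_nat.
have t1 : t k.+1 <= 1 by rewrite ler_pdivrMr// mul1r ler_nat.
rewrite (split ci t0 tt) mulrDr.
rewrite (_ : _ - _ = (ln (a 0) - ln (a (t k))) + (ln (a (t k)) - ln (a (t k.+1)))); last by ring.
apply: lerD; first exact/IH/ltnW.
apply: ln_decay_step => //.
have m : measurable (`]t k, t k.+1]%classic : set (T1 R)) by exact: measurable_itv.
apply: (@le_trans _ _ (\int[mu]_(r in `]t k, t k.+1]) `|b r|)).
  by rewrite le_eqVlt; apply/orP; left; apply/eqP/eq_Rintegral => r _; rewrite ger0_norm.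
have small : (mu `]t k, t k.+1] < e%:E)%E.
  rewrite lebesgue_measure_itv/= lte_fin ifT; last by rewrite ltr_pM2r ?invr_gt0// ltr_nat ltnSn.
  by rewrite -EFinB lte_fin /t -mulrBl -natrB// subSnn mul1r.
exact/ltW/(he _ m small).
Qed.

End logarithmic_decay.

Section lebesgue_norm.
Context {R : realType}.
Implicit Types (G : R * R -> (R * R) * (R * R)).

Lemma matrix_norm_ge0 (A : (R * R) * (R * R)) : 0 <= matrix_norm A.
Proof. exact: sqrtr_ge0. Qed.

Lemma le_matrix_norm (A : (R * R) * (R * R)) :
  `|A.1.1| + `|A.1.2| <= 2 * matrix_norm A /\ `|A.2.1| + `|A.2.2| <= 2 * matrix_norm A.
Proof.
have le (x : R) r : 0 <= r -> `|x| <= Num.sqrt (x ^+ 2 + r).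
  by move=> r0; rewrite -sqrtr_sqr ler_wsqrtr// lerDl.
have s x : 0 <= (x : R) ^+ 2 by exact: sqr_ge0.
have h1 : `|A.1.1| <= matrix_norm A.
  by rewrite /matrix_norm -!addrA; apply: le; rewrite !addr_ge0.
have h2 : `|A.1.2| <= matrix_norm A.
  by rewrite /matrix_norm (addrC (A.1.1 ^+ 2)) -!addrA; apply: le; rewrite !addr_ge0.
have h3 : `|A.2.1| <= matrix_norm A.
  by rewrite /matrix_norm (addrC _ (A.2.1 ^+ 2)) -!addrA; apply: le; rewrite !addr_ge0.
have h4 : `|A.2.2| <= matrix_norm A.
  by rewrite /matrix_norm (addrC _ (A.2.2 ^+ 2)); apply: le; rewrite !addr_ge0.
by split; lra.
Qed.

Lemma Lp_norm_le (p N : R) G : 0 < p -> 0 < N ->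
  measurable_fun (setT : set (T2 R)) (fun x => matrix_norm (G x)) ->
  (Lp_norm p G <= N%:E)%E ->
  (\int[P2]_x ((matrix_norm (G x) / N) `^ p)%:E <= 1)%E.
Proof.
move=> p0 N0 mG h.
have mGp : measurable_fun (setT : set (T2 R)) (fun x => matrix_norm (G x) `^ p).
  exact: (measurableT_comp (measurable_powR p) mG).
have Ip : (\int[P2]_x (matrix_norm (G x) `^ p)%:E <= (N `^ p)%:E)%E.
  rewrite integral_P2; last exact/measurable_EFinP.
  have e := @poweR_Lnorm _ _ R (leb2 R) ((fun x => (matrix_norm (G x))%:E) \_ Q) p (lt0r_neq0 p0).
  have -> : (\int[leb2 R]_(x in Q) (matrix_norm (G x) `^ p)%:E =
      \int[leb2 R]_x `|((fun x => (matrix_norm (G x))%:E) \_ Q) x| `^ p)%E.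
    rewrite integral_mkcond; apply: eq_integral => x _; rewrite !patchE; case: ifP => _.
      by rewrite /= ger0_norm ?matrix_norm_ge0.
    by rewrite abse0 poweR0r// gt_eqF.
  rewrite -e -poweR_EFin; apply: gt0_ler_poweR => //; first exact: ltW.
  - by rewrite in_itv/= leey Lnorm_ge0.
  - by rewrite in_itv/= leey lee_fin ltW.
have -> : (\int[P2]_x ((matrix_norm (G x) / N) `^ p)%:E =
    \int[P2]_x (((N `^ p)^-1)%:E * (matrix_norm (G x) `^ p)%:E))%E.
  apply: eq_integral => x _; rewrite -EFinM; congr EFin.
  by rewrite powRM ?matrix_norm_ge0 ?invr_ge0 ?ltW// -(powR_inv1 (ltW N0)) -powRrM mulN1r powRN mulrC.
have Np : (0 < N `^ p)%R by exact: powR_gt0.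
rewrite ge0_integralZl//.
- by rewrite muleC lee_pdivrMr// mul1e.
- exact/measurable_EFinP.
- by move=> x _; rewrite lee_fin powR_ge0.
- by rewrite lee_fin invr_ge0 ltW.
Qed.
End lebesgue_norm.

Section weighted_pairs.
Context {R : realType}.
Local Notation intg2 f := (P2.-integrable (setT : set (T2 R)) (EFin \o f)).
Local Notation TT R := (T2 R * T2 R)%type.
Local Open Scope ereal_scope.

(** Densities on pairs whose marginals have densities at most 1. *)
Definition pair_weight (W : (R * R) * (R * R) -> R) :=
  [/\ measurable_fun (setT : set (TT R)) W, (forall w, 0 <= W w)%R,
      (forall x, \int[P2]_y (W (x, y))%:E <= 1) & (forall y, \int[P2]_x (W (x, y))%:E <= 1)].

Variable W : (R * R) * (R * R) -> R.
Hypothesis hW : pair_weight W.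
Let mW : measurable_fun (setT : set (TT R)) W. Proof. by have [] := hW. Qed.
Let W0 w : (0 <= W w)%R. Proof. by have [] := hW. Qed.

Lemma weight_integral_le (h : R * R -> R) : measurable_fun (setT : set (T2 R)) h ->
  (forall x, 0 <= h x)%R ->
  \int[P2 \x P2]_w (W w * (h w.1 + h w.2))%:E <= 2%:E * \int[P2]_x (h x)%:E.
Proof.
move=> mh h0.
have mh1 : measurable_fun (setT : set (TT R)) (fun w => (h w.1)%R).
  exact: (measurableT_comp mh measurable_fst).
have mh2 : measurable_fun (setT : set (TT R)) (fun w => (h w.2)%R).
  exact: (measurableT_comp mh measurable_snd).
have m1 : measurable_fun (setT : set (TT R)) (fun w => (W w * h w.1)%:E).
  by apply/measurable_EFinP; exact: measurable_funM.
have m2 : measurable_fun (setT : set (TT R)) (fun w => (W w * h w.2)%:E).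
  by apply/measurable_EFinP; exact: measurable_funM.
have n1 (w : TT R) : 0 <= (W w * h w.1)%:E by rewrite lee_fin mulr_ge0.
have n2 (w : TT R) : 0 <= (W w * h w.2)%:E by rewrite lee_fin mulr_ge0.
have -> : \int[P2 \x P2]_w (W w * (h w.1 + h w.2))%:E =
    \int[P2 \x P2]_w (W w * h w.1)%:E + \int[P2 \x P2]_w (W w * h w.2)%:E.
  by rewrite -ge0_integralD//; apply: eq_integral => w _; rewrite -EFinD mulrDr.
have [_ _ W1 W2] := hW.
have mh' : measurable_fun (setT : set (T2 R)) (fun x => (h x)%:E) by exact/measurable_EFinP.
have -> : 2%:E * \int[P2]_x (h x)%:E = \int[P2]_x (h x)%:E + \int[P2]_x (h x)%:E.
  by rewrite -mule2n mule_natl.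
apply: leeD.
- rewrite (@fubini_tonelli1 _ _ (T2 R) (T2 R) R P2 P2 _ m1 n1); apply: ge0_le_integralT.
    by move=> x; apply: integral_ge0 => y _; exact: n1.
  move=> x; rewrite /fubini_F/=; have -> : \int[P2]_y (W (x, y) * h x)%:E = \int[P2]_y (W (x, y))%:E * (h x)%:E.
    rewrite -ge0_integralZr//.
    + by apply/measurable_EFinP; exact: (measurableT_comp mW (measurable_pair1 x)).
    + by move=> y _; rewrite lee_fin.
    + by rewrite lee_fin.
  by rewrite -[leRHS]mul1e; apply: lee_wpmul2r; rewrite ?lee_fin.
- rewrite (@fubini_tonelli2 _ _ (T2 R) (T2 R) R P2 P2 _ m2 n2); apply: ge0_le_integralT.
    by move=> y; apply: integral_ge0 => x _; exact: n2.
  move=> y; rewrite /fubini_G/=; have -> : \int[P2]_x (W (x, y) * h y)%:E = \int[P2]_x (W (x, y))%:E * (h y)%:E.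
    rewrite -ge0_integralZr//.
    + by apply/measurable_EFinP; exact: (measurableT_comp mW (measurable_pair2 y)).
    + by move=> x _; rewrite lee_fin.
    + by rewrite lee_fin.
  by rewrite -[leRHS]mul1e; apply: lee_wpmul2r; rewrite ?lee_fin.
Qed.

Local Close Scope ereal_scope.

Definition stretch (d : R) (u : R * R -> R * R) (w : (R * R) * (R * R)) : R :=
  (`|(u w.1).1 - (u w.2).1| + `|(u w.1).2 - (u w.2).2|) /
  (d + torus_gauge (w.1.1 - w.2.1, w.1.2 - w.2.2)).

Lemma torus_gauge_ge0 (z : R * R) : 0 <= torus_gauge z.
Proof. by rewrite addr_ge0. Qed.

Variables (p : R) (u : R * R -> R * R) (G : R * R -> (R * R) * (R * R)) (L : nat) (N : R).
Hypotheses (p1 : 1 < p) (pu : Z2_periodic u).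
Hypotheses (mu_ : measurable_fun (setT : set (T2 R)) u).
Hypotheses (mG : measurable_fun (setT : set (T2 R)) G).
Hypotheses (wg1 : weak_gradient (fun x => (u x).1) (fun x => (G x).1))
           (wg2 : weak_gradient (fun x => (u x).2) (fun x => (G x).2)).
Hypotheses (N0 : 0 < N) (GN : (Lp_norm p G <= N%:E)%E).
Variable Y : R * R -> R * R.
Hypothesis pY : preserves P2 P2 (Y : T2 R -> T2 R).

Let row_le (H : R * R -> R * R) : measurable_fun (setT : set (T2 R)) H ->
  (forall x, `|(H x).1| + `|(H x).2| <= 2 * matrix_norm (G x)) ->
  (\int[P2]_x (((`|(H x).1| + `|(H x).2|) / (2 * N)) `^ p)%:E <= 1)%E.
Proof.
move=> mH hH.
have mn : measurable_fun (setT : set (T2 R)) (fun x => matrix_norm (G x)).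
  have mc : measurable_fun (setT : set (T2 R)) (fun x => (G x).1) by exact: (measurableT_comp measurable_fst mG).
  have md : measurable_fun (setT : set (T2 R)) (fun x => (G x).2) by exact: (measurableT_comp measurable_snd mG).
  apply: (measurableT_comp (continuous_measurable_fun (@sqrt_continuous R))).
  apply: measurable_funD; first apply: measurable_funD; first apply: measurable_funD;
    apply: measurable_funX.
  - exact: (measurableT_comp measurable_fst mc).
  - exact: (measurableT_comp measurable_snd mc).
  - exact: (measurableT_comp measurable_fst md).
  - exact: (measurableT_comp measurable_snd md).
apply: le_trans (Lp_norm_le (lt_trans ltr01 p1) N0 mn GN).
apply: ge0_le_integralT => x; rewrite lee_fin ?powR_ge0//.
apply: ge0_ler_powR; rewrite ?nnegrE.
- by rewrite ltW// (lt_trans ltr01 p1).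
- by rewrite divr_ge0 ?addr_ge0// mulr_ge0// ltW.
- by rewrite divr_ge0 ?matrix_norm_ge0// ltW.
- rewrite invfM mulrA ler_pM2r ?invr_gt0// ler_pdivrMr// mulrC; exact: hH.
Qed.

(** For each of the two components of the velocity, [lusin_lipschitz] bounds the stretching
    by gam (Y x) + gam (Y y); integrate first in the variable that does not occur. *)
Lemma stretch_le : (\int[(P2 \x P2)%E]_w (W w * stretch (2 ^- L) u (Y w.1, Y w.2))%:E <=
  (8 * lip_cst p * N)%:E)%E.
Proof.
have N2 : 0 < 2 * N by rewrite mulr_gt0.
have mG1 : measurable_fun (setT : set (T2 R)) (fun x => (G x).1) by exact: (measurableT_comp measurable_fst mG).
have mG2 : measurable_fun (setT : set (T2 R)) (fun x => (G x).2) by exact: (measurableT_comp measurable_snd mG).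
have pu1 : Z2_periodic (fun x => (u x).1) by move=> x k l; rewrite pu.
have pu2 : Z2_periodic (fun x => (u x).2) by move=> x k l; rewrite pu.
have [g1 [g10 g1i g1L g1I]] := @lusin_lipschitz R p _ _ (2 * N) L p1 pu1
  (measurableT_comp measurable_fst mu_) (measurableT_comp measurable_fst mG1)
  (measurableT_comp measurable_snd mG1) wg1 N2 (row_le mG1 (fun x => (le_matrix_norm (G x)).1)).
have [g2 [g20 g2i g2L g2I]] := @lusin_lipschitz R p _ _ (2 * N) L p1 pu2
  (measurableT_comp measurable_snd mu_) (measurableT_comp measurable_fst mG2)
  (measurableT_comp measurable_snd mG2) wg2 N2 (row_le mG2 (fun x => (le_matrix_norm (G x)).2)).
pose h x := g1 (Y x) + g2 (Y x).
have hi : intg2 h.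
  by apply: integrable_realD; [exact: (integrable_preserves pY g1i)|exact: (integrable_preserves pY g2i)].
have mh : measurable_fun (setT : set (T2 R)) h by have /measurable_int/measurable_EFinP := hi.
have h0 x : 0 <= h x by rewrite addr_ge0.
apply: (@le_trans _ _ (\int[(P2 \x P2)%E]_w (W w * (h w.1 + h w.2))%:E)%E).
  apply: ge0_le_integralT => w; rewrite lee_fin.
    by rewrite mulr_ge0// divr_ge0 ?addr_ge0// ?torus_gauge_ge0// invr_ge0 exprn_ge0.
  rewrite ler_wpM2l// /stretch/=.
  have := g1L (Y w.1) (Y w.2); have := g2L (Y w.1) (Y w.2).
  set S := 2 ^- L + _ => k2 k1.
  have S0 : 0 < S by rewrite ltr_pwDl ?torus_gauge_ge0// invr_gt0 exprn_gt0.
  rewrite ler_pdivrMr//; apply: (le_trans (lerD k1 k2)).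
  by rewrite /h le_eqVlt; apply/orP; left; apply/eqP; ring.
apply: (le_trans (weight_integral_le mh h0)).
rewrite -(Rintegral_EFin hi) -EFinM lee_fin.
rewrite /h (RintegralD measurableT (integrable_preserves pY g1i) (integrable_preserves pY g2i)).
rewrite (Rintegral_preserves pY g1i) (Rintegral_preserves pY g2i).
by rewrite (_ : 8 * lip_cst p * N = 2 * (lip_cst p * (2 * N) + lip_cst p * (2 * N))); [rewrite ler_pM2l// lerD|ring].
Qed.

End weighted_pairs.

Section stretch_in_time.
Context {R : realType}.
Local Notation TT R := (T2 R * T2 R)%type.

Lemma measurable_time_slice d (A : measurableType d) (f : R -> R * R -> A) s : I01 s ->
  measurable_fun (I01 `*` setT : set (T1 R * T2 R)) (fun z => f z.1 z.2) ->
  measurable_fun (setT : set (T2 R)) (f s).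
Proof.
move=> hs mf.
have mI : measurable (I01 `*` setT : set (T1 R * T2 R)).
  by apply: measurableX => //; exact: measurable_itv.
have mg : measurable_fun (setT : set (T2 R)) (fun x : T2 R => (s, x) : T1 R * T2 R).
  exact: measurable_pair1.
rewrite (_ : f s = (fun z => f z.1 z.2) \o (fun x : T2 R => (s, x) : T1 R * T2 R))//.
by apply: (measurable_comp mI _ mf mg) => _ /= [x _ <-].
Qed.

Variables (v X : R -> R * R -> R * R) (Dv : R -> R * R -> (R * R) * (R * R)).
Hypotheses (vf : velocity_field v Dv) (fX : measure_preserving_flow v X).

(** The velocity, set to 0 outside of the time interval so as to be measurable. *)
Definition vel (w : R -> R * R -> R * R) (z : R * (R * R)) : R * R :=
  if z.1 \in I01 then w z.1 z.2 else (0, 0).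

Lemma measurable_vel : measurable_fun (setT : set (T1 R * T2 R)) (vel v : T1 R * T2 R -> T2 R).
Proof.
have [_ [mv _] _ _ _] := vf.
have mI : measurable (I01 : set (T1 R)) by exact: measurable_itv.
have mb : measurable_fun (setT : set (T1 R * T2 R)) (fun z => z.1 \in I01).
  apply: (measurable_fun_bool true); rewrite setTI.
  rewrite (_ : _ @^-1` _ = I01 `*` setT); first by apply: measurableX.
  by apply/seteqP; split=> z /=; [move=> /set_mem|move=> [/mem_set]].
apply: measurable_fun_if => //.
apply: measurable_funS mv; first by apply: measurableX.
by move=> z /= [_ /set_mem].
Qed.

Definition stretch_along (d : R) (s : R) (w : (R * R) * (R * R)) : R :=
  stretch d (fun x => vel v (s, x)) (torus_flow X (s, w.1), torus_flow X (s, w.2)).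

Lemma stretch_along_ge0 d s w : 0 <= d -> 0 <= stretch_along d s w.
Proof.
by move=> d0; rewrite divr_ge0 ?addr_ge0// torus_gauge_ge0.
Qed.

Lemma measurable_torus_gauge : measurable_fun (setT : set (T2 R)) (@torus_gauge R : T2 R -> R).
Proof.
have ms : measurable_fun (setT : set (T1 R)) (fun t : R => `|sin (pi * t)|).
  apply: measurableT_comp => //; apply: (measurableT_comp (continuous_measurable_fun (@continuous_sin R))).
  exact: measurable_funM.
by apply: measurable_funD; [exact: (measurableT_comp ms measurable_fst)|exact: (measurableT_comp ms measurable_snd)].
Qed.

Lemma measurable_stretch_along d : 0 <= d ->
  measurable_fun (setT : set (T1 R * TT R)) (fun z => stretch_along d z.1 z.2).
Proof.
move=> d0; have mY := measurable_torus_flow fX.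
have mp1 : measurable_fun (setT : set (T1 R * TT R)) (fun z => (z.1, z.2.1) : T1 R * T2 R).
  apply/measurable_fun_pairP; split => /=; first exact: measurable_fst.
  exact: (measurableT_comp measurable_fst measurable_snd).
have mp2 : measurable_fun (setT : set (T1 R * TT R)) (fun z => (z.1, z.2.2) : T1 R * T2 R).
  apply/measurable_fun_pairP; split => /=; first exact: measurable_fst.
  exact: (measurableT_comp measurable_snd measurable_snd).
have mY1 := measurableT_comp mY mp1; have mY2 := measurableT_comp mY mp2.
have mv (Y : T1 R * TT R -> T2 R) : measurable_fun setT Y ->
    measurable_fun setT (fun z => vel v (z.1, Y z)).
  move=> mYY; apply: (measurableT_comp measurable_vel).
  by apply/measurable_fun_pairP; split => /=; [exact: measurable_fst|].
have mv1 := mv _ mY1; have mv2 := mv _ mY2.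
have f1 (Y : T1 R * TT R -> T2 R) (mYY : measurable_fun setT Y) := measurableT_comp measurable_fst mYY.
have f2 (Y : T1 R * TT R -> T2 R) (mYY : measurable_fun setT Y) := measurableT_comp measurable_snd mYY.
apply: measurable_funM.
  apply: measurable_funD; apply: measurableT_comp => //; apply: measurable_funB.
  - exact: f1 _ mv1.
  - exact: f1 _ mv2.
  - exact: f2 _ mv1.
  - exact: f2 _ mv2.
rewrite (_ : (fun z => _) = fun z => (d + torus_gauge ((torus_flow X (z.1, z.2.1)).1 - (torus_flow X (z.1, z.2.2)).1,
    (torus_flow X (z.1, z.2.1)).2 - (torus_flow X (z.1, z.2.2)).2)) `^ (-1)); last first.
  by apply/funext => z; rewrite powR_inv1// addr_ge0// torus_gauge_ge0.
apply: (measurableT_comp (measurable_powR (-1))).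
apply: measurable_funD; first exact: measurable_cst.
apply: (measurableT_comp measurable_torus_gauge).
apply/measurable_fun_pairP; split => /=; apply: measurable_funB.
- exact: f1 _ mY1.
- exact: f1 _ mY2.
- exact: f2 _ mY1.
- exact: f2 _ mY2.
Qed.

Lemma doob_cst_ge0 (p : R) : 1 < p -> 0 <= doob_cst p.
Proof. by move=> p1; rewrite divr_ge0 ?powR_ge0// subr_ge0 ltW. Qed.

Lemma lip_cst_gt0 (p : R) : 1 < p -> 0 < lip_cst p.
Proof. by move=> /doob_cst_ge0 h; rewrite mulr_gt0// ltr_pwDl// mulr_ge0. Qed.

Variables (p : R) (L : nat) (W : (R * R) * (R * R) -> R).
Hypotheses (p1 : 1 < p) (hW : pair_weight W).
Local Open Scope ereal_scope.

Let F s := \int[P2 \x P2]_w (W w * stretch_along (2 ^- L) s w)%:E.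

Let F0 s : 0 <= F s.
Proof.
apply: integral_ge0 => w _; have [_ W0 _ _] := hW.
by rewrite lee_fin mulr_ge0// stretch_along_ge0// invr_ge0 exprn_ge0.
Qed.

Lemma measurable_weighted_stretch :
  measurable_fun (setT : set (T1 R * TT R)) (fun z => (W z.2 * stretch_along (2 ^- L) z.1 z.2)%:E).
Proof.
have [mW _ _ _] := hW; apply/measurable_EFinP; apply: measurable_funM.
  exact: (measurableT_comp mW measurable_snd).
by apply: measurable_stretch_along; rewrite invr_ge0 exprn_ge0.
Qed.

Let mF : measurable_fun (setT : set (T1 R)) F.
Proof.
have h0 (z : T1 R * TT R) : 0 <= (W z.2 * stretch_along (2 ^- L) z.1 z.2)%:E.
  have [_ W0 _ _] := hW.
  by rewrite lee_fin mulr_ge0// stretch_along_ge0// invr_ge0 exprn_ge0.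
exact: (@measurable_fun_fubini_tonelli_F _ _ (T1 R) (TT R) R P22 _ measurable_weighted_stretch h0).
Qed.

(** The bound [stretch_le] holds with N any number larger than the norm of the gradient. *)
Lemma stretch_time_le :
  ((8 * lip_cst p)^-1)%:E * \int[P1]_s \int[P2 \x P2]_w (W w * stretch_along (2 ^- L) s w)%:E <=
  \int[leb R]_(t in I01) Lp_norm p (Dv t).
Proof.
have c0 : (0 < 8 * lip_cst p)%R by rewrite mulr_gt0// lip_cst_gt0.
have ci0 : (0 <= (8 * lip_cst p)^-1)%R by rewrite invr_ge0 ltW.
rewrite -/F -ge0_integralZl//; [|by move=> s _; exact: F0].
have mcF : measurable_fun (setT : set (T1 R)) (fun s => ((8 * lip_cst p)^-1)%:E * F s).
  exact: measurable_funeM.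
rewrite (integral_P1c mcF); apply: ae_ge0_le_integral_dom.
- exact: measurable_itv.
- exact: measurable_funS mcF.
- by move=> s; rewrite mule_ge0// lee_fin.
- by move=> s; exact: Lnorm_ge0.
have [per [mv mD] _ wg _] := vf.
apply: (ae_imp wg) => s hwg Is; have [wg1 wg2] := hwg Is.
have [Lp|Lp] := eqVneq (Lp_norm p (Dv s)) +oo; first by rewrite Lp leey.
have Lf : Lp_norm p (Dv s) \is a fin_num by rewrite ge0_fin_numE ?Lnorm_ge0// ltey.
(* a norm that vanishes is not allowed in [stretch_le] *)
apply/lee_addgt0Pr => e e0.
set N := (fine (Lp_norm p (Dv s)) + e)%R.
have N0 : (0 < N)%R by rewrite ltr_wpDl// fine_ge0// Lnorm_ge0.
have -> : Lp_norm p (Dv s) + e%:E = N%:E by rewrite EFinD fineK.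
have LN : Lp_norm p (Dv s) <= N%:E.
  by rewrite -[leLHS](fineK Lf) lee_fin lerDl ltW.
have := stretch_le hW L p1 (per s).1 (measurable_time_slice Is mv)
  (measurable_time_slice Is mD) wg1 wg2 N0 LN (preserves_flow fX Is).
have -> : \int[P2 \x P2]_w (W w * stretch (2 ^- L) (v s) (torus_flow X (s, w.1), torus_flow X (s, w.2)))%:E = F s.
  apply: eq_integral => w _; rewrite /stretch_along (_ : (fun x => vel v (s, x)) = v s)//.
  by apply/funext => x; rewrite /vel/= mem_set.
move=> h; rewrite muleC lee_pdivrMr//.
by rewrite muleC; rewrite -EFinM.
Qed.

End stretch_in_time.

Section trajectories.
Context {R : realType}.
Local Notation TT R := (T2 R * T2 R)%type.
Local Notation mu := (leb R).
Local Notation intg f := (mu.-integrable (setT : set (T1 R)) (EFin \o f)).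
Variables (v X : R -> R * R -> R * R) (Dv : R -> R * R -> (R * R) * (R * R)).
Hypotheses (vf : velocity_field v Dv) (fX : measure_preserving_flow v X).

Definition along (x : R * R) (r : R) : R * R := vel v (r, torus_flow X (r, x)).

Definition trajectory (x : R * R) := [/\ Q x, intg (fun r => (along x r).1),
  intg (fun r => (along x r).2) & forall t, 0 <= t <= 1 ->
    X t x = (x.1 + \int[mu]_(r in `[0, t]) (along x r).1, x.2 + \int[mu]_(r in `[0, t]) (along x r).2)].

Lemma alongE x r : Q x -> I01 r -> along x r = v r (X r x).
Proof.
move=> Qx Ir; have [per _ _ _ _] := vf.
rewrite /along /vel /torus_flow/= !mem_set//; exact: (periodic_fr _ (per r).1).
Qed.

Lemma ae_trajectory : {ae P2, forall x, trajectory x}.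
Proof.
have [_ aeX _] := fX.
apply: (ae_imp (ae_and ae_Q (ae_P2 aeX))) => x [Qx [i1 i2 hX]].
have mI : measurable (I01 : set (T1 R)) by exact: measurable_itv.
have res (f : R -> R) (g : R -> R) : (forall r, I01 r -> g r = f r) -> (forall r, ~ I01 r -> g r = 0) ->
    mu.-integrable (I01 : set (T1 R)) (fun r => (f r)%:E) -> intg g.
  move=> e e0 fi; rewrite (_ : EFin \o g = (fun r => (f r)%:E) \_ I01).
    by apply/(integrable_mkcond _ mI).
  apply/funext => r /=; rewrite patchE; case: ifPn => [/set_mem|/negP] Ir.
    by rewrite e.
  by rewrite e0// => h; apply: Ir; exact: mem_set.
have out r : ~ I01 r -> along x r = (0, 0).
  by move=> Ir; rewrite /along /vel/= ifN//; apply/negP => /set_mem.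
split=> //.
- by apply: res i1 => r Ir; [rewrite alongE|rewrite out].
- by apply: res i2 => r Ir; [rewrite alongE|rewrite out].
move=> t t01; rewrite hX//; congr (_ + _, _ + _); apply: eq_Rintegral => r; rewrite inE/= in_itv/= => /andP[r0 rt];
  rewrite alongE// /I01/= in_itv/= r0 (le_trans rt)//; by case/andP: t01.
Qed.

Variables x y : R * R.
Hypotheses (hx : trajectory x) (hy : trajectory y).

Definition relvel r := `|(along x r).1 - (along y r).1| + `|(along x r).2 - (along y r).2|.

Lemma relvel_ge0 r : 0 <= relvel r. Proof. by rewrite addr_ge0. Qed.

Let intgB f g : intg f -> intg g -> intg (fun r => f r - g r).
Proof. by move=> fi gi; have := integrableB measurableT fi gi. Qed.

Let d1i : intg (fun r => (along x r).1 - (along y r).1).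
Proof. by have [_ xi _ _] := hx; have [_ yi _ _] := hy; exact: intgB. Qed.
Let d2i : intg (fun r => (along x r).2 - (along y r).2).
Proof. by have [_ _ xi _] := hx; have [_ _ yi _] := hy; exact: intgB. Qed.
Let n1i : intg (fun r => `|(along x r).1 - (along y r).1|) := integrable_norm d1i.
Let n2i : intg (fun r => `|(along x r).2 - (along y r).2|) := integrable_norm d2i.

Lemma integrable_relvel : intg relvel.
Proof. exact: (integrableD measurableT n1i n2i). Qed.

Definition separation t : R * R := ((X t x).1 - (X t y).1, (X t x).2 - (X t y).2).

Lemma separation_le s t : 0 <= s -> s <= t -> t <= 1 ->
  `|(separation t).1 - (separation s).1| + `|(separation t).2 - (separation s).2| <=
  \int[mu]_(r in `]s, t]) relvel r.
Proof.
move=> s0 st t1.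
have mi : measurable (`]s, t]%classic : set (T1 R)) by exact: measurable_itv.
have sub f (A : set R) : intg f -> measurable (A : set (T1 R)) -> mu.-integrable A (EFin \o f).
  by move=> fi mA; apply: integrableS fi.
have t01 : 0 <= t <= 1 by rewrite t1 (le_trans s0).
have s01 : 0 <= s <= 1 by rewrite s0 (le_trans st).
have diff f g : intg f -> intg g ->
    (\int[mu]_(r in `[0, t]) f r - \int[mu]_(r in `[0, t]) g r) -
    (\int[mu]_(r in `[0, s]) f r - \int[mu]_(r in `[0, s]) g r) =
    \int[mu]_(r in `]s, t]) (f r - g r).
  move=> fi gi; rewrite RintegralB//; [|exact: sub|exact: sub].
  have m u : measurable (`[0, u]%classic : set (T1 R)) by exact: measurable_itv.
  have ef := @Rintegral_itvB R f (BLeft 0) (BRight t) s (sub _ _ fi (m t)).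
  have eg := @Rintegral_itvB R g (BLeft 0) (BRight t) s (sub _ _ gi (m t)).
  by rewrite -ef ?bnd_simp// -eg ?bnd_simp//; ring.
have [_ x1 x2 xX] := hx; have [_ y1 y2 yX] := hy.
rewrite /separation !xX// !yX//=.
have -> (p q a b c d : R) : p + a - (q + b) - (p + c - (q + d)) = (a - b) - (c - d) by ring.
have -> (p q a b c d : R) : p + a - (q + b) - (p + c - (q + d)) = (a - b) - (c - d) by ring.
rewrite (diff _ _ x1 y1) (diff _ _ x2 y2).
rewrite /relvel (RintegralD mi (sub _ _ n1i mi) (sub _ _ n2i mi)).
by apply: lerD; apply: le_normr_Rintegral => //; exact: sub.
Qed.

Lemma torus_gauge_lipschitz (z w : R * R) :
  `|torus_gauge z - torus_gauge w| <= pi * (`|z.1 - w.1| + `|z.2 - w.2|).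
Proof.
have p0 : 0 <= pi :> R by exact: pi_ge0.
have l (s t : R) : `| `|sin (pi * s)| - `|sin (pi * t)| | <= pi * `|s - t|.
  by apply: (le_trans (abs_sin_lipschitz _ _)); rewrite -mulrBr normrM ger0_norm.
rewrite /torus_gauge opprD addrACA mulrDr; apply: (le_trans (ler_normD _ _)).
by apply: lerD.
Qed.

Lemma torus_gauge_flow t : I01 t ->
  torus_gauge ((torus_flow X (t, x)).1 - (torus_flow X (t, y)).1,
    (torus_flow X (t, x)).2 - (torus_flow X (t, y)).2) = torus_gauge (separation t).
Proof.
move=> It; have [Qx _ _ _] := hx; have [Qy _ _ _] := hy.
rewrite /torus_flow !mem_set// /torus_gauge/separation/=.
have e (a b : R) : `|sin (pi * (fr1 a - fr1 b))| = `|sin (pi * (a - b))|.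
  rewrite -[RHS](sin_pi_int _ (Num.floor b - Num.floor a)) rmorphB/= /fr1.
  by congr `|sin (pi * _)|; ring.
by rewrite /fr/= !e.
Qed.

Lemma relvelE d r : 0 < d -> relvel r = stretch_along v X d r (x, y) *
  (d + torus_gauge ((torus_flow X (r, x)).1 - (torus_flow X (r, y)).1,
    (torus_flow X (r, x)).2 - (torus_flow X (r, y)).2)).
Proof.
by move=> d0; rewrite /stretch_along /stretch/= divfK// gt_eqF// ltr_pwDl ?torus_gauge_ge0.
Qed.

Lemma measurable_stretch_path d : 0 <= d ->
  measurable_fun (setT : set (T1 R)) (fun r => stretch_along v X d r (x, y)).
Proof.
move=> d0; have mg : measurable_fun (setT : set (T1 R)) (fun r => (r, (x, y)) : T1 R * TT R).
  exact: measurable_pair2.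
exact: (measurableT_comp (measurable_stretch_along vf fX d0) mg).
Qed.

Lemma integrable_stretch_path d : 0 < d -> intg (fun r => stretch_along v X d r (x, y)).
Proof.
move=> d0; have bi := integrableZl measurableT d^-1 integrable_relvel.
apply: (le_integrable measurableT _ _ bi); first by apply/measurable_EFinP; exact: (measurable_stretch_path (ltW d0)).
move=> r _ /=; have s0 := stretch_along_ge0 v X r (x, y) (ltW d0).
rewrite lee_fin (ger0_norm s0) ger0_norm; last by rewrite mulr_ge0 ?relvel_ge0// invr_ge0 ltW.
by rewrite ler_pdivlMl// (relvelE _ d0) mulrC ler_wpM2l// lerDl torus_gauge_ge0.
Qed.

Lemma integral_stretch_path d : 0 < d ->
  (\int[mu]_(r in `]0%R, 1%R]) stretch_along v X d r (x, y))%:E =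
  (\int[P1]_r (stretch_along v X d r (x, y))%:E)%E.
Proof.
move=> d0; have ci := integrable_stretch_path d0.
have m : measurable (`]0%R, 1%R]%classic : set (T1 R)) by exact: measurable_itv.
have ci' : mu.-integrable (`]0%R, 1%R]%classic : set (T1 R))
  (EFin \o (fun r => stretch_along v X d r (x, y))) by apply: integrableS ci.
rewrite integral_P1c; last by apply/measurable_EFinP; exact: (measurable_stretch_path (ltW d0)).
rewrite /Rintegral fineK; last exact: (integrable_fin_num m ci').
exact: (integral_itv_obnd_cbnd (measurable_int _ ci')).
Qed.

Lemma separation0 : separation 0 = (x.1 - y.1, x.2 - y.2).
Proof.
have [_ _ _ xX] := hx; have [_ _ _ yX] := hy.
by rewrite /separation xX ?lexx ?ler01// yX ?lexx ?ler01//= set_itv1 !Rintegral_set1 !addr0.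
Qed.

(** The gauge of the separation has derivative at most pi times the relative velocity. *)
Lemma log_separation_le d : 0 < d ->
  ((ln (d + torus_gauge (x.1 - y.1, x.2 - y.2)) - ln (d + torus_gauge (separation 1)))%:E <=
  (2 * pi)%:E * \int[P1]_r (stretch_along v X d r (x, y))%:E)%E.
Proof.
move=> d0; rewrite -integral_stretch_path// -EFinM lee_fin -separation0.
have p0 : 0 <= pi :> R by exact: pi_ge0.
have ci := integrable_stretch_path d0.
have pci : intg (fun r => pi * stretch_along v X d r (x, y)) := integrableZl measurableT pi ci.
have pbi : intg (fun r => pi * relvel r) := integrableZl measurableT pi integrable_relvel.
rewrite -mulrA -RintegralZl//; last first.
  by apply: integrableS ci => //; exact: measurable_itv.
apply: (@ln_decay R (fun t => d + torus_gauge (separation t)) (fun r => pi * relvel r) _ d) => //.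
- by move=> t _; rewrite lerDl torus_gauge_ge0.
- by move=> r; rewrite mulr_ge0// relvel_ge0.
- by move=> r; rewrite mulr_ge0// stretch_along_ge0// ltW.
- move=> s t s0 st t1; rewrite opprD addrACA subrr add0r.
  apply: (le_trans (torus_gauge_lipschitz _ _)).
  rewrite RintegralZl//; last first.
    by apply: integrableS integrable_relvel => //; exact: measurable_itv.
  by rewrite ler_wpM2l// separation_le.
- move=> r r01; have Ir : I01 r by rewrite /I01/= in_itv.
  by rewrite (relvelE _ d0) (torus_gauge_flow Ir) mulrA [leRHS]mulrC.
Qed.

(** At scale d = 1, d + [torus_gauge] is at most 3, so the stretching is comparable to the
    relative velocity. *)
Lemma cos_separation_le :
  ((`|cos (2 * pi * (x.2 - y.2)) - cos (2 * pi * (separation 1).2)|)%:E <=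
  (6 * pi)%:E * \int[P1]_r (stretch_along v X 1 r (x, y))%:E)%E.
Proof.
rewrite -integral_stretch_path// -EFinM lee_fin.
have p0 : 0 <= 2 * pi :> R by rewrite mulr_ge0// pi_ge0.
have e : x.2 - y.2 = (separation 0).2 by rewrite separation0.
have ci := integrable_stretch_path (@ltr01 R).
rewrite e; set z0 := (separation 0).2; set z1 := (separation 1).2.
have lc : `|cos (2 * pi * z0) - cos (2 * pi * z1)| <= 2 * pi * `|z1 - z0|.
  have := sin_lipschitz (2 * pi * z0 + pi / 2) (2 * pi * z1 + pi / 2).
  rewrite !sinDpihalf opprD addrACA subrr addr0 -mulrBr normrM (ger0_norm p0).
  by rewrite [X in _ <= _ * X]distrC.
apply: (le_trans lc); rewrite (_ : 6 * pi = 2 * pi * 3); last by ring.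
rewrite -[leRHS]mulrA ler_wpM2l//.
have := separation_le (lexx 0) ler01 (lexx 1); rewrite -/z0 -/z1 => h.
apply: (@le_trans _ _ (\int[mu]_(r in `]0, 1]) relvel r)).
  by apply: le_trans h; rewrite lerDr.
have m : measurable (`]0%R, 1%R]%classic : set (T1 R)) by exact: measurable_itv.
rewrite -RintegralZl//; last by apply: integrableS ci.
apply: le_Rintegral => //.
- by apply: integrableS integrable_relvel.
- by apply: integrableS (integrableZl measurableT 3 ci).
move=> r _; rewrite (relvelE _ ltr01) mulrC ler_wpM2r ?stretch_along_ge0//.
have s1 (s : R) : `|sin s| <= 1 by exact: sin_max.
by rewrite /torus_gauge/=; have := s1 (pi * ((torus_flow X (r, x)).1 - (torus_flow X (r, y)).1));
  have := s1 (pi * ((torus_flow X (r, x)).2 - (torus_flow X (r, y)).2)); lra.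
Qed.

End trajectories.

Section weighted_pathwise_bound.
Context {R : realType}.
Local Notation TT R := (T2 R * T2 R)%type.
Variables (v X : R -> R * R -> R * R) (Dv : R -> R * R -> (R * R) * (R * R)).
Hypotheses (vf : velocity_field v Dv) (fX : measure_preserving_flow v X).
Variables (p : R) (p1 : 1 < p).
Variables (W D : (R * R) * (R * R) -> R) (L : nat) (c : R).
Hypotheses (hW : pair_weight W) (bW : bounded_measurable (W : TT R -> R)).
Hypotheses (bD : bounded_measurable (D : TT R -> R)) (c0 : 0 < c).
Hypothesis hD : forall x y, trajectory v X x -> trajectory v X y ->
  ((D (x, y))%:E <= c%:E * \int[P1]_r (stretch_along v X (2 ^- L) r (x, y))%:E)%E.

Let lc0 : 0 < 8 * lip_cst p. Proof. by rewrite mulr_gt0// lip_cst_gt0. Qed.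
Let d0 : 0 <= 2 ^- L :> R. Proof. by rewrite invr_ge0 exprn_ge0. Qed.

(** The pathwise bound on D is integrated against W, and the order of the integrals in
    time and in (x, y) is exchanged. *)
Lemma weighted_pathwise_bound :
  (((c * (8 * lip_cst p))^-1 * \int[P22]_w (W w * D w))%:E <=
   \int[leb R]_(t in I01) Lp_norm p (Dv t))%E.
Proof.
have [mW W0 _ _] := hW; have [mD [M DM]] := bD.
apply: le_trans (stretch_time_le vf fX L p1 hW).
set I := Rintegral _ _ _.
rewrite (_ : _^-1 * I = (8 * lip_cst p)^-1 * (c^-1 * I)); last by rewrite invfM; ring.
rewrite EFinM; apply: lee_wpmul2l; first by rewrite lee_fin invr_ge0 ltW.
rewrite EFinM lee_pdivrMl// {}/I.
have h0 (z : T1 R * TT R) : (0 <= (W z.2 * stretch_along v X (2 ^- L) z.1 z.2)%:E)%E.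
  by rewrite lee_fin mulr_ge0// stretch_along_ge0.
have mh := measurable_weighted_stretch vf fX L hW.
rewrite (_ : (\int[P1]_s \int[P2 \x P2]_w (W w * stretch_along v X (2 ^- L) s w)%:E)%E =
  (\int[P22]_w \int[P1]_s (W w * stretch_along v X (2 ^- L) s w)%:E)%E); last first.
  exact: (@fubini_tonelli _ _ (T1 R) (TT R) R P1 P22 _ mh h0).
(* D may be negative, whereas the integrals in time are exchanged for nonnegative functions *)
pose D' w := Num.max (D w) 0.
have bD' : bounded_measurable (D' : TT R -> R).
  split; first by apply: measurable_maxr => //; exact: measurable_cst.
  by exists M => w; rewrite /D'; case: (leP (D w) 0) => _; rewrite ?normr0 ?DM// (le_trans (normr_ge0 _) (DM w)).
have iD := bounded_measurable_integrable P22 (bounded_measurableM bW bD).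
have iD' := bounded_measurable_integrable P22 (bounded_measurableM bW bD').
apply: (@le_trans _ _ ((\int[P22]_w (W w * D' w))%:E)).
  rewrite lee_fin; apply: le_Rintegral => // w _.
  by rewrite ler_wpM2l// le_max lexx.
rewrite /Rintegral fineK; last exact: (integrable_fin_num measurableT iD').
have mG := @measurable_fun_fubini_tonelli_G _ _ (T1 R) (TT R) R P1 _ mh h0.
have G0 w : (0 <= \int[P1]_s (W w * stretch_along v X (2 ^- L) s w)%:E)%E.
  by apply: integral_ge0 => s _; exact: (h0 (s, w)).
rewrite -ge0_integralZl//; last by rewrite lee_fin ltW.
apply: ae_ge0_le_integral_dom => //.
- exact: measurable_int iD'.
- by move=> w; rewrite lee_fin mulr_ge0// le_max lexx orbT.
- by move=> w; rewrite mule_ge0// lee_fin ltW.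
have t1 := ae_preserves (preserves_fst_prod P2 P2) (ae_trajectory vf fX).
have t2 := ae_preserves (preserves_snd_prod P2 P2) (ae_trajectory vf fX).
apply: (ae_imp (ae_and t1 t2)) => -[x y] /= [hx hy] _.
have -> : (\int[P1]_s (W (x, y) * stretch_along v X (2 ^- L) s (x, y))%:E =
    (W (x, y))%:E * \int[P1]_s (stretch_along v X (2 ^- L) s (x, y))%:E)%E.
  rewrite -ge0_integralZl//.
  + by apply/measurable_EFinP; exact: (measurable_stretch_path vf fX).
  + by move=> s _; rewrite lee_fin stretch_along_ge0.
  + by rewrite lee_fin.
rewrite EFinM muleCA; apply: lee_wpmul2l; first by rewrite lee_fin.
rewrite /D'; have [_|_] := leP (D (x, y)) 0; last exact: hD.
apply: mule_ge0; first by rewrite lee_fin ltW.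
by apply: integral_ge0 => s _; rewrite lee_fin stretch_along_ge0.
Qed.

End weighted_pathwise_bound.

(** * Fejer kernels and negative Sobolev norms *)

Section fejer_kernel.
Context {R : realType}.
Implicit Types (t : R) (n : nat).

(** The square of the modulus of a sum of e^(i th), expanded. *)
Lemma sum_cos_sq (I : finType) (th : I -> R) :
  (\sum_i cos (th i)) ^+ 2 + (\sum_i sin (th i)) ^+ 2 = \sum_i \sum_j cos (th i - th j).
Proof.
rewrite !expr2 !big_distrlr/= -big_split/=; apply: eq_bigr => i _.
by rewrite -big_split/=; apply: eq_bigr => j _; rewrite cosB.
Qed.

(** The square of the modulus of the sum of e^(2 pi i j t) for j < n, divided by n. *)
Definition fejer n t : R := n%:R^-1 *
  ((\sum_(j < n) cos (2 * pi * j%:R * t)) ^+ 2 + (\sum_(j < n) sin (2 * pi * j%:R * t)) ^+ 2).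

Lemma fejer_ge0 n t : 0 <= fejer n t.
Proof. by rewrite mulr_ge0 ?invr_ge0// addr_ge0// sqr_ge0. Qed.

Lemma fejerE n t : fejer n t =
  n%:R^-1 * \sum_(i < n) \sum_(j < n) cos (2 * pi * (i%:Z - j%:Z)%:~R * t + 0).
Proof.
rewrite /fejer sum_cos_sq; congr (_ * _); apply: eq_bigr => i _; apply: eq_bigr => j _.
by congr cos; rewrite rmorphB/=; ring.
Qed.

Lemma fejerDint n t (k : int) : fejer n (t + k%:~R) = fejer n t.
Proof.
rewrite !fejerE; congr (_ * _); apply: eq_bigr => i _; apply: eq_bigr => j _.
by rewrite !addr0 -[RHS](cos_period ((i%:Z - j%:Z) * k)) intrM; congr cos; ring.
Qed.

Lemma fejerN n t : fejer n (- t) = fejer n t.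
Proof.
rewrite /fejer; congr (_ * (_ ^+ 2 + _)).
  by apply: eq_bigr => j _; rewrite mulrN cosN.
rewrite -[RHS]sqrrN -sumrN; congr (_ ^+ 2).
by apply: eq_bigr => j _; rewrite mulrN sinN.
Qed.

(** |sin (pi t)| |sum of e^(2 pi i j t)| = |sin (pi n t)| <= 1, by telescoping.  Hence the
    kernel concentrates at scale n^(-1/2) in the mean square sense. *)
Lemma fejer_sin n t : fejer n t * sin (pi * t) ^+ 2 <= n%:R^-1.
Proof.
pose al : R := pi * (2 * n%:R - 1) * t.
have hc : sin (pi * t) * \sum_(j < n) cos (2 * pi * j%:R * t) = 2^-1 * (sin al + sin (pi * t)).
  rewrite /al; elim: n {al} => [|n IH].
    by rewrite big_ord0 mulr0 mulr0 sub0r mulrN1 mulNr sinN addNr mulr0.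
  rewrite big_ord_recr/= mulrDr IH -[n.+1%:R]natr1.
  rewrite (_ : pi * (2 * (n%:R + 1) - 1) * t = 2 * pi * n%:R * t + pi * t); last by ring.
  rewrite (_ : pi * (2 * n%:R - 1) * t = 2 * pi * n%:R * t - pi * t); last by ring.
  by rewrite sinB sinD; lra.
have hs : sin (pi * t) * \sum_(j < n) sin (2 * pi * j%:R * t) = 2^-1 * (cos (pi * t) - cos al).
  rewrite /al; elim: n {al hc} => [|n IH].
    by rewrite big_ord0 mulr0 mulr0 sub0r mulrN1 mulNr cosN subrr mulr0.
  rewrite big_ord_recr/= mulrDr IH -[n.+1%:R]natr1.
  rewrite (_ : pi * (2 * (n%:R + 1) - 1) * t = 2 * pi * n%:R * t + pi * t); last by ring.
  rewrite (_ : pi * (2 * n%:R - 1) * t = 2 * pi * n%:R * t - pi * t); last by ring.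
  by rewrite cosB cosD; lra.
rewrite /fejer -mulrA -[leRHS]mulr1 ler_wpM2l ?invr_ge0//.
rewrite mulrDl -!exprMn ![_ * sin (pi * t)]mulrC hc hs.
have -> : (2^-1 * (sin al + sin (pi * t))) ^+ 2 + (2^-1 * (cos (pi * t) - cos al)) ^+ 2 =
  4^-1 * ((cos al ^+ 2 + sin al ^+ 2) + (cos (pi * t) ^+ 2 + sin (pi * t) ^+ 2) -
    2 * (cos al * cos (pi * t) - sin al * sin (pi * t))) by field.
rewrite !cos2Dsin2 -cosD.
by have := cos_geN1 (al + pi * t); lra.
Qed.

Lemma fejer_bounded n : bounded_measurable (fejer n : T1 R -> R).
Proof.
rewrite (_ : fejer n = fun t => n%:R^-1 * \sum_(i < n) \sum_(j < n) cos (2 * pi * (i%:Z - j%:Z)%:~R * t + 0)).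
  apply: bounded_measurableM; first exact: bounded_measurable_cst.
  by apply: bounded_measurable_sum => i; apply: bounded_measurable_sum => j; exact: bounded_cos_affine.
by apply/funext => t; exact: fejerE.
Qed.

Lemma integral_fejer n : (0 < n)%N -> \int[P1]_t fejer n t = 1.
Proof.
move=> n0; under eq_Rintegral do rewrite fejerE.
have ci i j : P1.-integrable (setT : set (T1 R)) (EFin \o
    (fun t : R => cos (2 * pi * (i%:Z - j%:Z)%:~R * t + 0))).
  by apply: bounded_measurable_integrable; exact: bounded_cos_affine.
rewrite RintegralZl//; last by apply: integrable_real_sum => i; exact: integrable_real_sum.
rewrite Rintegral_sum; last by move=> i; exact: integrable_real_sum.
rewrite (eq_bigr (fun=> 1)); last first.
  move=> i _; rewrite Rintegral_sum// (bigD1 i)//= subrr mulr0z mulr0.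
  under eq_Rintegral do rewrite mul0r addr0 cos0.
  rewrite Rintegral_cst//= [X in fine X](_ : _ = 1%E) ?probability_setT// mulr1 big1 ?addr0// => j ji.
  apply: integral_cos_mode; rewrite subr_eq0; apply: contra ji => /eqP[e].
  by apply/eqP/val_inj.
by rewrite sumr_const card_ord mulVf// pnatr_eq0 -lt0n.
Qed.

Definition fejer2 n (z : R * R) : R := fejer n z.1 * fejer n z.2.

Lemma fejer2_ge0 n z : 0 <= fejer2 n z.
Proof. by rewrite mulr_ge0// fejer_ge0. Qed.

Definition phase (k : int * int) (z : R * R) : R :=
  2 * pi * (k.1%:~R * z.1 + k.2%:~R * z.2).

(** The product of the two sums of exponentials is a sum over p in [0, n[^2. *)
Lemma fejer2E n z : fejer2 n z = n%:R^-1 ^+ 2 * \sum_(p : 'I_n * 'I_n) \sum_(q : 'I_n * 'I_n)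
  cos (phase (p.1%:Z - q.1%:Z, p.2%:Z - q.2%:Z) z).
Proof.
pose th (p : 'I_n * 'I_n) := 2 * pi * p.1%:R * z.1 + 2 * pi * p.2%:R * z.2.
transitivity (n%:R^-1 ^+ 2 * ((\sum_p cos (th p)) ^+ 2 + (\sum_p sin (th p)) ^+ 2)).
  pose C t : R := \sum_(j < n) cos (2 * pi * j%:R * t).
  pose S t : R := \sum_(j < n) sin (2 * pi * j%:R * t).
  have -> : \sum_p cos (th p) = C z.1 * C z.2 - S z.1 * S z.2.
    rewrite -(pair_bigA _ (fun i j => cos (th (i, j))))/= /C /S !big_distrlr/= -sumrB.
    by apply: eq_bigr => i _; rewrite -sumrB; apply: eq_bigr => j _; rewrite /th cosD.
  have -> : \sum_p sin (th p) = S z.1 * C z.2 + C z.1 * S z.2.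
    rewrite -(pair_bigA _ (fun i j => sin (th (i, j))))/= /C /S !big_distrlr/= -big_split/=.
    by apply: eq_bigr => i _; rewrite -big_split/=; apply: eq_bigr => j _; rewrite /th sinD.
  by rewrite /fejer2 /fejer -/(C _) -/(S _) -/(C z.2) -/(S z.2); ring.
rewrite sum_cos_sq; congr (_ * _); apply: eq_bigr => p _; apply: eq_bigr => q _.
by congr cos; rewrite /th /phase/= !rmorphB/=; ring.
Qed.

End fejer_kernel.

Section torus_convolution.
Context {R : realType}.
Local Notation intg2 f := (P2.-integrable (setT : set (T2 R)) (EFin \o f)).

Lemma integral_convolution (h : R * R -> R) (c : R * R) : Z2_periodic h ->
  (forall z, h (- z.1, - z.2) = h z) -> intg2 h ->
  \int[P2]_y h (c.1 - y.1, c.2 - y.2) = \int[P2]_z h z.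
Proof.
move=> ph he hi.
have ps := preserves_shift (fr1_itv (- c.1)) (fr1_itv (- c.2)).
rewrite -(Rintegral_preserves ps hi); apply: eq_Rintegral => y _.
rewrite -he/= -(periodic_fr (- _, _) ph); congr h.
have e (s t : R) : fr1 (- (s - t)) = fr1 (t + fr1 (- s)).
  by rewrite {3}/fr1 -mulrNz addrA fr1D_int opprB.
by rewrite /fr/= !e.
Qed.

Lemma fejer2_periodic n : Z2_periodic (@fejer2 R n).
Proof. by move=> z k l; rewrite /fejer2/= !fejerDint. Qed.

Lemma fejer2_even n (z : R * R) : fejer2 n (- z.1, - z.2) = fejer2 n z.
Proof. by rewrite /fejer2/= !fejerN. Qed.

Lemma fejer2_bounded n : bounded_measurable (fejer2 n : T2 R -> R).
Proof.
have [mf [M Mf]] := @fejer_bounded R n.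
apply: bounded_measurableM.
  by split; [exact: (measurableT_comp mf measurable_fst)|exists M => z; exact: Mf].
by split; [exact: (measurableT_comp mf measurable_snd)|exists M => z; exact: Mf].
Qed.

Lemma integral_fejer2 n : (0 < n)%N -> \int[P2]_z @fejer2 R n z = 1.
Proof.
move=> n0; have fi : P1.-integrable (setT : set (T1 R)) (EFin \o fejer n).
  by apply: bounded_measurable_integrable; exact: fejer_bounded.
rewrite Rintegral_P2_col; last by apply: bounded_measurable_integrable; exact: fejer2_bounded.
rewrite -[RHS](integral_fejer n0); apply: eq_Rintegral => x _.
by rewrite /fejer2/= RintegralZl// integral_fejer// mulr1.
Qed.

End torus_convolution.

Section negative_sobolev.
Context {R : realType}.
Local Notation intg2 f := (P2.-integrable (setT : set (T2 R)) (EFin \o f)).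
Variable f : R * R -> R.
Hypothesis fi : intg2 f.
Let mf : measurable_fun (setT : set (T2 R)) f.
Proof. by have /measurable_int/measurable_EFinP := fi. Qed.

Lemma measurable_phase k : measurable_fun (setT : set (T2 R)) (phase k : T2 R -> R).
Proof.
apply: measurable_funM; first exact: measurable_cst.
apply: measurable_funD; apply: measurable_funM; try exact: measurable_cst.
- exact: measurable_fst.
- exact: measurable_snd.
Qed.

Lemma bounded_cos_phase k : bounded_measurable ((fun z => cos (phase k z)) : T2 R -> R).
Proof.
split; last by exists 1 => z; exact: cos_max.
apply: (measurableT_comp _ (measurable_phase k)).
by apply: continuous_measurable_fun; exact: continuous_cos.
Qed.

Lemma bounded_sin_phase k : bounded_measurable ((fun z => sin (phase k z)) : T2 R -> R).
Proof.
split; last by exists 1 => z; exact: sin_max.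
apply: (measurableT_comp _ (measurable_phase k)).
by apply: continuous_measurable_fun; exact: continuous_sin.
Qed.

(** The squared modulus of the Fourier coefficient of f at k. *)
Definition amplitude (k : int * int) : R :=
  (\int[P2]_x (f x * cos (phase k x))) ^+ 2 + (\int[P2]_x (f x * sin (phase k x))) ^+ 2.

Let fc k : intg2 (fun x => f x * cos (phase k x)).
Proof. by apply: integrableM_bounded => //; exact: bounded_cos_phase. Qed.
Let fs k : intg2 (fun x => f x * sin (phase k x)).
Proof. by apply: integrableM_bounded => //; exact: bounded_sin_phase. Qed.

Let modeE k (w : (R * R) * (R * R)) :
  f w.1 * f w.2 * cos (phase k (w.1.1 - w.2.1, w.1.2 - w.2.2)) =
  (f w.1 * cos (phase k w.1)) * (f w.2 * cos (phase k w.2)) +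
  (f w.1 * sin (phase k w.1)) * (f w.2 * sin (phase k w.2)).
Proof.
have -> : phase k (w.1.1 - w.2.1, w.1.2 - w.2.2) = phase k w.1 - phase k w.2.
  by rewrite /phase/=; ring.
by rewrite cosB; ring.
Qed.

Lemma integrable_pair_mode k : (P2 \x P2)%E.-integrable setT (EFin \o (fun w : T2 R * T2 R =>
  f w.1 * f w.2 * cos (phase k (w.1.1 - w.2.1, w.1.2 - w.2.2)))).
Proof.
rewrite (_ : (fun w => _) = fun w => (f w.1 * cos (phase k w.1)) * (f w.2 * cos (phase k w.2)) +
  (f w.1 * sin (phase k w.1)) * (f w.2 * sin (phase k w.2))); last by apply/funext => w; exact: modeE.
exact: (integrable_realD (integrable_prod (fc k) (fc k)) (integrable_prod (fs k) (fs k))).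
Qed.

Lemma integral_pair_mode k : \int[(P2 \x P2)%E]_w
  (f w.1 * f w.2 * cos (phase k (w.1.1 - w.2.1, w.1.2 - w.2.2))) = amplitude k.
Proof.
under eq_Rintegral do rewrite modeE.
rewrite (RintegralD measurableT (integrable_prod (fc k) (fc k)) (integrable_prod (fs k) (fs k))).
by rewrite (Rintegral_prod (fc k) (fc k)) (Rintegral_prod (fs k) (fs k)) -!expr2.
Qed.

Lemma integral_pair_fejer n : \int[(P2 \x P2)%E]_w
  (f w.1 * f w.2 * fejer2 n (w.1.1 - w.2.1, w.1.2 - w.2.2)) =
  n%:R^-1 ^+ 2 * \sum_(p : 'I_n * 'I_n) \sum_(q : 'I_n * 'I_n)
    amplitude (p.1%:Z - q.1%:Z, p.2%:Z - q.2%:Z).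
Proof.
under eq_Rintegral => w _.
  rewrite fejer2E mulrCA mulr_sumr; under eq_bigr do rewrite mulr_sumr.
  over.
have I k := integrable_pair_mode k.
rewrite RintegralZl//; last first.
  by apply: integrable_real_sum => p; exact: integrable_real_sum.
rewrite Rintegral_sum; last by move=> p; exact: integrable_real_sum.
congr (_ * _); apply: eq_bigr => p _; rewrite Rintegral_sum//.
by apply: eq_bigr => q _; exact: integral_pair_mode.
Qed.

Lemma sum_amplitude_le (eps : R) (s : seq (int * int)) : 0 <= eps -> uniq s ->
  (Hm1_norm f <= eps%:E)%E ->
  \sum_(k <- s) (1 + (k.1%:~R ^+ 2 + k.2%:~R ^+ 2))^-1 * amplitude k <= eps ^+ 2.
Proof.
move=> e0 us hf.
pose F (k : int * int) : R :=
  (1 + (k.1%:~R ^+ 2 + k.2%:~R ^+ 2))^-1 * Normc.normc (fourier f k) ^+ 2.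
have FE k : F k = (1 + (k.1%:~R ^+ 2 + k.2%:~R ^+ 2))^-1 * amplitude k.
  congr (_ * _); rewrite /fourier/= sqr_sqrtr; last by rewrite addr_ge0// sqr_ge0.
  rewrite sqrrN /amplitude !Rintegral_P2//; last first.
    by have /measurable_int/measurable_EFinP := fc k.
  by have /measurable_int/measurable_EFinP := fs k.
have F0 k : 0 <= F k.
  by rewrite mulr_ge0 ?sqr_ge0// invr_ge0 addr_ge0// addr_ge0// sqr_ge0.
under eq_bigr do rewrite -FE.
rewrite -lee_fin -sumEFin.
apply: (@le_trans _ _ (\esum_(k in [set: int * int]) (F k)%:E)%E).
  apply: esum_ge; exists [set` s]; first by split=> //; exact: finite_seq.
  by rewrite -fsbig_seq.
have S0 : (0 <= \esum_(k in [set: int * int]) (F k)%:E)%E.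
  by apply: esum_ge0 => k _; rewrite lee_fin.
move: hf; rewrite /Hm1_norm -/F poweR12_sqrt//.
case: (\esum_(k in _) _)%E S0 => [r r0| _ |//]; last by rewrite leye_eq.
rewrite !lee_fin in r0 * => re; rewrite -(sqr_sqrtr r0).
by rewrite ler_pXn2r ?nnegrE ?sqrtr_ge0.
Qed.

(** For each q, the frequencies p - q are distinct and satisfy 1 + |p - q|^2 <= 2 n^2, so
    that the sum over p is at most 2 n^2 |f|_{H^-1}^2.  There are n^2 values of q, as many
    as the normalisation of the kernel divides by. *)
Lemma integral_pair_fejer_le n (eps : R) : (0 < n)%N -> 0 <= eps -> (Hm1_norm f <= eps%:E)%E ->
  \int[(P2 \x P2)%E]_w (f w.1 * f w.2 * fejer2 n (w.1.1 - w.2.1, w.1.2 - w.2.2)) <=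
  2 * n%:R ^+ 2 * eps ^+ 2.
Proof.
move=> n0 e0 hf; rewrite integral_pair_fejer exchange_big/=.
have nR : 0 < n%:R :> R by rewrite ltr0n.
pose fr_ (q p : 'I_n * 'I_n) : int * int := (p.1%:Z - q.1%:Z, p.2%:Z - q.2%:Z).
have amp0 k : 0 <= amplitude k by rewrite addr_ge0// sqr_ge0.
have one q : \sum_(p : 'I_n * 'I_n) amplitude (fr_ q p) <= 2 * n%:R ^+ 2 * eps ^+ 2.
  have inj : injective (fr_ q).
    move=> [p1 p2] [r1 r2] [/addIr[e1] /addIr[e2]].
    by congr (_, _); exact: val_inj.
  have us : uniq [seq fr_ q p | p <- index_enum ('I_n * 'I_n)%type].
    by rewrite map_inj_uniq// index_enum_uniq.
  have := sum_amplitude_le e0 us hf; rewrite big_map => h.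
  have n2 : 0 < 2 * n%:R ^+ 2 :> R by rewrite mulr_gt0// exprn_gt0.
  rewrite -ler_pdivrMl//; apply: le_trans h.
  rewrite mulr_sumr; apply: ler_sum => p _; rewrite ler_wpM2r//.
  have sq (i j : 'I_n) : (i%:Z - j%:Z)%:~R ^+ 2 <= (n%:R - 1) ^+ 2 :> R.
    rewrite -(real_normK (num_real (_%:~R))) ler_pXn2r ?nnegrE ?normr_ge0//; last first.
      by rewrite subr_ge0 ler1n.
    rewrite rmorphB/= -!pmulrn ler_norml.
    have : 0 <= i%:R :> R by []. have : 0 <= j%:R :> R by [].
    have le1 (m : nat) : (m < n)%N -> m%:R + 1 <= n%:R :> R by move=> ?; rewrite natr1 ler_nat.
    have := le1 _ (ltn_ord i); have := le1 _ (ltn_ord j).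
    by move=> *; apply/andP; split; lra.
  have := sq p.1 q.1; have := sq p.2 q.2; rewrite /fr_/=.
  set x := _%:~R ^+ 2; set y := _%:~R ^+ 2 => hy hx.
  have x0 : 0 <= x by rewrite sqr_ge0.
  have y0 : 0 <= y by rewrite sqr_ge0.
  rewrite lef_pV2 ?posrE//; last by rewrite ltr_pwDl// addr_ge0.
  have : 1 <= n%:R :> R by rewrite ler1n.
  by move: hx hy; rewrite sqrrB expr1n mulr1; nra.
apply: (@le_trans _ _ (n%:R^-1 ^+ 2 * \sum_(q : 'I_n * 'I_n) (2 * n%:R ^+ 2 * eps ^+ 2))).
  by rewrite ler_wpM2l ?sqr_ge0//; apply: ler_sum => q _; exact: one.
rewrite sumr_const card_prod !card_ord -[X in _ * X <= _]mulr_natl natrM.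
by rewrite le_eqVlt; apply/orP; left; apply/eqP; field; rewrite gt_eqF.
Qed.

End negative_sobolev.

(** * Mixing of the half strip *)

Section half_strip_geometry.
Context {R : realType}.
Implicit Types (x y : R * R).

Lemma half_stripE x : half_strip x = if 0 <= x.2 <= 2^-1 then 1 else 0 :> R.
Proof.
rewrite /half_strip indicE; case: ifPn => h; first by rewrite mem_set//= in_itv.
by rewrite memNset//= in_itv/=; exact/negP.
Qed.

Lemma measurable_half_strip : measurable_fun (setT : set (T2 R)) (@half_strip R : T2 R -> R).
Proof.
have m : measurable_fun (setT : set (T1 R)) (\1_(`[0, 2^-1]) : R -> R).
  by apply: measurable_indic; exact: measurable_itv.
exact: (measurableT_comp m measurable_snd).
Qed.

Lemma half_strip01 x : 0 <= (half_strip x : R) <= 1.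
Proof. by rewrite half_stripE; case: ifP => _; rewrite lexx ler01. Qed.

Definition differ (w : (R * R) * (R * R)) : R := (half_strip w.1 - half_strip w.2) ^+ 2.

Lemma differE w : differ w = if half_strip w.1 == half_strip w.2 :> R then 0 else 1.
Proof.
rewrite /differ !half_stripE; case: ifP => _; case: ifP => _.
- by rewrite eqxx subrr expr0n.
- by rewrite oner_eq0 subr0 expr1n.
- by rewrite eq_sym oner_eq0 sub0r sqrrN expr1n.
- by rewrite eqxx subrr expr0n.
Qed.

Lemma differ01 w : 0 <= differ w <= 1.
Proof. by rewrite differE; case: ifP => _; rewrite lexx ler01. Qed.

Lemma strip_product x y : (half_strip x - 2^-1) * (half_strip y - 2^-1) = 4^-1 - 2^-1 * differ (x, y).
Proof. by rewrite /differ/= !half_stripE; case: ifP => _; case: ifP => _; field. Qed.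

Lemma strip_product_le x y : `|(half_strip x - 2^-1) * (half_strip y - 2^-1)| <= 4^-1 :> R.
Proof.
rewrite strip_product; have /andP[a b] := differ01 (x, y).
by rewrite ler_norml; apply/andP; split; lra.
Qed.

(** sin (2 pi x_2) and sin (2 pi y_2) have opposite signs when exactly one of x, y is in
    the strip, so |sin (2 pi x_2)| is at most the modulus of their difference. *)
Lemma strip_gap x y : Q x -> Q y -> differ (x, y) != 0 ->
  `|sin (2 * pi * x.2)| <= 2 * torus_gauge (x.1 - y.1, x.2 - y.2).
Proof.
have p0 : 0 < pi :> R by exact: pi_gt0.
have upper t : 0 <= t <= 2^-1 -> 0 <= sin (2 * pi * t) :> R.
  move=> /andP[t0 t1]; apply: sin_ge0_pi; apply/andP; split; first by rewrite !mulr_ge0// ltW.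
  by rewrite mulrAC -[leRHS]mul1r ler_pM2r//; lra.
have lower t : 2^-1 < t < 1 -> sin (2 * pi * t) <= 0 :> R.
  move=> /andP[t0 t1]; rewrite (_ : 2 * pi * t = 2 * pi * (t - 2^-1) + pi); last by field.
  by rewrite sinDpi oppr_le0 upper//; apply/andP; split; lra.
move=> [_ /=]; rewrite in_itv/= => x2 [_ /=]; rewrite in_itv/= => y2.
rewrite differE; case: ifP => [|+ _]; first by rewrite eqxx.
rewrite !half_stripE => h.
have key : `|sin (2 * pi * x.2)| <= `|sin (2 * pi * x.2) - sin (2 * pi * y.2)|.
  case: ifP h; case: ifP; rewrite ?eqxx//= => hy hx _.
    have sx := upper _ hx; have sy : sin (2 * pi * y.2) <= 0.
      by apply: lower; move: y2 hy => /andP[y0 ->]; rewrite y0/= andbT ltNge => ->.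
    by rewrite ger0_norm// ger0_norm ?subr_ge0 ?(le_trans sy)// lerDl oppr_ge0.
  have sy := upper _ hy; have sx : sin (2 * pi * x.2) <= 0.
    by apply: lower; move: x2 hx => /andP[x0 ->]; rewrite x0/= andbT ltNge => ->.
  by rewrite ler0_norm// ler0_norm ?subr_le0 ?(le_trans sx)// opprB lerDr.
apply: (le_trans key).
have -> : sin (2 * pi * x.2) - sin (2 * pi * y.2) = 2 * (sin (pi * (x.2 - y.2)) * cos (pi * (x.2 + y.2))).
  rewrite (_ : 2 * pi * x.2 = pi * (x.2 + y.2) + pi * (x.2 - y.2)); last by ring.
  rewrite (_ : 2 * pi * y.2 = pi * (x.2 + y.2) - pi * (x.2 - y.2)); last by ring.
  by rewrite sinB sinD; ring.
rewrite normrM ger0_norm// ler_wpM2l// normrM /torus_gauge/=.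
by rewrite (@le_trans _ _ `|sin (pi * (x.2 - y.2))|)// ?lerDr// ler_piMr// cos_max.
Qed.

Definition near_boundary (t : R) : R := if `|sin (2 * pi * t)| < 16^-1 then 1 else 0.

(** The four dyadic intervals of length 1/32 adjacent to 0, 1/2 and 1.  A bound by
    densities [kap] makes the measure of the set immediate. *)
Lemma near_boundary_le t : 0 <= t < 1 ->
  near_boundary t <= 32^-1 * (kap 5 0 t + kap 5 (15 / 32) t + kap 5 (16 / 32) t + kap 5 (31 / 32) t).
Proof.
move=> /andP[t0 t1].
have didxE (i : nat) : didx 5 (i%:R / 32 : R) = i%:Z.
  apply/eqP; rewrite didx_eq -pmulrn (_ : 2 ^+ 5 = 32 :> R); last by ring.
  by rewrite lexx/= ltr_pM2r// ltrDl.
have sameE (i : nat) : same1 5 (i%:R / 32 : R) t = (i%:R / 32 <= t < (i%:R + 1) / 32).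
  rewrite same1_sym /same1 didxE didx_eq -pmulrn (_ : 2 ^+ 5 = 32 :> R)//; by ring.
have k0 (c : R) : 0 <= kap 5 c t by exact: kap_ge0.
rewrite /near_boundary; case: ifPn => [h|_]; last by rewrite mulr_ge0// !addr_ge0.
have big (i : nat) : i%:R / 32 <= t < (i%:R + 1) / 32 -> kap 5 (i%:R / 32) t = 32.
  by move=> hi; rewrite /kap sameE hi mulr1; ring.
have [k [k1 _]] := near_int (2 * t).
have {}k1 : `|2 * t + k%:~R| < 16^-1 by rewrite (le_lt_trans k1)// mulrCA mulrA.
have [k2 k3] : (- 3 < k)%R /\ (k < 1)%R.
  move: k1; rewrite ltr_norml => /andP[a b].
  by split; rewrite -(ltr_int R); lra.
have hk : [\/ kap 5 0 t = 32, kap 5 (15 / 32) t = 32, kap 5 (16 / 32) t = 32 | kap 5 (31 / 32) t = 32].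
  have e0 : kap 5 0 t = kap 5 (0%:R / 32) t by rewrite mul0r.
  have : k = 0 \/ k = -1 \/ k = -2 by lia.
  case=> [|[|]] e; rewrite e ?mulrNz ltr_norml in k1; move: k1 => /andP[a b].
  - by constructor 1; rewrite e0 (big 0%N)//; apply/andP; split; lra.
  - have [s|s] := leP 2^-1 t.
      by constructor 3; rewrite (big 16%N)//; apply/andP; split; lra.
    by constructor 2; rewrite (big 15%N)//; apply/andP; split; lra.
  - by constructor 4; rewrite (big 31%N)//; apply/andP; split; lra.
have := k0 0; have := k0 (15 / 32); have := k0 (16 / 32); have := k0 (31 / 32).
by case: hk => ->; lra.
Qed.

Lemma measurable_near_boundary : measurable_fun (setT : set (T1 R)) near_boundary.
Proof.
apply: measurable_fun_ifT => //; apply: measurable_fun_ltr; last exact: measurable_cst.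
apply: measurableT_comp => //; apply: (measurableT_comp (continuous_measurable_fun (@continuous_sin R))).
exact: measurable_funM.
Qed.

Lemma near_boundary_bounded : bounded_measurable ((fun x => near_boundary x.2) : T2 R -> R).
Proof.
split; first exact: (measurableT_comp measurable_near_boundary measurable_snd).
by exists 1 => t; rewrite /near_boundary; case: ifP; rewrite ?normr1 ?normr0.
Qed.

Lemma integral_near_boundary : \int[P2]_x near_boundary x.2 <= 8^-1.
Proof.
have bk (c : R) : bounded_measurable ((fun t => kap 5 c t) : T1 R -> R).
  split; first exact: measurable_kap_r.
  by exists (2 ^+ 5) => t; rewrite ger0_norm ?kap_ge0// kap_le.
have ik c : P1.-integrable (setT : set (T1 R)) (EFin \o (fun t => kap 5 c t)).
  by apply: bounded_measurable_integrable; exact: bk.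
have k1 c : 0 <= c < 1 -> \int[P1]_t kap 5 c t = 1.
  by move=> hc; rewrite /Rintegral integral_kap.
pose F t : R := 32^-1 * (kap 5 0 t + kap 5 (15 / 32) t + kap 5 (16 / 32) t + kap 5 (31 / 32) t).
have Fi : P1.-integrable (setT : set (T1 R)) (EFin \o F).
  by apply: integrable_realZ; do 3 ![apply: integrable_realD => //].
have FI : \int[P1]_t F t = 8^-1.
  rewrite /F RintegralZl//; last by do 3 ![apply: integrable_realD => //].
  rewrite RintegralD//; last by do 2 ![apply: integrable_realD => //].
  rewrite RintegralD//; last by apply: integrable_realD.
  rewrite RintegralD// !k1; try by apply/andP; split; lra.
  by field.
rewrite -FI -(Rintegral_preserves preserves_snd Fi).
apply: ae_le_Rintegral.
- by apply: bounded_measurable_integrable; exact: near_boundary_bounded.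
- exact: (integrable_preserves preserves_snd Fi).
- by apply: (ae_imp ae_Q) => x [_ /=]; rewrite in_itv/=; exact: near_boundary_le.
Qed.

Lemma strip_sine : \int[P2]_x ((half_strip x - 2^-1) * sin (2 * pi * x.2)) = pi^-1 :> R.
Proof.
have p0 : 0 < pi :> R by exact: pi_gt0.
pose st (t : R) : R := if 2^-1 <= t then 1 else 0.
pose co (t : R) : R := cos (2 * pi * t + - (pi / 2)).
have mst : measurable_fun (setT : set (T1 R)) st.
  by apply: measurable_fun_ifT => //; apply: measurable_fun_ler.
have bst : bounded_measurable (st : T1 R -> R).
  by split=> //; exists 1 => t; rewrite /st; case: ifP; rewrite ?normr1 ?normr0.
have bco : bounded_measurable (co : T1 R -> R) by exact: bounded_cos_affine.
have ico : P1.-integrable (setT : set (T1 R)) (EFin \o co) := bounded_measurable_integrable P1 bco.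
have ist : P1.-integrable (setT : set (T1 R)) (EFin \o (fun t => st t * co t)).
  by apply: bounded_measurable_integrable; exact: bounded_measurableM.
pose F t := 2^-1 * co t - st t * co t.
have ihc : P1.-integrable (setT : set (T1 R)) (EFin \o (fun t => 2^-1 * co t)) by exact: integrable_realZ.
have Fi : P1.-integrable (setT : set (T1 R)) (EFin \o F) by exact: integrable_realB.
have c2 : 2 * pi != 0 :> R by rewrite mulf_neq0 ?gt_eqF.
have FI : \int[P1]_t F t = pi^-1.
  rewrite RintegralB// RintegralZl// /st /co.
  rewrite integral_cos_P1// integral_cos_from//; last by apply/andP; split; lra.
  have s1 : sin (2 * pi + - (pi / 2)) = -1 :> R.
    rewrite (_ : 2 * pi + _ = - (pi / 2) + pi *+ 2); last by ring.
    by rewrite sinD2pi sinN sin_pihalf.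
  have s2 : sin (2 * pi * 2^-1 + - (pi / 2)) = 1 :> R.
    by rewrite (_ : 2 * pi * 2^-1 + _ = pi / 2) ?sin_pihalf//; field.
  by rewrite s1 s2 sinN sin_pihalf invfM; lra.
rewrite -FI -(Rintegral_preserves preserves_snd Fi).
apply: ae_eq_Rintegral.
- apply: measurable_funM; first by apply: measurable_funB => //; exact: measurable_half_strip.
  have ms : measurable_fun (setT : set (T1 R)) (fun t : R => sin (2 * pi * t)).
    by apply: (measurableT_comp (continuous_measurable_fun (@continuous_sin R))); exact: measurable_funM.
  exact: (measurableT_comp ms measurable_snd).
- by have /measurable_int/measurable_EFinP := integrable_preserves preserves_snd Fi.
have nh : {ae P1, forall t : R, t != 2^-1}.
  exists [set 2^-1]; split.
  - exact: measurable_set1.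
  - rewrite P1E; apply/eqP; rewrite eq_le measure_ge0 andbT.
    rewrite -(lebesgue_measure_set1 (2^-1 : R)); apply: le_measure; rewrite ?inE//.
    by apply: measurableI => //; exact: measurable_itv.
  - by move=> t /= /negP; rewrite negbK => /eqP.
apply: (ae_imp (ae_and ae_Q (ae_preserves preserves_snd nh))) => x [[_ /=]].
rewrite in_itv/= => /andP[x0 _] xh; rewrite /F /co cosBpihalf half_stripE x0/= /st.
move: (x.2 : R) xh => t th; have [h|h] := ltP t 2^-1.
  by rewrite (ltW h)/=; field.
by rewrite leNgt lt_neqAle eq_sym th h/=; field.
Qed.

End half_strip_geometry.

Section mixing_by_a_measure_preserving_map.
Context {R : realType}.
Local Notation TT R := (T2 R * T2 R)%type.
Local Notation intg2 f := (P2.-integrable (setT : set (T2 R)) (EFin \o f)).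
Variables (Y : R * R -> R * R) (f : R * R -> R).
Hypothesis pY : preserves P2 P2 (Y : T2 R -> T2 R).
Hypothesis mf : measurable_fun (setT : set (T2 R)) f.
Hypothesis hf : {ae P2, forall x, f (Y x) = half_strip x - 2^-1}.

Let pYY : preserves (P22 : {measure set (TT R) -> \bar R}) (P22 : {measure set (TT R) -> \bar R})
  (fun w : TT R => (Y w.1, Y w.2)) := preserves_pair pY pY.

Definition gap (w : (R * R) * (R * R)) : R * R := (w.1.1 - w.2.1, w.1.2 - w.2.2).
Let gapY (w : (R * R) * (R * R)) : R * R := gap (Y w.1, Y w.2).

Lemma measurable_gap : measurable_fun (setT : set (TT R)) (gap : TT R -> T2 R).
Proof.
apply/measurable_fun_pairP; split => /=; apply: measurable_funB.
- exact: (measurableT_comp measurable_fst measurable_fst).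
- exact: (measurableT_comp measurable_fst measurable_snd).
- exact: (measurableT_comp measurable_snd measurable_fst).
- exact: (measurableT_comp measurable_snd measurable_snd).
Qed.

Let mgapY : measurable_fun (setT : set (TT R)) (gapY : TT R -> T2 R).
Proof. exact: (measurableT_comp measurable_gap pYY.1). Qed.

Lemma bounded_gapY (h : R * R -> R) : bounded_measurable (h : T2 R -> R) ->
  bounded_measurable ((fun w => h (gapY w)) : TT R -> R).
Proof.
by move=> [mh [M hM]]; split; [exact: (measurableT_comp mh mgapY)|exists M => w; exact: hM].
Qed.

Lemma bounded_gap (h : R * R -> R) : bounded_measurable (h : T2 R -> R) ->
  bounded_measurable ((fun w => h (gap w)) : TT R -> R).
Proof.
by move=> [mh [M hM]]; split; [exact: (measurableT_comp mh measurable_gap)|exists M => w; exact: hM].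
Qed.

Lemma bounded_half_strip : bounded_measurable ((fun x => half_strip x - 2^-1) : T2 R -> R).
Proof.
split; first by apply: measurable_funB => //; exact: measurable_half_strip.
by exists 1 => x; have /andP[a b] := half_strip01 x; rewrite ler_norml; apply/andP; split; lra.
Qed.

Lemma bounded_differ : bounded_measurable (differ : TT R -> R).
Proof.
split; last first.
  by exists 1 => w; have /andP[a b] := @differ01 R w; rewrite ger0_norm.
apply: measurable_funX; apply: measurable_funB.
- exact: (measurableT_comp measurable_half_strip measurable_fst).
- exact: (measurableT_comp measurable_half_strip measurable_snd).
Qed.

Section even_periodic_kernel.
Variable h : R * R -> R.
Hypotheses (ph : Z2_periodic h) (eh : forall z, h (- z.1, - z.2) = h z).
Hypothesis bh : bounded_measurable (h : T2 R -> R).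

Lemma integral_gapY_r x : \int[P2]_y h (gapY (x, y)) = \int[P2]_z h z.
Proof.
have [mh [M hM]] := bh.
rewrite -(integral_convolution (Y x) ph eh (bounded_measurable_integrable P2 bh)).
rewrite -[RHS](Rintegral_preserves pY (f := fun y => h ((Y x).1 - y.1, (Y x).2 - y.2)))//.
apply: bounded_measurable_integrable; split; last by exists M => z; exact: hM.
apply: (measurableT_comp mh); apply/measurable_fun_pairP; split => /=; exact: measurable_funB.
Qed.

Lemma integral_gapY_l y : \int[P2]_x h (gapY (x, y)) = \int[P2]_z h z.
Proof.
rewrite -(integral_gapY_r y); apply: eq_Rintegral => x _.
by rewrite -eh /gapY/gap/= !opprB.
Qed.

(** The law of y is invariant under Y and under translations, so the integral over y does
    not depend on x. *)
Lemma integral_weight_gapY (g : R * R -> R) : bounded_measurable (g : T2 R -> R) ->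
  \int[P22]_w (g w.1 * h (gapY w)) = \int[P2]_x g x * \int[P2]_z h z.
Proof.
move=> bg; have bgh : bounded_measurable ((fun w => g w.1 * h (gapY w)) : TT R -> R).
  apply: bounded_measurableM; last exact: bounded_gapY.
  have [mg [M gM]] := bg.
  by split; [exact: (measurableT_comp mg measurable_fst)|exists M => w; exact: gM].
have i : (P2 \x P2)%E.-integrable setT (EFin \o (fun w : TT R => g w.1 * h (gapY w))).
  exact: (bounded_measurable_integrable P22 bgh).
rewrite [LHS](Rintegral_col i).
have gi : intg2 g by exact: (bounded_measurable_integrable P2 bg).
rewrite -(RintegralZr _ measurableT gi); apply: eq_Rintegral => x _ /=.
rewrite RintegralZl//; first by rewrite integral_gapY_r.
have [mhY [M hM]] := bounded_gapY bh.
apply: bounded_measurable_integrable; split; last by exists M => z; exact: hM.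
exact: (measurableT_comp mhY (measurable_pair1 x)).
Qed.

End even_periodic_kernel.

Lemma integrable_image : intg2 f.
Proof.
have mfY : measurable_fun (setT : set (T2 R)) (fun x => f (Y x)).
  exact: (measurableT_comp mf pY.1).
apply/integrableP; split; first exact/measurable_EFinP.
rewrite -(ge0_integral_preserves pY)//; last first.
  by apply/measurable_EFinP; exact: measurableT_comp.
have [mhs _] := bounded_half_strip.
have e : (\int[P2]_x (`|f (Y x)|)%:E = \int[P2]_x (`|half_strip x - 2^-1|)%:E)%E.
  apply: ae_eq_integral => //.
  - by apply/measurable_EFinP; exact: measurableT_comp.
  - by apply/measurable_EFinP; exact: measurableT_comp.
  - by apply: (ae_imp hf) => x -> _.
rewrite [X in (X < _)%E]e.
by have /integrableP[_] := bounded_measurable_integrable P2 bounded_half_strip.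
Qed.

(** The pair correlations of f are those of the initial datum, seen through Y. *)
Lemma pair_image (h : R * R -> R) : bounded_measurable (h : T2 R -> R) ->
  \int[P22]_w (f w.1 * f w.2 * h (gap w)) =
  \int[P22]_w ((half_strip w.1 - 2^-1) * (half_strip w.2 - 2^-1) * h (gapY w)).
Proof.
move=> bh; have fi := integrable_image.
have ffi : P22.-integrable (setT : set (TT R)) (EFin \o (fun w => f w.1 * f w.2 * h (gap w))).
  by apply: integrableM_bounded; [exact: (integrable_prod fi fi)|exact: bounded_gap].
rewrite -(Rintegral_preserves pYY ffi); apply: ae_eq_Rintegral.
- have /measurable_int/measurable_EFinP := ffi => mff.
  exact: (measurableT_comp mff pYY.1).
- have [mhs _] := bounded_half_strip; have [mhY _] := bounded_gapY bh.
  apply: measurable_funM => //; apply: measurable_funM.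
  + exact: (measurableT_comp mhs measurable_fst).
  + exact: (measurableT_comp mhs measurable_snd).
have a1 := ae_preserves (preserves_fst_prod P2 P2) hf.
have a2 := ae_preserves (preserves_snd_prod P2 P2) hf.
by apply: (ae_imp (ae_and a1 a2)) => w /= [-> ->].
Qed.

Variables (eps : R) (eps0 : 0 <= eps) (Hf : (Hm1_norm f <= eps%:E)%E).

Section fejer_weight.
Variable n : nat.
Hypothesis n0 : (0 < n)%N.

Definition mix_weight (w : (R * R) * (R * R)) : R := differ w * fejer2 n (gapY w).

Let bK : bounded_measurable ((fun w => fejer2 n (gapY w)) : TT R -> R).
Proof. exact/bounded_gapY/fejer2_bounded. Qed.

Lemma mix_weight_bounded : bounded_measurable (mix_weight : TT R -> R).
Proof. by apply: bounded_measurableM => //; exact: bounded_differ. Qed.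

Lemma mix_weight_le w : mix_weight w <= fejer2 n (gapY w).
Proof.
by have /andP[_ h] := @differ01 R w; rewrite /mix_weight ler_piMl ?fejer2_ge0.
Qed.

Lemma mix_weight_ge0 w : 0 <= mix_weight w.
Proof. by have /andP[h _] := @differ01 R w; rewrite mulr_ge0 ?fejer2_ge0. Qed.

Lemma mix_pair_weight : pair_weight mix_weight.
Proof.
have [mW _] := mix_weight_bounded; have [mK [M hM]] := bK.
have K1 := integral_fejer2 (R := R) n0.
have sec (g : R * R -> (R * R) * (R * R)) : measurable_fun (setT : set (T2 R)) (g : T2 R -> TT R) ->
    \int[P2]_y fejer2 n (gapY (g y)) = 1 -> (\int[P2]_y (mix_weight (g y))%:E <= 1)%E.
  move=> mg e; have i : intg2 (fun y => fejer2 n (gapY (g y))).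
    apply: bounded_measurable_integrable; split; last by exists M => y; exact: hM.
    exact: (measurableT_comp mK mg).
  apply: (@le_trans _ _ (\int[P2]_y (fejer2 n (gapY (g y)))%:E)%E).
    by apply: ge0_le_integralT => y; rewrite lee_fin ?mix_weight_ge0// mix_weight_le.
  by rewrite -(Rintegral_EFin i) e.
split=> //.
- exact: mix_weight_ge0.
- move=> x; apply: (sec (fun y => (x, y))); first exact: measurable_pair1.
  by rewrite (integral_gapY_r (@fejer2_periodic R n) (@fejer2_even R n) (@fejer2_bounded R n)).
- move=> y; apply: (sec (fun x => (x, y))); first exact: measurable_pair2.
  by rewrite (integral_gapY_l (@fejer2_periodic R n) (@fejer2_even R n) (@fejer2_bounded R n)).
Qed.

(** f (Y x) * f (Y y) is 1/4 minus half the indicator function of the pairs with exactly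
    one point in the strip, and its mean against the kernel is small by
    [integral_pair_fejer_le]. *)
Lemma mix_weight_mass : 2^-1 - 4 * n%:R ^+ 2 * eps ^+ 2 <= \int[P22]_w mix_weight w.
Proof.
have := integral_pair_fejer_le integrable_image n0 eps0 Hf.
have e := pair_image (@fejer2_bounded R n).
rewrite [X in X <= _](_ : _ = \int[P22]_w (f w.1 * f w.2 * fejer2 n (gap w)))// e.
under eq_Rintegral => w _ do rewrite strip_product mulrBl -mulrA -[differ _ * _]/(mix_weight (w.1, w.2)).
have i1 := bounded_measurable_integrable P22 bK.
have i2 := bounded_measurable_integrable P22 mix_weight_bounded.
rewrite RintegralB//; [|exact: integrable_realZ|exact: integrable_realZ].
rewrite RintegralZl// RintegralZl//.
have -> : \int[P22]_w fejer2 n (gapY w) = 1.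
  have one : bounded_measurable ((fun=> 1) : T2 R -> R) by exact: bounded_measurable_cst.
  have := integral_weight_gapY (@fejer2_periodic R n) (@fejer2_even R n) (@fejer2_bounded R n) one.
  under eq_Rintegral do rewrite mul1r.
  by move=> ->; rewrite integral_fejer2// mulr1 Rintegral_cst//= [X in fine X](_ : _ = 1%E) ?probability_setT// mulr1.
rewrite [X in _ - _ * X <= _](_ : _ = \int[P22]_w mix_weight w); last first.
  by apply: eq_Rintegral => -[].
by move: (Rintegral _ _ _) (n%:R ^+ 2 * eps ^+ 2) (mulrA) => I c _; lra.
Qed.

Lemma torus_gauge_bounded : bounded_measurable (@torus_gauge R : T2 R -> R).
Proof.
split; first exact: measurable_torus_gauge.
exists 2 => z; rewrite ger0_norm ?torus_gauge_ge0//.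
by rewrite (_ : 2 = 1 + 1 :> R)// lerD ?sin_max//.
Qed.

Lemma log_gauge_bounded (d : R) : 0 < d ->
  bounded_measurable ((fun z => ln (1 + torus_gauge z / d)) : T2 R -> R).
Proof.
move=> d0; have [mg _] := torus_gauge_bounded; split.
  apply: (measurableT_comp (@measurable_ln R)).
  by apply: measurable_funD => //; exact: measurable_funM.
have gd z : 0 <= torus_gauge z / d by rewrite divr_ge0 ?torus_gauge_ge0// ltW.
exists (2 / d) => z; rewrite ger0_norm ?ln_ge0 ?lerDl//.
apply: le_trans (le_ln1Dx _) _; first by rewrite (lt_le_trans _ (gd z))// ltrN10.
rewrite ler_pM2r ?invr_gt0// (_ : 2 = 1 + 1 :> R)// lerD ?sin_max//.
Qed.

(** ln (1 + s) <= s, and s / d <= (1 + s^2 / d^2) / 2 for each coordinate; the quadratic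
    term is controlled by [fejer_sin], as n d^2 = 1. *)
Lemma mix_log_image_le (d : R) : 0 < d -> n%:R * d ^+ 2 = 1 ->
  \int[P22]_w (mix_weight w * ln (1 + torus_gauge (gapY w) / d)) <= 2.
Proof.
move=> d0 nd; have nR : 0 < n%:R :> R by rewrite ltr0n.
(* a periodic even majorant of the integrand, of integral 2 *)
pose h (z : R * R) : R := fejer2 n z + 2^-1 * (fejer n z.1 + fejer n z.2).
have ph : Z2_periodic h by move=> z k l; rewrite /h fejer2_periodic/= !fejerDint.
have eh z : h (- z.1, - z.2) = h z by rewrite /h fejer2_even/= !fejerN.
have bf1 : bounded_measurable ((fun z : R * R => fejer n z.1) : T2 R -> R).
  have [mf1 [M hM]] := @fejer_bounded R n.
  by split; [exact: (measurableT_comp mf1 measurable_fst)|exists M => z; exact: hM].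
have bf2 : bounded_measurable ((fun z : R * R => fejer n z.2) : T2 R -> R).
  have [mf1 [M hM]] := @fejer_bounded R n.
  by split; [exact: (measurableT_comp mf1 measurable_snd)|exists M => z; exact: hM].
have bs : bounded_measurable ((fun z : R * R => 2^-1 * (fejer n z.1 + fejer n z.2)) : T2 R -> R).
  apply: bounded_measurableM; first exact: bounded_measurable_cst.
  exact: bounded_measurableD.
have bh : bounded_measurable (h : T2 R -> R).
  by apply: bounded_measurableD => //; exact: fejer2_bounded.
have one : bounded_measurable ((fun=> 1) : T2 R -> R) by exact: bounded_measurable_cst.
have hI : \int[P22]_w h (gapY w) = 2.
  have := integral_weight_gapY ph eh bh one.
  under eq_Rintegral do rewrite mul1r.
  move=> ->; rewrite Rintegral_cst//= [X in fine X](_ : _ = 1%E) ?probability_setT// !mul1r.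
  have i1 := bounded_measurable_integrable P2 bf1; have i2 := bounded_measurable_integrable P2 bf2.
  have fi := bounded_measurable_integrable P1 (@fejer_bounded R n).
  rewrite RintegralD//; last exact: (bounded_measurable_integrable P2 bs).
    rewrite RintegralZl//; last exact: integrable_realD.
    rewrite RintegralD// (Rintegral_preserves preserves_fst fi) (Rintegral_preserves preserves_snd fi).
    by rewrite integral_fejer// integral_fejer2//; field.
  exact: (bounded_measurable_integrable P2 (@fejer2_bounded R n)).
rewrite -hI; apply: le_Rintegral => //.
- apply: bounded_measurable_integrable; apply: bounded_measurableM; first exact: mix_weight_bounded.
  exact: (bounded_gapY (log_gauge_bounded d0)).
- exact: (bounded_measurable_integrable P22 (bounded_gapY bh)).
move=> w _; set z := gapY w.
have g0 : 0 <= torus_gauge z / d by rewrite divr_ge0 ?torus_gauge_ge0// ltW.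
have lg : ln (1 + torus_gauge z / d) <= torus_gauge z / d.
  by apply: le_ln1Dx; rewrite (lt_le_trans _ g0)// ltrN10.
apply: (@le_trans _ _ (fejer2 n z * (torus_gauge z / d))).
  apply: ler_pM => //; [exact: mix_weight_ge0|by rewrite ln_ge0// lerDl|exact: mix_weight_le].
have F1 := fejer_ge0 n z.1; have F2 := fejer_ge0 n z.2.
have s1 := fejer_sin n z.1; have s2 := fejer_sin n z.2.
have en : n%:R^-1 = d ^+ 2 :> R.
  by apply: (mulfI (lt0r_neq0 nR)); rewrite mulfV ?gt_eqF.
rewrite en in s1 s2; rewrite /h /fejer2 /torus_gauge.
rewrite -(real_normK (num_real (sin (pi * z.1)))) in s1.
rewrite -(real_normK (num_real (sin (pi * z.2)))) in s2.
move: s1 s2; move: (fejer n z.1) (fejer n z.2) F1 F2 (`|sin (pi * z.1)|) (`|sin (pi * z.2)|).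
move=> a b a0 b0 s t s1 s2.
have q (r : R) : r / d <= 2^-1 * (1 + r ^+ 2 / d ^+ 2).
  have := sqr_ge0 (1 - r / d); rewrite sqrrB expr1n mul1r expr_div_n.
  by lra.
have ab : 0 <= a * b by rewrite mulr_ge0.
rewrite mulrDl mulrDr.
have {}s1 : a * (s ^+ 2 / d ^+ 2) <= 1 by rewrite mulrA ler_pdivrMr ?exprn_gt0// mul1r.
have {}s2 : b * (t ^+ 2 / d ^+ 2) <= 1 by rewrite mulrA ler_pdivrMr ?exprn_gt0// mul1r.
apply: (le_trans (lerD (ler_wpM2l ab (q s)) (ler_wpM2l ab (q t)))).
have u1 : b * (a * (s ^+ 2 / d ^+ 2)) <= b by rewrite ler_piMr.
have u2 : a * (b * (t ^+ 2 / d ^+ 2)) <= a by rewrite ler_piMr.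
by move: u1 u2; move: (s ^+ 2 / d ^+ 2) (t ^+ 2 / d ^+ 2) => S' T'; lra.
Qed.

(** The pairs with x away from the boundary of the strip are at distance at least 1/32.
    The others have mass at most 1/8, since the first marginal of the weight has density
    at most 1. *)
Lemma mix_log_ge (d : R) : 0 < d ->
  ln (1 + (32 * d)^-1) * (\int[P22]_w mix_weight w - 8^-1) <=
  \int[P22]_w (mix_weight w * ln (1 + torus_gauge (gap w) / d)).
Proof.
move=> d0; set l := ln _.
have l0 : 0 <= l by rewrite ln_ge0// lerDl invr_ge0 mulr_ge0// ltW.
have bnb := @near_boundary_bounded R.
have bB : bounded_measurable ((fun w => near_boundary w.1.2 * fejer2 n (gapY w)) : TT R -> R).
  apply: bounded_measurableM => //; have [m [M hM]] := bnb.
  by split; [exact: (measurableT_comp m measurable_fst)|exists M => w; exact: hM].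
have iB := bounded_measurable_integrable P22 bB.
have iW := bounded_measurable_integrable P22 mix_weight_bounded.
have B8 : \int[P22]_w (near_boundary w.1.2 * fejer2 n (gapY w)) <= 8^-1.
  rewrite (integral_weight_gapY (@fejer2_periodic R n) (@fejer2_even R n) (@fejer2_bounded R n) bnb).
  by rewrite integral_fejer2// mulr1; exact: integral_near_boundary.
apply: (@le_trans _ _ (\int[P22]_w (l * (mix_weight w - near_boundary w.1.2 * fejer2 n (gapY w))))).
  rewrite RintegralZl//; last exact: integrable_realB.
  by rewrite ler_wpM2l// RintegralB// lerD2l lerN2.
apply: ae_le_Rintegral.
- by apply: integrable_realZ; exact: integrable_realB.
- apply: bounded_measurable_integrable; apply: bounded_measurableM; first exact: mix_weight_bounded.
  exact: (bounded_gap (log_gauge_bounded d0)).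
have a1 := ae_preserves (preserves_fst_prod P2 P2) (@ae_Q R).
have a2 := ae_preserves (preserves_snd_prod P2 P2) (@ae_Q R).
apply: (ae_imp (ae_and a1 a2)) => -[x y] /= [Qx Qy].
have K0 := fejer2_ge0 n (gapY (x, y)).
have g0 : 0 <= torus_gauge (gap (x, y)) / d by rewrite divr_ge0 ?torus_gauge_ge0// ltW.
have ll : 0 <= ln (1 + torus_gauge (gap (x, y)) / d) by rewrite ln_ge0// lerDl.
have W0 := mix_weight_ge0 (x, y).
rewrite /near_boundary; case: ifPn => [_|]; rewrite -?leNgt.
  rewrite mul1r (@le_trans _ _ 0)//; last exact: mulr_ge0.
  by rewrite mulr_ge0_le0// subr_le0 mix_weight_le.
rewrite mul0r subr0 => s16.
have [df|df] := eqVneq (differ (x, y)) 0; first by rewrite /mix_weight df !(mul0r, mulr0).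
rewrite [leLHS]mulrC ler_wpM2l// ler_ln ?posrE ?ltr_pwDl// ?invr_ge0 ?mulr_ge0// ?(ltW d0)//.
rewrite lerD2l invfM ler_pM2r ?invr_gt0//.
rewrite -(@ler_pM2l _ 2)//; apply: le_trans (strip_gap Qx Qy df); apply: le_trans s16.
by rewrite -[32]/((2 * 16)%N%:R) natrM invfM mulVKf// pnatr_eq0.
Qed.

End fejer_weight.

(** The frequency (0, 1) and its opposite each have weight 1/2 in the norm. *)
Lemma first_mode_decreases : pi^-1 ^+ 2 - eps ^+ 2 <= 4^-1 *
  \int[P22]_w `|cos (2 * pi * (gap w).2) - cos (2 * pi * (gapY w).2)|.
Proof.
pose co (z : R * R) : R := cos (2 * pi * z.2).
have bco : bounded_measurable (co : T2 R -> R).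
  have [m _] := @bounded_cos_snd R (2 * pi) 0.
  split; last by exists 1 => z; exact: cos_max.
  by rewrite (_ : co = fun z => cos (2 * pi * z.2 + 0)) //; apply/funext => z; rewrite /co addr0.
have phE k (z : R * R) : phase (0, k) z = 2 * pi * k%:~R * z.2 by rewrite /phase/= mul0r add0r mulrA.
have phN (z : R * R) : phase (0, -1) z = - phase (0, 1) z by rewrite !phE mulrNz; ring.
have coE (z : R * R) : cos (phase (0, 1) z) = co z by rewrite phE mulr1.
have ampE : \int[P22]_w (f w.1 * f w.2 * co (gap w)) = amplitude f (0, 1).
  rewrite -(integral_pair_mode integrable_image (0, 1)).
  by apply: eq_Rintegral => w _; rewrite coE.
(* f is real *)
have ampN : amplitude f (0, -1) = amplitude f (0, 1).
  rewrite /amplitude; congr (_ ^+ 2 + _).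
    by apply: eq_Rintegral => x _; rewrite phN cosN.
  rewrite -sqrrN; congr (_ ^+ 2).
  have i : intg2 (fun x => f x * sin (phase (0, -1) x)).
    by apply: integrableM_bounded; [exact: integrable_image|exact: bounded_sin_phase].
  rewrite -mulN1r -RintegralZl//; apply: eq_Rintegral => x _.
  by rewrite phN sinN mulrN mulN1r opprK.
have amp1 : amplitude f (0, 1) <= eps ^+ 2.
  have us : uniq [:: ((0, 1) : int * int); (0, -1)] by [].
  have := sum_amplitude_le integrable_image eps0 us Hf.
  rewrite !big_cons big_nil/= ampN mulrNz sqrrN expr0n expr1n/= add0r addr0.
  by move: (amplitude _ _) => a; rewrite (_ : 1 + 1 = 2 :> R)//; lra.
have hi := bounded_measurable_integrable P2 bounded_half_strip.
have amp0 : pi^-1 ^+ 2 <= \int[P22]_w ((half_strip w.1 - 2^-1) * (half_strip w.2 - 2^-1) * co (gap w)).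
  rewrite [leRHS](_ : _ = amplitude (fun x => half_strip x - 2^-1) (0, 1)); last first.
    by rewrite -(integral_pair_mode hi (0, 1)); apply: eq_Rintegral => w _; rewrite coE.
  rewrite /amplitude [in X in _ <= _ + X](_ : Rintegral _ _ _ = pi^-1); first by rewrite lerDr sqr_ge0.
  by rewrite -strip_sine; apply: eq_Rintegral => x _; rewrite phE mulr1.
have bp : bounded_measurable ((fun w => (half_strip w.1 - 2^-1) * (half_strip w.2 - 2^-1)) : TT R -> R).
  have [m [M hM]] := bounded_half_strip.
  apply: bounded_measurableM.
  - by split; [exact: (measurableT_comp m measurable_fst)|exists M => w; exact: hM].
  - by split; [exact: (measurableT_comp m measurable_snd)|exists M => w; exact: hM].
have b1 := bounded_measurableM bp (bounded_gap bco).
have b2 := bounded_measurableM bp (bounded_gapY bco).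
have bdif : bounded_measurable ((fun w => `|co (gap w) - co (gapY w)|) : TT R -> R).
  have [m1 _] := bounded_gap bco; have [m2 _] := bounded_gapY bco.
  split; first by apply: measurableT_comp => //; exact: measurable_funB.
  exists 2 => w; rewrite normr_id (le_trans (ler_normB _ _))//.
  by rewrite (_ : 2 = 1 + 1 :> R)// lerD ?cos_max//.
apply: (@le_trans _ _ (\int[P22]_w ((half_strip w.1 - 2^-1) * (half_strip w.2 - 2^-1) * co (gap w)) -
   \int[P22]_w ((half_strip w.1 - 2^-1) * (half_strip w.2 - 2^-1) * co (gapY w)))).
  by rewrite -(pair_image bco) ampE lerB.
have i1 := bounded_measurable_integrable P22 b1; have i2 := bounded_measurable_integrable P22 b2.
have i3 := bounded_measurable_integrable P22 bdif.
rewrite -RintegralB// -RintegralZl//; apply: le_Rintegral => //.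
- exact: integrable_realB.
- exact: integrable_realZ.
move=> [x y] _ /=; rewrite -mulrBr; apply: (le_trans (ler_norm _)); rewrite normrM ler_wpM2r//.
exact: strip_product_le.
Qed.

End mixing_by_a_measure_preserving_map.

Section choice_of_scale.
Context {R : realType}.

Lemma mixing_scale (eps : R) : 0 < eps < 4^-1 ->
  exists L : nat, 4 ^+ L * (4 * eps) <= 1 /\ `|ln eps| <= (L%:R + 2) * (2 * ln 2).
Proof.
move=> /andP[e0 e4]; have e4' : 0 < 4 * eps by rewrite mulr_gt0.
have ex : exists k, 1 < 4 ^+ k * (4 * eps).
  exists (Num.truncn (4 * eps)^-1).+1.
  rewrite -ltr_pdivrMr// mul1r (lt_le_trans (truncnS_gt _))//.
  by rewrite -natrX ler_nat ltnW// ltn_expl.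
case: (ex_minnP ex) => -[|L] hL min.
  by move: hL; rewrite expr0 mul1r => h; lra.
exists L; split; first by rewrite leNgt; apply/negP => /min; rewrite ltnn.
have eps1 : eps < 1 by lra.
rewrite ltr0_norm ?ln_lt0 ?e0// -lnV ?posrE//.
have -> : (L%:R + 2) * (2 * ln 2) = ln (4 ^+ L.+2) :> R.
  rewrite lnXn// (_ : 4 = 2 ^+ 2 :> R) ?lnXn//; last by ring.
  by rewrite -(mulr_natr (ln 2 *+ 2)) -(mulr_natr (ln 2)) -[in RHS]addn2 natrD; ring.
rewrite ler_ln ?posrE ?invr_gt0// ?exprn_gt0//.
rewrite -[leLHS]mul1r ler_pdivrMr// exprSr -mulrA.
exact: ltW.
Qed.

End choice_of_scale.

Section lower_bounds.
Context {R : realType}.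
Local Notation TT R := (T2 R * T2 R)%type.
Variables (p eps : R) (v X : R -> R * R -> R * R).
Variables (Dv : R -> R * R -> (R * R) * (R * R)) (f : R * R -> R).
Hypotheses (p1 : 1 < p) (eps0 : 0 <= eps).
Hypotheses (vf : velocity_field v Dv) (fX : measure_preserving_flow v X).
Let Y x := torus_flow X (1, x).
Hypotheses (mf : measurable_fun (setT : set (T2 R)) f).
Hypotheses (hf : {ae P2, forall x, f (Y x) = half_strip x - 2^-1}).
Hypothesis Hf : (Hm1_norm f <= eps%:E)%E.

Let I1 : I01 (1 : R). Proof. by rewrite /I01/= in_itv/= lexx ler01. Qed.
Let pY : preserves P2 P2 (Y : T2 R -> T2 R) := preserves_flow fX I1.
Let pi0 : 0 < pi :> R := @pi_gt0 R.
Let lip0 : 0 < lip_cst p := lip_cst_gt0 p1.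

(** The weight has mass at least 1/4 as n eps <= 1/4; removing 1/8 of it leaves a mean of
    ln (1 + 2^L / 32) / 8 for the initial separation. *)
Lemma logarithmic_lower_bound L : 4 ^+ L * (4 * eps) <= 1 ->
  (((16 * pi * lip_cst p)^-1 * (8^-1 * ((L%:R - 5) * ln 2) - 2))%:E <=
   \int[leb R]_(t in I01) Lp_norm p (Dv t))%E.
Proof.
move=> Leps; pose n := (4 ^ L)%N; pose d : R := 2 ^- L.
have n0 : (0 < n)%N by rewrite expn_gt0.
have d0 : 0 < d by rewrite invr_gt0 exprn_gt0.
have nE : n%:R = 4 ^+ L :> R by rewrite natrX.
have nd : n%:R * d ^+ 2 = 1.
  by rewrite nE /d exprVn -exprM mulnC exprM (_ : 2 ^+ 2 = 4 :> R) ?mulfV ?expf_neq0//; ring.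
pose D w := ln (1 + torus_gauge (gap w) / d) - ln (1 + torus_gauge (gap (Y w.1, Y w.2)) / d).
have b1 := bounded_gap (log_gauge_bounded d0).
have b2 := bounded_gapY pY (log_gauge_bounded d0).
have bW := mix_weight_bounded pY n.
have bD : bounded_measurable (D : TT R -> R).
  have := bounded_measurableD b1 (bounded_measurableM (bounded_measurable_cst (TT R) (-1)) b2).
  by rewrite (_ : (fun w => _) = D)//; apply/funext => w; rewrite mulN1r.
have c0 : 0 < 2 * pi :> R by rewrite mulr_gt0.
have hD x y : trajectory v X x -> trajectory v X y ->
    ((D (x, y))%:E <= (2 * pi)%:E * \int[P1]_r (stretch_along v X (2 ^- L) r (x, y))%:E)%E.
  move=> hx hy; have := log_separation_le vf fX hx hy d0.
  rewrite -(torus_gauge_flow hx hy I1) -/(gap (x, y)) -/(gap (Y x, Y y)).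
  (* the terms ln d cancel *)
  have lnd z : ln (d + torus_gauge z) = ln d + ln (1 + torus_gauge z / d).
    rewrite -lnM ?posrE//; last by rewrite ltr_pwDl// divr_ge0 ?torus_gauge_ge0// ltW.
    by congr ln; field; rewrite gt_eqF.
  by rewrite !lnd opprD addrACA subrr add0r.
apply: le_trans (weighted_pathwise_bound vf fX p1 (mix_pair_weight pY n0) bW bD c0 hD).
rewrite lee_fin (_ : 16 * pi * lip_cst p = 2 * pi * (8 * lip_cst p)); last by ring.
apply: ler_wpM2l; first by rewrite invr_ge0 ltW// (mulr_gt0 c0)// mulr_gt0.
have i1 := bounded_measurable_integrable P22 (bounded_measurableM bW b1).
have i2 := bounded_measurable_integrable P22 (bounded_measurableM bW b2).
have -> : \int[P22]_w (mix_weight Y n w * D w) =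
    \int[P22]_w (mix_weight Y n w * ln (1 + torus_gauge (gap w) / d)) -
    \int[P22]_w (mix_weight Y n w * ln (1 + torus_gauge (gap (Y w.1, Y w.2)) / d)).
  by rewrite -RintegralB//; apply: eq_Rintegral => w _; rewrite mulrBr.
have up := mix_log_image_le pY n0 d0 nd.
have low := mix_log_ge pY n0 d0.
have mass := mix_weight_mass pY mf hf eps0 Hf n0.
have n2 : n%:R ^+ 2 * eps ^+ 2 <= 16^-1.
  have : n%:R * (4 * eps) <= 1 by rewrite nE.
  rewrite mulrA (mulrC _ 4) -mulrA -exprMn => h.
  have h0 : 0 <= n%:R * eps by rewrite mulr_ge0.
  rewrite (_ : 16^-1 = 4^-1 ^+ 2); last by field.
  by rewrite ler_pXn2r ?nnegrE//; lra.
have mass8 : 8^-1 <= \int[P22]_w mix_weight Y n w - 8^-1.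
  move: mass n2; rewrite -[4 * _ * _]mulrA; move: (_ ^+ 2 * _ ^+ 2) (Rintegral _ _ _) => c I; lra.
have ld : (L%:R - 5) * ln 2 <= ln (1 + (32 * d)^-1).
  have -> : (L%:R - 5) * ln 2 = ln ((32 * d)^-1) :> R.
    rewrite lnV ?posrE ?mulr_gt0// lnM ?posrE// /d lnV ?posrE ?exprn_gt0// lnXn//.
    rewrite (_ : 32 = 2 ^+ 5 :> R) ?lnXn//; last by ring.
    by rewrite -(mulr_natr (ln 2) 5) -(mulr_natr (ln 2) L); ring.
  by rewrite ler_ln ?posrE ?lerDr ?invr_gt0 ?mulr_gt0// addr_gt0// invr_gt0 mulr_gt0.
have l0 : 0 <= ln (1 + (32 * d)^-1) by rewrite ln_ge0// lerDl invr_ge0 mulr_ge0// ltW.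
have := ler_wpM2l l0 mass8; move: low up ld.
set A := Rintegral _ _ _; set B := Rintegral _ _ _; set E := ln (1 + _).
set J := \int[P22]_w mix_weight Y n w; set q := (L%:R - 5) * ln 2.
by move: A B E J q => A B E J q; lra.
Qed.

Lemma universal_lower_bound : eps <= 4^-1 ->
  (((12 * pi * lip_cst p)^-1 * (pi^-1 ^+ 2 - 16^-1))%:E <=
   \int[leb R]_(t in I01) Lp_norm p (Dv t))%E.
Proof.
move=> eps4.
pose D w : R := `|cos (2 * pi * (gap w).2) - cos (2 * pi * (gap (Y w.1, Y w.2)).2)|.
pose W (w : (R * R) * (R * R)) : R := 1.
have bW : bounded_measurable (W : TT R -> R) by exact: bounded_measurable_cst.
have hW : pair_weight W.
  split=> //; first by have [] := bW.
    by move=> x; rewrite /W (integral_cst P2 measurableT) mul1e; exact: probability_le1.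
  by move=> x; rewrite /W (integral_cst P2 measurableT) mul1e; exact: probability_le1.
pose co (z : R * R) : R := cos (2 * pi * z.2).
have bco : bounded_measurable (co : T2 R -> R).
  have [m _] := @bounded_cos_snd R (2 * pi) 0.
  split; last by exists 1 => z; exact: cos_max.
  by rewrite (_ : co = fun z => cos (2 * pi * z.2 + 0))//; apply/funext => z; rewrite /co addr0.
have bD : bounded_measurable (D : TT R -> R).
  have [m1 _] := bounded_gap bco; have [m2 _] := bounded_gapY pY bco.
  split; first by apply: measurableT_comp => //; exact: measurable_funB.
  exists 2 => w; rewrite normr_id (le_trans (ler_normB _ _))//.
  by rewrite (_ : 2 = 1 + 1 :> R)// lerD ?cos_max//.
have c0 : 0 < 6 * pi :> R by rewrite mulr_gt0.
have hD x y : trajectory v X x -> trajectory v X y ->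
    ((D (x, y))%:E <= (6 * pi)%:E * \int[P1]_r (stretch_along v X (2 ^- 0) r (x, y))%:E)%E.
  move=> hx hy; rewrite expr0 invr1; apply: le_trans (cos_separation_le vf fX hx hy).
  have [Qx _ _ _] := hx; have [Qy _ _ _] := hy.
  rewrite lee_fin /D/= [X in `|_ - X|](_ : _ = cos (2 * pi * (separation X x y 1).2))//.
  rewrite /Y /torus_flow/= !mem_set//= /fr1.
  set a := (X 1 x).2; set b := (X 1 y).2.
  by rewrite -[RHS](cos_period (Num.floor b - Num.floor a)) rmorphB/=; congr cos; ring.
apply: le_trans (weighted_pathwise_bound vf fX p1 hW bW bD c0 hD).
have := first_mode_decreases pY mf hf eps0 Hf.
rewrite lee_fin [X in _ <= _ * X -> _](_ : _ = \int[P22]_w (W w * D w)); last first.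
  by apply: eq_Rintegral => w _; rewrite mul1r.
move: (Rintegral _ _ _) => I h.
rewrite (_ : 6 * pi * (8 * lip_cst p) = 12 * pi * lip_cst p * 4); last by ring.
rewrite [X in _ <= X * _](invfM (12 * pi * lip_cst p)) -[leRHS]mulrA; apply: ler_wpM2l; first by rewrite invr_ge0 ltW// mulr_gt0// mulr_gt0.
apply: le_trans h; rewrite lerD2l lerN2 (_ : 16^-1 = 4^-1 ^+ 2); last by field.
by rewrite ler_pXn2r ?nnegrE.
Qed.

End lower_bounds.

Unset Implicit Arguments.

Theorem corollary1p2 (R : realType) (p : R) (hp : 1 < p) :
  exists2 C : R, 0 < C &
    forall (eps : R) (v : R -> R * R -> R * R)
           (Dv : R -> R * R -> (R * R) * (R * R)) (rho : R -> R * R -> R),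
      0 < eps < 4^-1 ->
      velocity_field v Dv ->
      unique_and_transported v half_strip ->
      transport_solution v half_strip rho ->
      (Hm1_norm (fun x => (rho 1%R x - 2^-1)%R) <= eps%:E)%E ->
      ((C * `|ln eps|)%:E <= \int[leb R]_(t in I01) Lp_norm p (Dv t))%E.
Proof.
have pi0 : 0 < pi :> R := pi_gt0 R; have lip0 := lip_cst_gt0 hp.
pose K1 := 16 * pi * lip_cst p; pose K2 := 12 * pi * lip_cst p.
have K10 : 0 < K1 by rewrite mulr_gt0// mulr_gt0.
have K20 : 0 < K2 by rewrite mulr_gt0// mulr_gt0.
pose c0 : R := pi^-1 ^+ 2 - 16^-1.
have c00 : 0 < c0.
  have pi4 : pi < 4 :> R by have := @pihalf_lt2 R; lra.
  rewrite subr_gt0 (_ : 16^-1 = 4^-1 ^+ 2); last by field.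
  by rewrite ltr_pXn2r ?nnegrE ?invr_ge0 ?(ltW pi0)// ltf_pV2 ?posrE.
have ln20 : 0 < ln 2 :> R by rewrite ln_gt0// ltr1n.
(* the additive constant left by the logarithmic bound is absorbed by the universal one *)
pose C' := 16 * K1 + (32 + 14 * ln 2) * (K2 / c0).
have s0 : 0 < 32 + 14 * ln 2 :> R by apply: addr_gt0 => //; exact: mulr_gt0.
have C'0 : 0 < C' by apply: addr_gt0; apply: mulr_gt0 => //; exact: divr_gt0.
exists C'^-1; first by rewrite invr_gt0.
move=> eps v Dv rho heps vf [_ [X fX tr]] sol hm.
have [L [hL hln]] := mixing_scale heps.
have /andP[e0 e4] := heps.
have I1 : I01 (1 : R) by rewrite /I01/= in_itv/= lexx ler01.
have [per mrho _ _ _] := sol.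
pose f x := rho 1 x - 2^-1.
have mf : measurable_fun (setT : set (T2 R)) f.
  by apply: measurable_funB => //; exact: (measurable_time_slice I1 mrho).
have hf : {ae P2, forall x, f (torus_flow X (1, x)) = half_strip x - 2^-1}.
  apply: (ae_imp (ae_and ae_Q (ae_P2 (tr _ sol _ I1)))) => x [Qx hx].
  by rewrite /f /torus_flow mem_set//= (periodic_fr _ (per 1)) hx.
have lbA := logarithmic_lower_bound hp (ltW e0) vf fX mf hf hm hL.
have lbB := universal_lower_bound hp (ltW e0) vf fX mf hf hm (ltW e4).
case: (\int[leb R]_(t in I01) Lp_norm p (Dv t))%E lbA lbB => [i| |]; rewrite ?leey//.
rewrite !lee_fin -/K1 -/K2 -/c0 => lbA lbB.
rewrite ler_pdivrMl//; apply: (le_trans hln).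
have a1 : 8^-1 * ((L%:R - 5) * ln 2) - 2 <= K1 * i by rewrite -ler_pdivrMl.
have b1 : 1 <= K2 / c0 * i.
  by rewrite mulrAC ler_pdivlMr// mul1r; move: lbB; rewrite ler_pdivrMl.
have b2 : 32 + 14 * ln 2 <= (32 + 14 * ln 2) * (K2 / c0 * i).
  by rewrite ler_peMr// ltW.
have -> : C' * i = 16 * (K1 * i) + (32 + 14 * ln 2) * (K2 / c0 * i).
  by rewrite /C' mulrDl !mulrA.
move: a1 b2; move: (K1 * i) (_ * (K2 / c0 * i)) => A B.
by rewrite mulrBl mulrDl !mulrA; lra.
Qed.
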